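(* Let $\Gamma_9$ be the orientation-preserving index-two subgroup of the group generated by the reflections in the faces of the compact hyperbolic tetrahedron $T_9[2,3,5;2,3,5]$. Then the turnover subgroups of $\Gamma_9$ are $T(3,5,5)$ and $T(5,5,5)$; that is, for integers $2\le p\le q\le r$ with $\frac1p+\frac1q+\frac1r<1$, the group $\Gamma_9$ contains a subgroup isomorphic to $T(p,q,r)$ if and only if $(p,q,r)\in\{(3,5,5),(5,5,5)\}$.
   Context: For integers $2\le p\le q\le r$ with $\frac1p+\frac1q+\frac1r<1$, the turnover group $T(p,q,r)$ is the index-two orientation-preserving subgroup of the group generated by reflections in the sides of the hyperbolic triangle with angles $\pi/p,\pi/q,\pi/r$ (the orientation-preserving triangle group). A turnover subgroup of a Kleinian group is a subgroup isomorphic to some such $T(p,q,r)$. $T_i[l_1,l_2,l_3;m_1,m_2,m_3]$ denotes the compact tetrahedron $ABCD$ in $\mathbb{H}^3$ whose dihedral angles at the edges $AB,BC,AC,CD,AD,BD$ are, in this order, $\pi/l_1,\pi/l_2,\pi/l_3,\pi/m_1,\pi/m_2,\pi/m_3$. Thus $T_9$ has dihedral angles $\pi/2$ at $AB$ and $CD$, $\pi/3$ at $BC$ and $AD$, and $\pi/5$ at $AC$ and $BD$. *)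

(* Defs.v *)
From HB Require Import structures.
From mathcomp Require Export all_boot all_order all_algebra.
From mathcomp Require Export all_classical all_reals all_analysis.

Set Implicit Arguments.
Unset Strict Implicit.
Unset Printing Implicit Defensive.

Import Order.TTheory GRing.Theory Num.Theory.

Local Open Scope classical_set_scope.
Local Open Scope ring_scope.

(** Possibly infinite groups of invertible elements of a ring. *)

Definition is_subgroup (A : unitRingType) (G : set A) : Prop :=
  [/\ G `<=` [set x | x \is a GRing.unit], G 1,
      (forall x y, G x -> G y -> G (x * y)) & (forall x, G x -> G x^-1)].

Definition generated_group (A : unitRingType) (S : set A) : set A :=
  smallest (@is_subgroup A) S.

Definition isomorphic (A B : unitRingType) (G : set A) (H : set B) : Prop :=
  exists2 f : A -> B, set_bij G H f &
    forall x y, G x -> G y -> f (x * y) = f x * f y.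

Definition contains_copy_of (A B : unitRingType) (G : set A) (K : set B) :
    Prop :=
  exists H : set A, [/\ is_subgroup H, H `<=` G & isomorphic H K].

(** The hyperboloid model of hyperbolic n-space in R^n.+1, coordinate 0 being
    the timelike one. *)

Definition lorentz (R : realType) (n : nat) (x y : 'rV[R]_n.+1) : R :=
  - (x 0 ord0 * y 0 ord0) +
  \sum_(i < n) x 0 (lift ord0 i) * y 0 (lift ord0 i).

Definition hyperbolic_space (R : realType) (n : nat) : set 'rV[R]_n.+1 :=
  [set x | lorentz x x = -1 /\ 0 < x 0 ord0].

(** A compact hyperbolic n-simplex, given by its vertices, which are not
    contained in a common hyperplane of hyperbolic space. *)
Record hsimplex (R : realType) (n : nat) := HSimplex {
  vertex :> 'I_n.+1 -> 'rV[R]_n.+1 ;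
  vertex_hyperbolic : forall i, hyperbolic_space (vertex i) ;
  vertex_free : row_free (\matrix_i vertex i)
}.

Definition is_outward_normal (R : realType) (n : nat) (T : hsimplex R n)
    (i : 'I_n.+1) (u : 'rV[R]_n.+1) : Prop :=
  [/\ lorentz u u = 1, (forall j, j != i -> lorentz u (T j) = 0) &
      lorentz u (T i) < 0].

(** Outward unit normal of the facet opposite to vertex i.  There is exactly
    one, so the default value 0 is never used. *)
Definition facet_normal (R : realType) (n : nat) (T : hsimplex R n)
    (i : 'I_n.+1) : 'rV[R]_n.+1 :=
  xget 0 [set u | is_outward_normal T i u].

(** Interior dihedral angle between the facets opposite to the vertices
    i != j, i.e. pi minus the angle between their outward normals.  For n = 2
    it is the angle of the triangle at the third vertex. *)
Definition dihedral_angle (R : realType) (n : nat) (T : hsimplex R n)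
    (i j : 'I_n.+1) : R :=
  acos (- lorentz (facet_normal T i) (facet_normal T j)).

(** Matrices act on row vectors on the right. *)
Definition reflection_mx (R : realType) (n : nat) (u : 'rV[R]_n.+1) :
    'M[R]_n.+1 :=
  lin1_mx (fun x : 'rV[R]_n.+1 => x - (2 * lorentz x u) *: u).

Definition reflection_group (R : realType) (n : nat) (T : hsimplex R n) :
    set 'M[R]_n.+1 :=
  generated_group [set reflection_mx (facet_normal T i) | i in [set: 'I_n.+1]].

(** A Lorentz transformation preserving the upper sheet of the hyperboloid is
    an orientation-preserving isometry exactly when it has determinant 1. *)
Definition rotation_group (R : realType) (n : nat) (T : hsimplex R n) :
    set 'M[R]_n.+1 :=
  reflection_group T `&` [set M | \det M = 1].

Definition is_triangle (R : realType) (T : hsimplex R 2) (p q r : nat) : Prop :=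
  [/\ dihedral_angle T 1 2 = pi / p%:R,
      dihedral_angle T 0 2 = pi / q%:R &
      dihedral_angle T 0 1 = pi / r%:R].

(** The vertices A, B, C, D are numbered 0, 1, 2, 3.  The faces meeting along
    an edge are those opposite to the two vertices not on that edge. *)
Definition is_tetrahedron (R : realType) (T : hsimplex R 3)
    (l1 l2 l3 m1 m2 m3 : nat) : Prop :=
  let A : 'I_4 := 0 in let B : 'I_4 := 1 in
  let C : 'I_4 := 2 in let D : 'I_4 := 3 in
  [/\ (* AB *) dihedral_angle T C D = pi / l1%:R,
      (* BC *) dihedral_angle T A D = pi / l2%:R &
      (* AC *) dihedral_angle T B D = pi / l3%:R] /\
  [/\ (* CD *) dihedral_angle T A B = pi / m1%:R,
      (* AD *) dihedral_angle T B C = pi / m2%:R &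
      (* BD *) dihedral_angle T A C = pi / m3%:R].

(** G contains a subgroup isomorphic to the turnover group T(p,q,r).  The
    triangle with angles pi/p, pi/q, pi/r is unique up to isometry, so the
    choice of Delta is immaterial. *)
Definition has_turnover_subgroup (R : realType) (n : nat)
    (G : set 'M[R]_n.+1) (p q r : nat) : Prop :=
  exists2 Delta : hsimplex R 2, is_triangle Delta p q r &
    contains_copy_of G (rotation_group Delta).

(* Main.v *)
(** In the basis of outward unit normals the reflections act by matrices over
    Z[phi], phi the golden ratio, and generate a Coxeter group.  By Tits, two words
    acting equally are equivalent under the braid relations, and an element of finite
    order is conjugate into a vertex stabilizer.  All vertex groups are icosahedral, so
    rotations have order 2, 3 or 5, which leaves the triples (2,5,5), (3,3,5), (3,5,5)
    and (5,5,5).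

    Let x, y be the standard generators of a copy of T(2,5,5) or T(3,3,5), lifted to
    SL_2(C).  By Fricke's identity, either the commutator of x and y has trace 1 or -1,
    hence order 3, which does not happen in a hyperbolic triangle group, or the traces
    are too special.  For (2,5,5), y and xy would have equal traces as Lorentz matrices;
    modulo 2, the group acts through A_5 on a family of totally singular planes, the
    trace of a rotation of order 5 determines the class of its image, and A_5 contains no
    element of order 2 whose product with a 5-cycle y is a 5-cycle conjugate to y.  For
    (3,3,5), the trace of x y^-1 would be 1 modulo sqrt 5; but there the group acts
    through A_5 on a 3-dimensional quotient, and the orders 3, 3, 5 force trace 4.

    Conversely, T(3,5,5) and T(5,5,5) are generated by products of reflections in three
    roots whose Gram matrix is that of the triangle: e_C, e_D s_B, e_A in the first case
    and e_C, e_D s_A s_C s_B, e_A in the second. *)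
From Stdlib Require Import ZArith.
From HB Require Import structures.
From mathcomp Require Import complex.
Require Import Defs.
From mathcomp Require Import all_boot all_order all_algebra.
From mathcomp Require Import all_classical all_reals all_analysis.
From mathcomp Require Import ring lra ssrZ zify.
Set Implicit Arguments.
Unset Strict Implicit.
Unset Printing Implicit Defensive.
Import Order.TTheory GRing.Theory Num.Theory.
Local Open Scope ring_scope.

(** * Coxeter groups with labels 2, 3 and 5 *)

(** Orders of elements alone exclude neither (2,5,5) nor (3,3,5): both triples occur in A_5. There,
    however, such a pair has a commutator of order 3, and its absence in a hyperbolic triangle group
    forces the lifts onto the other branch of Fricke's identity, where a trace is pinned down. That
    trace is then refuted in a finite quotient. For orders to be kept in the quotients, nontrivial
    torsion must survive there; this is checked on the four vertex groups, of order 120 each.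

    The two quotients are built differently. Modulo sqrt 5 the matrices themselves are reduced, and
    phi coincides with its conjugate, so both possible traces for (3,3,5) give one residue. The
    permutations of planes are given only on generators; that a matrix determines its permutation is
    the Coxeter presentation, which is why Tits' argument is carried out for an arbitrary action
    satisfying the braid relations. *)

Section Coxeter.
Context {R : comNzRingType} {n : nat}.
Implicit Types (B : 'M[R]_n.+1) (i j s t : 'I_n.+1) (w u : seq 'I_n.+1).

Definition vec i : 'rV[R]_n.+1 := delta_mx 0 i.

(** [B] is twice a Gram matrix, so [v] goes to [v - (v B)_i e_i]. This form of the reflection, in
    the basis of roots, needs no division and makes sense over any ring, in particular over F_5. *)
Definition cox_refl B i : 'M[R]_n.+1 := 1%:M - col i B *m vec i.

Definition cox_word B w : 'M[R]_n.+1 := \prod_(i <- w) cox_refl B i.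

Lemma mul_cox_refl B v i :
  v *m cox_refl B i = v - (v *m B) 0 i *: vec i.
Proof.
rewrite /cox_refl mulmxBr mulmx1 mulmxA; congr (_ - _).
apply/rowP => k; rewrite mxE big_ord1 !mxE; congr (_ * _).
by apply: eq_bigr => j _; rewrite mxE.
Qed.

Lemma cox_word_cons B i w : cox_word B (i :: w) = cox_refl B i *m cox_word B w.
Proof. by rewrite /cox_word big_cons. Qed.

Lemma cox_word_cat B w u : cox_word B (w ++ u) = cox_word B w *m cox_word B u.
Proof. by rewrite /cox_word big_cat. Qed.

Lemma cox_word_nil B : cox_word B [::] = 1%:M.
Proof. by rewrite /cox_word big_nil. Qed.

Fixpoint alternating i j k := if k is k'.+1 then i :: alternating j i k' else [::].

Lemma size_alternating i j k : size (alternating i j k) = k.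
Proof. by elim: k i j => //= k IH i j; rewrite IH. Qed.

Lemma alternating_cat i j k l :
  alternating i j (k + l) =
  alternating i j k ++ (if odd k then alternating j i l else alternating i j l).
Proof. by elim: k i j => //= k IH i j; rewrite IH; case: (odd k). Qed.

Lemma eq_mulmx_row (M N : 'M[R]_n.+1) : (forall v : 'rV_n.+1, v *m M = v *m N) -> M = N.
Proof. by move=> MN; apply/row_matrixP => k; rewrite !rowE MN. Qed.

End Coxeter.
Arguments vec {R n} i.

(** * Tits' theorem on the geometric representation *)

Section Tits.
Context {R : realFieldType} {n : nat}.
Variables (phi : R) (B : 'M[R]_n.+1).
Hypothesis phi2 : phi * phi = phi + 1.
Hypothesis phi_gt0 : 0 < phi.
Hypothesis Bdiag : forall i, B i i = 2.
Hypothesis Bsym : forall i j, B i j = B j i.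
Hypothesis Boff : forall i j, i != j -> [\/ B i j = 0, B i j = -1 | B i j = - phi].
Implicit Types (i j s t : 'I_n.+1) (w u : seq 'I_n.+1).

(** The off-diagonal entries are [-2 cos (pi / m)], that is 0, -1 and [- phi] for m = 2, 3, 5. *)
Definition cox_order i j := if B i j == 0 then 2%N else if B i j == -1 then 3%N else 5%N.

Lemma vecB i j : (vec i *m B) 0 j = B i j.
Proof. by rewrite -rowE mxE. Qed.

Lemma refl_comb v x y i j :
  (v + x *: vec i + y *: vec j) *m cox_refl B i =
  v + (- x - (v *m B) 0 i - B i j * y) *: vec i + y *: vec j.
Proof.
rewrite mul_cox_refl !mulmxDl -!scalemxAl.
rewrite ![(_ + _ : 'rV_n.+1) 0 _]mxE ![(_ *: _ : 'rV_n.+1) 0 _]mxE !vecB Bdiag (Bsym j i).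
apply/rowP => k; rewrite !mxE; ring.
Qed.

Lemma refl_comb' v x y i j :
  (v + x *: vec i + y *: vec j) *m cox_refl B j =
  v + x *: vec i + (- y - (v *m B) 0 j - B i j * x) *: vec j.
Proof.
rewrite mul_cox_refl !mulmxDl -!scalemxAl.
rewrite ![(_ + _ : 'rV_n.+1) 0 _]mxE ![(_ *: _ : 'rV_n.+1) 0 _]mxE !vecB Bdiag.
apply/rowP => k; rewrite !mxE; ring.
Qed.

Lemma phi_neq1 : phi != 1 /\ phi != 0.
Proof. by split; apply/eqP => H; move: phi2; rewrite H; lra. Qed.

Lemma cox_order_cases i j : i != j ->
  [\/ B i j = 0 /\ cox_order i j = 2%N, B i j = -1 /\ cox_order i j = 3%N
    | B i j = - phi /\ cox_order i j = 5%N].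
Proof.
have [p1 p0] := phi_neq1.
rewrite /cox_order => /Boff [] ->.
- by rewrite eqxx; constructor 1.
- by rewrite oppr_eq0 oner_eq0 eqxx; constructor 2.
- by rewrite oppr_eq0 (negbTE p0) eqr_opp (negbTE p1); constructor 3.
Qed.

Lemma cox_order_sym i j : cox_order i j = cox_order j i.
Proof. by rewrite /cox_order Bsym. Qed.

Lemma cox_word_braid i j : i != j ->
  cox_word B (alternating i j (cox_order i j)) =
  cox_word B (alternating j i (cox_order i j)).
Proof.
move=> ij; apply: eq_mulmx_row => v.
(* Both reflections preserve the shape [v + x e_i + y e_j] with [v] fixed, so the braid relation
   becomes an identity between two coefficients. *)
have -> : v = v + 0 *: vec i + 0 *: vec j by rewrite !scale0r !addr0.
set v0 := v in |- *.
have [] := cox_order_cases ij => -[eB ->] /=;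
  rewrite !cox_word_cons !cox_word_nil !mulmxA !mulmx1;
  rewrite !(refl_comb, refl_comb') eB; apply/rowP => k; rewrite !mxE.
- ring.
- ring.
- ring: phi2.
Qed.

(** The only coefficients that occur are 0, 1 and [phi], so rank two is settled by running through
    the at most five lengths. *)
Lemma dihedral_nonneg s t k : s != t -> (k < cox_order s t)%N ->
  exists a b, [/\ 0 <= a, 0 <= b &
    vec s *m cox_word B (alternating t s k) = a *: vec s + b *: vec t].
Proof.
move=> st.
have stepT x y : (x *: vec s + y *: vec t) *m cox_refl B t =
    x *: vec s + (- y - B s t * x) *: vec t.
  by rewrite -[x *: vec s]add0r refl_comb' mul0mx mxE subr0.
have stepS x y : (x *: vec s + y *: vec t) *m cox_refl B s =
    (- x - B s t * y) *: vec s + y *: vec t.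
  by rewrite -[x *: vec s]add0r refl_comb mul0mx mxE subr0 !add0r.
have E : vec s = (1 : R) *: vec s + 0 *: vec t by rewrite scale1r scale0r addr0.
have fin x y : 0 <= x -> 0 <= y ->
    exists a b, [/\ 0 <= a, 0 <= b & x *: vec s + y *: vec t = a *: vec s + b *: vec t].
  by move=> x0 y0; exists x, y.
have ge0_0 (x : R) : x = 0 -> 0 <= x by move=> ->.
have ge0_1 (x : R) : x = 1 -> 0 <= x by move=> ->.
have ge0_p x : x = phi -> 0 <= x by move=> ->; exact: ltW.
have [] := cox_order_cases st => -[eB ->]; case: k => [|[|[|[|[|k]]]]] //= _;
  rewrite ?cox_word_cons cox_word_nil ?mulmxA mulmx1 {1}E ?stepT ?stepS ?stepT ?stepS ?stepT ?eB;
  apply: fin; first [apply: ge0_0; ring: phi2 | apply: ge0_1; ring: phi2 | apply: ge0_p; ring: phi2].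
Qed.

Definition nonneg (v : 'rV[R]_n.+1) := forall k, 0 <= v 0 k.

Lemma nonneg_comb a b x y : 0 <= a -> 0 <= b -> nonneg x -> nonneg y ->
  nonneg (a *: x + b *: y).
Proof. by move=> a0 b0 x0 y0 k; rewrite !mxE addr_ge0 ?mulr_ge0. Qed.

Section Action.
Variables (X : Type) (act : X -> 'I_n.+1 -> X).
Hypothesis act_invol : forall x i, act (act x i) i = x.
Hypothesis act_braid : forall x i j, i != j ->
  foldl act x (alternating i j (cox_order i j)) =
  foldl act x (alternating j i (cox_order i j)).

(** Instead of the congruence generated by the relations, [equiv] asks for equal matrices and equal
    actions. Tits' argument uses only that it is a congruence satisfying the relations, and its
    outcome is that the first half implies the second. *)
Definition equiv w u :=
  cox_word B w = cox_word B u /\ forall x, foldl act x w = foldl act x u.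

Lemma equiv_refl w : equiv w w. Proof. by []. Qed.

Lemma equiv_sym w u : equiv w u -> equiv u w.
Proof. by move=> [E1 E2]; split=> [|x]; rewrite (E1, E2). Qed.

Lemma equiv_trans w u v : equiv w u -> equiv u v -> equiv w v.
Proof.
move=> [E1 E2] [F1 F2]; split=> [|x]; first by rewrite E1 F1.
by rewrite E2 F2.
Qed.

Lemma equiv_cat w w' u u' : equiv w w' -> equiv u u' -> equiv (w ++ u) (w' ++ u').
Proof.
move=> [E1 E2] [F1 F2]; split; first by rewrite !cox_word_cat E1 F1.
by move=> x; rewrite !foldl_cat E2 F2.
Qed.

Lemma cox_refl_invol i : cox_refl B i *m cox_refl B i = 1%:M.
Proof.
apply: eq_mulmx_row => v; rewrite mulmxA mulmx1 !mul_cox_refl mulmxBl -scalemxAl.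
rewrite [(_ - _ : 'rV_n.+1) 0 _]mxE [(- _ : 'rV_n.+1) 0 _]mxE [(_ *: _ : 'rV_n.+1) 0 _]mxE.
rewrite vecB Bdiag; move: ((v *m B) 0 i) => c.
by apply/rowP => k; rewrite !mxE; ring.
Qed.

Lemma equiv_ii i : equiv [:: i; i] [::].
Proof.
split=> [|x /=]; last by rewrite act_invol.
by rewrite !cox_word_cons cox_word_nil mulmx1 cox_refl_invol.
Qed.

Lemma equiv_braid i j : i != j ->
  equiv (alternating i j (cox_order i j)) (alternating j i (cox_order i j)).
Proof. by move=> ij; split=> [|x]; [exact: cox_word_braid | exact: act_braid]. Qed.

Lemma equiv_cancel i w : equiv (i :: i :: w) w.
Proof. exact: (equiv_cat (equiv_ii i) (equiv_refl w)). Qed.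

Lemma len_exists w : exists k, `[< exists u, size u = k /\ equiv u w >].
Proof. by exists (size w); apply/asboolP; exists w. Qed.

Definition len w := ex_minn (len_exists w).

Lemma len_le u w : equiv u w -> (len w <= size u)%N.
Proof.
by move=> uw; rewrite /len; case: ex_minnP => k _; apply; apply/asboolP; exists u.
Qed.

Lemma len_reduced w : exists u, size u = len w /\ equiv u w.
Proof. by rewrite /len; case: ex_minnP => k /asboolP. Qed.

Lemma equiv_shorter s t u : all (fun i => (i == s) || (i == t)) u ->
  [\/ exists u', (size u' < size u)%N /\ equiv u' u,
      u = alternating s t (size u) | u = alternating t s (size u)].
Proof.
elim: u => [_|a u IH /= /andP [aP /IH {IH} [[u' [lt u'u]]|E|E]]].
- by constructor 2.
- by constructor 1; exists (a :: u'); split=> //; apply: (equiv_cat (equiv_refl [:: a])).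
- have /orP [/eqP ->|/eqP ->] := aP; last by constructor 3; rewrite {1}E.
  case: u E => [|b u] /=; first by constructor 2.
  move=> [-> _]; constructor 1; exists u; split; first by rewrite ltnS leqW.
  exact/equiv_sym/equiv_cancel.
- have /orP [/eqP ->|/eqP ->] := aP; first by constructor 2; rewrite {1}E.
  case: u E => [|b u] /=; first by constructor 3.
  move=> [-> _]; constructor 1; exists u; split; first by rewrite ltnS leqW.
  exact/equiv_sym/equiv_cancel.
Qed.

Lemma len_nil w : len w = 0%N -> equiv w [::].
Proof. by have [u [<- uw]] := len_reduced w => /size0nil E; apply: equiv_sym; rewrite -E. Qed.

(** Induction on the length. With [w] = [u v], where [u] is a word in [s] and another letter [t] and
    [v] is as short as possible, [v] keeps [e_s] and [e_t] nonnegative by induction, and [u] sends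
    [e_s] to a nonnegative combination of these two. *)
Theorem tits_nonneg w s : (len w <= len (s :: w))%N -> nonneg (vec s *m cox_word B w).
Proof.
have [N] := ubnP (len w); elim: N w s => // N IH w s wN sw.
have [w0|w_gt0] := posnP (len w).
  have [-> _] := len_nil w0; rewrite cox_word_nil mulmx1 => k.
  by rewrite mxE; case: (_ && _); rewrite ?ler01.
have [[|t w1] [sz w1w]] := len_reduced w; first by rewrite -sz in w_gt0.
have st : s != t.
  apply/eqP => E; have : (len (s :: w) <= size w1)%N.
    apply: len_le; apply: equiv_sym; apply: equiv_trans (equiv_cancel t w1).
    by rewrite E; apply: (equiv_cat (equiv_refl [:: t])); exact: equiv_sym.
  by move=> H; have := leq_trans sw H; rewrite -sz ltnn.
(* The second letter [t] begins a reduced word for [w]. The least [k] makes [v] a shortest element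
   of its coset of the dihedral group on [s] and [t]. *)
pose P k := `[< exists u v, [/\ all (fun i => (i == s) || (i == t)) u, equiv (u ++ v) w,
  (size u + len v = len w)%N & len v = k] >].
have lew a v : equiv (a ++ v) w -> (len w <= size a + len v)%N.
  have [v' [<- v'v]] := len_reduced v => avw.
  rewrite -size_cat; apply: len_le; apply: equiv_trans avw.
  exact: equiv_cat (equiv_refl a) v'v.
have Pex : exists k, P k.
  exists (len w1); apply/asboolP; exists [:: t], w1; split=> //=; first by rewrite eqxx orbT.
  apply/eqP; rewrite eqn_leq; apply/andP; split; last exact: (lew [:: t] w1 w1w).
  by rewrite -sz /= add1n ltnS; exact: len_le (equiv_refl w1).
case: (ex_minnP Pex) => k /asboolP [u [v [u_st uvw uv_len <-]]] kmin {k}.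
have vw : (len v < len w)%N.
  have : P (len w1).
    apply/asboolP; exists [:: t], w1; split=> //=; first by rewrite eqxx orbT.
    apply/eqP; rewrite eqn_leq; apply/andP; split; last exact: (lew [:: t] w1 w1w).
    by rewrite -sz /= add1n ltnS; exact: len_le (equiv_refl w1).
  move=> /kmin H; apply: leq_ltn_trans H _; rewrite -sz ltnS.
  exact: len_le (equiv_refl w1).
(* If [a :: v] were shorter than [v], the letter [a] could be moved into [u], against the minimality
   of [v]. *)
have vpos a : (a == s) || (a == t) -> nonneg (vec a *m cox_word B v).
  move=> ast; apply: IH; first exact: leq_trans vw _.
  rewrite leqNgt; apply/negP => av.
  have Hw : equiv (rcons u a ++ (a :: v)) w.
    apply: equiv_trans uvw; rewrite cat_rcons.
    by apply: equiv_cat (equiv_refl u) _; exact: equiv_cancel.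
  have : P (len (a :: v)).
    apply/asboolP; exists (rcons u a), (a :: v); split=> //; first by rewrite all_rcons ast.
    apply/eqP; rewrite eqn_leq lew // andbT size_rcons -uv_len addSnnS leq_add2l //.
  by move=> /kmin; rewrite leqNgt av.
have short u' : equiv u' u -> (size u' < size u)%N -> False.
  move=> u'u lt; have := lew u' v.
  rewrite -uv_len leqNgt ltn_add2r lt => /(_ _) H; suff: false by []; apply: H.
  by apply: equiv_trans uvw; exact: equiv_cat u'u (equiv_refl v).
have sshort u' : equiv u' (s :: u) -> (size u' < size u)%N -> False.
  move=> u'u lt; have [v' [sz' v'v]] := len_reduced v.
  have : (len (s :: w) <= size (u' ++ v'))%N.
    apply: len_le; apply: equiv_trans (equiv_cat u'u v'v) _.
    exact: (equiv_cat (equiv_refl [:: s]) uvw).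
  move/(leq_trans sw); rewrite size_cat sz' -uv_len leqNgt ltn_add2r lt //.
(* [u] cannot be shortened, and it cannot begin with [s] since [s :: w] is not shorter than [w]. *)
have Eu : u = alternating t s (size u).
  have [[u' [lt u'u]]|E|//] := equiv_shorter u_st; first by case: (short u').
  case: u E {u_st uvw uv_len kmin short} sshort => //= b u [-> _] sshort.
  case: (sshort u) => //.
  exact/equiv_sym/equiv_cancel.
(* Below the braid length the rank two case applies; from there on the braid relation would let [u]
   begin with [s], making [s :: w] too short. *)
have [ult|uge] := ltnP (size u) (cox_order s t).
  have [a [b [a0 b0 E]]] := dihedral_nonneg st ult.
  rewrite -uvw.1 cox_word_cat mulmxA Eu E mulmxDl -!scalemxAl.
  by apply: nonneg_comb => //; apply: vpos; rewrite eqxx ?orbT.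
have [m Em] : exists m, cox_order s t = m.+1.
  by rewrite /cox_order; case: ifP => _; [exists 1%N|case: ifP => _; [exists 2%N|exists 4%N]].
set l := (size u - cox_order s t)%N.
have Eu' : u = alternating t s (cox_order t s) ++
    (if odd (cox_order t s) then alternating s t l else alternating t s l).
  by rewrite -alternating_cat cox_order_sym subnKC // -cox_order_sym.
case: (sshort (alternating t s m ++
    (if odd (cox_order t s) then alternating s t l else alternating t s l))).
  rewrite Eu' -cat_cons; apply: equiv_cat (equiv_refl _).
  apply: equiv_trans (equiv_sym (equiv_cancel s _)) _.
  apply: (equiv_cat (equiv_refl [:: s])); rewrite -[s :: _]/(alternating s t m.+1) -Em.
  by rewrite (cox_order_sym t s); exact: equiv_braid st.
rewrite [X in (_ < size X)%N]Eu' !size_cat ltn_add2r !size_alternating.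
by rewrite cox_order_sym Em.
Qed.

Lemma equiv_rev_l w : equiv (rev w ++ w) [::].
Proof.
elim: w => [|i w IH]; first exact: equiv_refl.
rewrite rev_cons cat_rcons; apply: equiv_trans IH.
exact: (equiv_cat (equiv_refl _) (equiv_cancel i w)).
Qed.

Lemma equiv_rev_r w : equiv (w ++ rev w) [::].
Proof. by rewrite -{1}[w]revK; exact: equiv_rev_l. Qed.

Lemma len_equiv w u : equiv w u -> (len u <= len w)%N.
Proof.
move=> wu; have [w' [<- w'w]] := len_reduced w.
by apply: len_le; apply: equiv_trans wu.
Qed.

Lemma len_cons_reduced w : (0 < len w)%N ->
  exists t w', [/\ equiv (t :: w') w, equiv w' (t :: w), (len w' < len w)%N &
                 (len (t :: w) < len w)%N].
Proof.
have [[|t w'] [sz w'w]] := len_reduced w; first by rewrite -sz.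
move=> _; have E : equiv w' (t :: w).
  apply: equiv_trans (equiv_sym (equiv_cancel t w')) _.
  exact: (equiv_cat (equiv_refl [:: t]) w'w).
by exists t, w'; split=> //; rewrite -sz ltnS; apply: len_le => //; exact: equiv_refl.
Qed.

Lemma vec_cox_refl i : vec i *m cox_refl B i = - vec i.
Proof.
by rewrite mul_cox_refl vecB Bdiag; apply/rowP => k; rewrite !mxE; ring.
Qed.

Lemma tits_nonpos w s : (len (s :: w) < len w)%N ->
  nonneg (- (vec s *m cox_word B w)).
Proof.
move=> lt; have := @tits_nonneg (s :: w) s.
rewrite cox_word_cons mulmxA vec_cox_refl mulNmx; apply.
apply: leq_trans (ltnW lt) _; apply: len_equiv; exact: equiv_cancel.
Qed.

Lemma vec_nonneg i : nonneg (vec i).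
Proof. by move=> k; rewrite mxE; case: (_ && _); rewrite ?ler01. Qed.

(** The first letter of a nonempty reduced word has its root made negative, which the identity does
    not do. *)
Lemma cox_word_faithful w : cox_word B w = 1%:M -> equiv w [::].
Proof.
move=> w1; have [/len_nil //|/len_cons_reduced [t [w' [_ _ _ lt]]]] := posnP (len w).
have := tits_nonpos lt; rewrite w1 mulmx1 => /(_ t).
by rewrite !mxE !eqxx lerNr oppr0 lern0.
Qed.

Theorem cox_word_inj w u : cox_word B w = cox_word B u -> equiv w u.
Proof.
move=> E; have W : equiv (rev u ++ w) [::].
  apply: cox_word_faithful; rewrite cox_word_cat E -cox_word_cat.
  by rewrite (equiv_rev_l u).1 cox_word_nil.
have := equiv_cat (equiv_refl u) W; rewrite cats0 catA; apply: equiv_trans.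
exact: (equiv_sym (equiv_cat (equiv_rev_r u) (equiv_refl w))).
Qed.

(** * Roots, inversions and the chamber *)

Definition bform (x y : 'rV[R]_n.+1) : R := (x *m B *m y^T) 0 0.

Lemma bformE x y : bform x y = \sum_k (x *m B) 0 k * y 0 k.
Proof. by rewrite /bform mxE; apply: eq_bigr => k _; rewrite [y^T _ _]mxE. Qed.

Lemma bform_vec x i : bform x (vec i) = (x *m B) 0 i.
Proof.
rewrite bformE (bigD1 i) //= [vec i _ _]mxE !eqxx mulr1 big1 ?addr0 // => k /negbTE ki.
by rewrite [vec i _ _]mxE ki mulr0.
Qed.

Lemma bformC x y : bform x y = bform y x.
Proof.
have BT : B^T = B by apply/matrixP => i j; rewrite mxE.
have -> : bform y x = ((y *m B *m x^T)^T) 0 0 by rewrite [RHS]mxE.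
by rewrite !trmx_mul trmxK BT mulmxA.
Qed.

Lemma bformDl x y z : bform (x + y) z = bform x z + bform y z.
Proof. by rewrite /bform !mulmxDl mxE. Qed.

Lemma bformZl a x z : bform (a *: x) z = a * bform x z.
Proof. by rewrite /bform -!scalemxAl mxE. Qed.

Lemma bformDr x y z : bform z (x + y) = bform z x + bform z y.
Proof. by rewrite !(bformC z) bformDl. Qed.

Lemma bformZr a x z : bform z (a *: x) = a * bform z x.
Proof. by rewrite !(bformC z) bformZl. Qed.

Lemma bform_refl i x y : bform (x *m cox_refl B i) (y *m cox_refl B i) = bform x y.
Proof.
rewrite !mul_cox_refl -!scaleNr !(bformDl, bformDr, bformZl, bformZr) (bformC (vec i) y).
by rewrite !bform_vec vecB Bdiag; ring.
Qed.

Lemma bform_word w x y : bform (x *m cox_word B w) (y *m cox_word B w) = bform x y.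
Proof.
elim: w x y => [|i w IH] x y; first by rewrite cox_word_nil !mulmx1.
by rewrite cox_word_cons !mulmxA IH bform_refl.
Qed.

Lemma bform_rev w x y : bform (x *m cox_word B w) y = bform x (y *m cox_word B (rev w)).
Proof.
rewrite -[LHS](bform_word (rev w)) -mulmxA -cox_word_cat.
by rewrite (equiv_rev_r w).1 cox_word_nil mulmx1.
Qed.

Definition is_root a := exists w s, a = vec s *m cox_word B w.

Lemma root_nonneg a : is_root a -> nonneg a \/ nonneg (- a).
Proof.
move=> [w [s ->]]; have [le|lt] := leqP (len w) (len (s :: w)).
  by left; exact: tits_nonneg.
by right; exact: tits_nonpos.
Qed.

Lemma root_norm a : is_root a -> bform a a = 2.
Proof. by move=> [w [s ->]]; rewrite bform_word bform_vec vecB Bdiag. Qed.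

Lemma root_refl a i : is_root a -> is_root (a *m cox_refl B i).
Proof.
move=> [w [s ->]]; exists (rcons w i), s.
by rewrite -cats1 cox_word_cat cox_word_cons cox_word_nil mulmx1 mulmxA.
Qed.

Lemma vec_root i : is_root (vec i).
Proof. by exists [::], i; rewrite cox_word_nil mulmx1. Qed.

Lemma nonneg_anti a : nonneg a -> nonneg (- a) -> a = 0.
Proof.
move=> a0 Na; apply/rowP => k; rewrite mxE; apply/eqP; rewrite eq_le a0 andbT.
by have := Na k; rewrite mxE oppr_ge0.
Qed.

(** The reflection changes coordinate [i] only, so a positive root that it makes negative is a
    multiple of [e_i], and norm 2 makes it [e_i] itself. *)
Lemma refl_nonneg a i : is_root a -> nonneg a -> a != vec i -> nonneg (a *m cox_refl B i).
Proof.
move=> ra a0 ai; have [//|neg] := root_nonneg (root_refl i ra).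
have E : a = a 0 i *: vec i.
  apply/rowP => k; rewrite !mxE eqxx /=; have [->|ki] := eqVneq k i; first by rewrite mulr1.
  rewrite mulr0; apply/eqP; rewrite eq_le a0 andbT; have := neg k.
  by rewrite mul_cox_refl !mxE eqxx (negbTE ki) /= mulr0 subr0 oppr_ge0.
have := root_norm ra; rewrite E bformZl bformZr bform_vec vecB Bdiag => H.
suff a1 : a 0 i = 1 by move: ai; rewrite E a1 scale1r eqxx.
have /eqP : (a 0 i - 1) * (a 0 i + 1) = 0 by lra.
by rewrite mulf_eq0 => /orP [/eqP|/eqP]; have := a0 i; lra.
Qed.

Fixpoint inversions w : seq 'rV[R]_n.+1 :=
  if w is i :: w' then vec i :: [seq a *m cox_refl B i | a <- inversions w'] else [::].

Lemma mem_inversions w a : is_root a -> nonneg a -> nonneg (- (a *m cox_word B w)) ->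
  a \in inversions w.
Proof.
elim: w a => [|i w IH] a ra a0.
  rewrite cox_word_nil mulmx1 => Na; have := root_norm ra.
  by rewrite (nonneg_anti a0 Na) /bform !mul0mx mxE; lra.
rewrite cox_word_cons mulmxA /= inE; have [//|ai] := eqVneq a (vec i) => /= Na.
rewrite -[a]mulmx1 -(cox_refl_invol i) mulmxA; apply: map_f; apply: IH => //.
  exact: root_refl.
exact: refl_nonneg.
Qed.

(** The roots stand for outward normals, so the points of the simplex pair nonpositively with
    them. *)
Definition in_chamber (y : 'rV[R]_n.+1) := forall i, (y *m B) 0 i <= 0.

Lemma chamber_bform y a : in_chamber y -> nonneg a -> bform y a <= 0.
Proof.
by move=> yc a0; rewrite bformE sumr_le0 // => k _; rewrite mulr_le0_ge0.
Qed.

(* Each simple reflection whose root is wrong for y removes one wrong root. *)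
Lemma to_chamber (L : seq 'rV[R]_n.+1) y :
  (forall a, is_root a -> nonneg a -> 0 < bform y a -> a \in L) ->
  exists w, in_chamber (y *m cox_word B w).
Proof.
have [N] := ubnP (size L); elim: N L y => // N IH L y LN HL.
have [i|yc] := pickP (fun i => 0 < (y *m B) 0 i); last first.
  by exists [::] => i; rewrite cox_word_nil mulmx1 leNgt yc.
rewrite -bform_vec => yi.
have iL : vec i \in L by apply: HL yi; [exact: vec_root | exact: vec_nonneg].
have [] := IH [seq a *m cox_refl B i | a <- L & a != vec i] (y *m cox_refl B i).
- rewrite size_map size_filter -ltnS; apply: leq_trans LN; rewrite ltnS.
  rewrite -(count_predC (pred1 (vec i)) L) -[X in (X < _)%N]add0n ltn_add2r.
  by rewrite -has_count has_pred1.
- move=> a ra a0 ya; have ai : a != vec i.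
    apply: contraTneq ya => ->; rewrite -leNgt.
    rewrite -[vec i]opprK -vec_cox_refl -scaleN1r.
    by rewrite bformZr bform_refl; lra.
  apply/mapP; exists (a *m cox_refl B i); last first.
    by rewrite -mulmxA cox_refl_invol mulmx1.
  rewrite mem_filter; apply/andP; split.
    apply: contraTneq (a0 i) => E; rewrite -ltNge.
    rewrite -[a]mulmx1 -(cox_refl_invol i) mulmxA E vec_cox_refl !mxE !eqxx.
    by rewrite oppr_lt0 ltr01.
  apply: HL; [exact: root_refl | exact: refl_nonneg |].
  by rewrite -(bform_refl i) -mulmxA cox_refl_invol mulmx1.
by move=> w wc; exists (i :: w); rewrite cox_word_cons mulmxA.
Qed.

(** If [t] is the first letter of a reduced word for [g], then [e_t g] is negative, so the product
    of [y] with [e_t], which equals that with [e_t g], has both signs and vanishes. The letter [t]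
    then fixes [y] and can be removed. *)
Lemma chamber_stabilizer y g : in_chamber y -> y *m cox_word B g = y ->
  exists u, equiv u g /\ forall i, i \in u -> (y *m B) 0 i = 0.
Proof.
move=> yc; have [N] := ubnP (len g); elim: N g => // N IH g gN yg.
have [/len_nil g0|/len_cons_reduced [t [g' [g'g gg' g'l tl]]]] := posnP (len g).
  by exists [::]; split=> //; exact: equiv_sym.
have yt : (y *m B) 0 t = 0.
  apply/eqP; rewrite eq_le yc -bform_vec -(bform_word g) yg.
  by have := chamber_bform yc (tits_nonpos tl); rewrite -scaleN1r bformZr; lra.
have yg' : y *m cox_word B g' = y.
  by rewrite gg'.1 cox_word_cons mulmxA mul_cox_refl yt scale0r subr0.
have [u [ug' uy]] := IH g' (leq_trans g'l gN) yg'.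
exists (t :: u); split; last by move=> i; rewrite inE => /orP [/eqP ->//|/uy].
by apply: equiv_trans g'g; exact: (equiv_cat (equiv_refl [:: t]) ug').
Qed.

(** * Elements of finite order *)

Variable y0 : 'rV[R]_n.+1.
Hypothesis y0_chamber : in_chamber y0.
Hypothesis y0_timelike : bform y0 y0 < 0.

(** A letter [t] put before [w'] and lengthening it adds to [y0 w'] a nonnegative multiple of the
    positive root [e_t w'], which pairs nonpositively with [y0]. *)
Lemma chamber_word_timelike w : bform y0 (y0 *m cox_word B w) < 0.
Proof.
suff : bform y0 (y0 *m cox_word B w) <= bform y0 y0 by move=> H; apply: le_lt_trans H _.
have [N] := ubnP (len w); elim: N w => // N IH w wN.
have [/len_nil [-> _]|/len_cons_reduced [t [w' [w'w ww' w'l tl]]]] := posnP (len w).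
  by rewrite cox_word_nil mulmx1.
have H := IH w' (leq_trans w'l wN); apply: le_trans H.
rewrite -w'w.1 cox_word_cons mulmxA mul_cox_refl mulmxBl -scalemxAl -scaleNr.
rewrite bformDr bformZr gerDl; apply: mulr_ge0_le0; first by rewrite oppr_ge0.
apply: chamber_bform => //; apply: tits_nonneg.
by apply: leq_trans (ltnW w'l) _; exact: len_equiv w'w.
Qed.

(** The sum of the orbit of [y0] under the powers of [g] is fixed by [g]. Once it is moved into the
    chamber, its stabilizer is generated by the walls through it, and these are not all the
    walls. *)
Theorem torsion_in_parabolic g m : (0 < m)%N -> cox_word B g ^+ m = 1 ->
  exists w u i, i \notin u /\ cox_word B g = cox_word B (w ++ u ++ rev w).
Proof.
move=> m0 gm; pose h k := flatten (nseq k g).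
have wh k : cox_word B (h k) = cox_word B g ^+ k.
  elim: k => [|k IH]; first by rewrite cox_word_nil.
  by rewrite /h /= cox_word_cat -/(h k) IH exprS.
pose y := \sum_(k < m) y0 *m cox_word B (h k).
have bsum x : bform y x = \sum_(k < m) bform (y0 *m cox_word B (h k)) x.
  by rewrite /bform /y !mulmx_suml summxE.
have yg : y *m cox_word B g = y.
  rewrite /y mulmx_suml; case: m m0 gm {y bsum} => // m _ gm.
  rewrite big_ord_recr big_ord_recl /= addrC; congr (_ + _).
    by rewrite -mulmxA !wh; change (y0 *m (cox_word B g ^+ m * cox_word B g) = y0 *m 1);
       rewrite -exprSr gm.
  apply: eq_bigr => k _; rewrite -mulmxA !wh.
  by change (y0 *m (cox_word B g ^+ k * cox_word B g) = y0 *m cox_word B g ^+ k.+1);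
     rewrite -exprSr.
have [w wc] : exists w, in_chamber (y *m cox_word B w).
  (* Only finitely many positive roots are on the wrong side of [y]: each is on the wrong side of
     some summand [y0 g^k], and since [y0] lies in the chamber it is an inversion of the reversed
     word. *)
  apply: (@to_chamber (flatten [seq inversions (rev (h k)) | k <- iota 0 m])) => a ra a0.
  rewrite bsum => ya.
  have [k ka] : exists k : 'I_m, 0 < bform (y0 *m cox_word B (h k)) a.
    apply/existsP; apply: contraTT ya => /existsPn H; rewrite -leNgt.
    by apply: sumr_le0 => k _; rewrite leNgt H.
  apply/flattenP; exists (inversions (rev (h k))).
    by apply/mapP; exists (k : nat); rewrite // mem_iota /= add0n.
  apply: mem_inversions => //; move: ka; rewrite bform_rev => ka.
  have : is_root (a *m cox_word B (rev (h k))).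
    have [v [s ->]] := ra; exists (v ++ rev (h k)), s.
    by rewrite cox_word_cat mulmxA.
  case/root_nonneg => // /(chamber_bform y0_chamber).
  by rewrite leNgt ka.
have fixy : y *m cox_word B w *m cox_word B (rev w ++ g ++ w) = y *m cox_word B w.
  rewrite !cox_word_cat !mulmxA -[y *m _ *m cox_word B (rev w)]mulmxA -cox_word_cat.
  by rewrite (equiv_rev_r w).1 cox_word_nil mulmx1 yg.
have [u [ug uy]] := chamber_stabilizer wc fixy.
(* On all the walls at once, [y] would be orthogonal to everything, but its product with [y0] is
   negative. *)
have [i iy] : exists i, (y *m cox_word B w *m B) 0 i != 0.
  apply/existsP; apply: contraT => /existsPn H.
  have : bform y y0 < 0.
    rewrite bsum; case: m m0 {gm y bsum yg wc fixy uy H} => // m _.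
    rewrite big_ord_recl ltr_wnDr //; last first.
      by rewrite wh expr0 mulmx1.
    by apply: sumr_le0 => k _; rewrite bformC ltW ?chamber_word_timelike.
  rewrite -(bform_word w) bformE big1 ?ltxx // => k _.
  by have := H k; rewrite negbK => /eqP ->; rewrite mul0r.
exists w, u, i; split; first by apply: contra iy => /uy ->.
rewrite !cox_word_cat ug.1 !cox_word_cat !mulmxA -cox_word_cat (equiv_rev_r w).1.
by rewrite cox_word_nil mul1mx -mulmxA -cox_word_cat (equiv_rev_r w).1 cox_word_nil mulmx1.
Qed.
End Action.
End Tits.

(** * Computations over Z[phi] *)

(* (a, b) stands for a + b * phi, where phi is the golden ratio. *)
Definition zphi := (Z * Z)%type.
Definition z0 : zphi := (Z0, Z0).
Definition z1 : zphi := (Zpos 1, Z0).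
Definition zadd (x y : zphi) : zphi := (Z.add x.1 y.1, Z.add x.2 y.2).
Definition zsub (x y : zphi) : zphi := (Z.sub x.1 y.1, Z.sub x.2 y.2).
Definition zmul (x y : zphi) : zphi :=
  (Z.add (Z.mul x.1 y.1) (Z.mul x.2 y.2),
   Z.add (Z.add (Z.mul x.1 y.2) (Z.mul x.2 y.1)) (Z.mul x.2 y.2)).

Definition zentry (M : seq (seq zphi)) i j := nth z0 (nth [::] M i) j.
Definition zsum (s : seq zphi) := foldr zadd z0 s.

Definition zact (G : seq (seq zphi)) (c : seq zphi) (i : nat) : seq zphi :=
  let d := zsum [seq zmul (nth z0 c k) (zentry G k i) | k <- iota 0 (size G)] in
  [seq (let x := nth z0 c k in if k == i then zsub x d else x) | k <- iota 0 (size G)].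

Definition zunit N k : seq zphi := [seq (if l == k then z1 else z0) | l <- iota 0 N].

Definition zword (G : seq (seq zphi)) (w : seq nat) : seq (seq zphi) :=
  [seq foldl (zact G) (zunit (size G) k) w | k <- iota 0 (size G)].

Definition ztrace (M : seq (seq zphi)) := zsum [seq zentry M k k | k <- iota 0 (size M)].

Lemma int_of_ZD x y : int_of_Z (Z.add x y) = int_of_Z x + int_of_Z y.
Proof. exact: (raddfD int_of_Z x y). Qed.
Lemma int_of_ZB x y : int_of_Z (Z.sub x y) = int_of_Z x - int_of_Z y.
Proof. exact: (raddfB int_of_Z x y). Qed.
Lemma int_of_ZM x y : int_of_Z (Z.mul x y) = int_of_Z x * int_of_Z y.
Proof. exact: (rmorphM int_of_Z x y). Qed.

Section Valuation.
Context {A : comNzRingType}.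
Variable f : A.
Hypothesis f2 : f * f = f + 1.

Definition zval (x : zphi) : A := (int_of_Z x.1)%:~R + (int_of_Z x.2)%:~R * f.

Lemma zval0 : zval z0 = 0. Proof. by rewrite /zval /= mul0r addr0. Qed.
Lemma zval1 : zval z1 = 1. Proof. by rewrite /zval /= mul0r addr0. Qed.
Lemma zvalD x y : zval (zadd x y) = zval x + zval y.
Proof. rewrite /zval /= !int_of_ZD !rmorphD /=; ring. Qed.
Lemma zvalB x y : zval (zsub x y) = zval x - zval y.
Proof. rewrite /zval /= !int_of_ZB !rmorphB /=; ring. Qed.
Lemma zvalM x y : zval (zmul x y) = zval x * zval y.
Proof.
rewrite /zval /zmul /=.
rewrite !(int_of_ZD, int_of_ZM) !rmorphD !rmorphM /=; ring: f2.
Qed.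

Lemma zval_sum (s : seq zphi) : zval (zsum s) = \sum_(x <- s) zval x.
Proof.
by elim: s => [|x s IH]; rewrite ?big_nil ?zval0 // big_cons /= zvalD IH.
Qed.

Definition zvec n (c : seq zphi) : 'rV[A]_n.+1 := \row_k zval (nth z0 c k).
Definition zmx n (M : seq (seq zphi)) : 'M[A]_n.+1 := \matrix_(i, j) zval (zentry M i j).

Lemma size_zact G c i : size (zact G c i) = size G.
Proof. by rewrite size_map size_iota. Qed.

Lemma zvec_act n G c (i : 'I_n.+1) : size G = n.+1 ->
  zvec n (zact G c i) = zvec n c *m cox_refl (zmx n G) i.
Proof.
move=> sG; rewrite mul_cox_refl; apply/rowP => k.
rewrite !mxE (nth_map 0%N) ?size_iota ?sG ?ltn_ord // nth_iota // add0n.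
have -> : (nat_of_ord k == nat_of_ord i) = (k == i) by [].
rewrite eqxx andTb; case: (eqVneq k i) => [->|ki]; last by rewrite mulr0 subr0.
rewrite mulr1 zvalB; congr (_ - _). rewrite zval_sum big_map.
rewrite -[iota 0 n.+1]/(index_iota 0 n.+1) big_mkord.
by apply: eq_bigr => l _; rewrite zvalM !mxE.
Qed.

Lemma zvec_unit n (k : 'I_n.+1) : zvec n (zunit n.+1 k) = vec k.
Proof.
apply/rowP => l; rewrite !mxE (nth_map 0%N) ?size_iota // nth_iota // add0n eqxx /=.
by rewrite val_eqE; case: eqVneq => _; rewrite ?zval0 ?zval1.
Qed.

Lemma zvec_word n G c (w : seq 'I_n.+1) : size G = n.+1 ->
  zvec n (foldl (zact G) c [seq val i | i <- w]) = zvec n c *m cox_word (zmx n G) w.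
Proof.
move=> sG; elim: w c => [|i w IH] c; first by rewrite cox_word_nil mulmx1.
by rewrite /= IH zvec_act // cox_word_cons mulmxA.
Qed.

Lemma zmx_word n G (w : seq 'I_n.+1) : size G = n.+1 ->
  zmx n (zword G [seq val i | i <- w]) = cox_word (zmx n G) w.
Proof.
move=> sG; apply/row_matrixP => k; rewrite [RHS]rowE -/(vec k) -zvec_unit -zvec_word //.
apply/rowP => l; rewrite !mxE /zentry /zword (nth_map 0%N) ?size_iota ?sG //.
by rewrite nth_iota.
Qed.

Lemma zmx_trace n M : size M = n.+1 -> \tr (zmx n M) = zval (ztrace M).
Proof.
move=> sM; rewrite /mxtrace zval_sum big_map sM -[iota 0 n.+1]/(index_iota 0 n.+1) big_mkord.
by apply: eq_bigr => k _; rewrite mxE.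
Qed.
End Valuation.

(* Twice the Gram matrix of the outward unit normals of the faces of T_9. *)
Definition G9 : seq (seq zphi) :=
  let d := (Zpos 2, Z0) in let a := (Zneg 1, Z0) in let b := (Z0, Zneg 1) in
  [:: [:: d; z0; b; a]; [:: z0; d; a; b]; [:: b; a; d; z0]; [:: a; b; z0; d]].

(** * Enumeration of finite groups by words *)

Definition extend {K : eqType} (key : seq nat -> K) (acc : seq (K * seq nat)) (u : seq nat) :=
  let k := key u in if k \in map fst acc then acc else rcons acc (k, u).

(* Breadth-first enumeration; the first m entries of acc are already expanded. *)
Fixpoint closure {K : eqType} (key : seq nat -> K) (gens : seq (seq nat)) n m acc :=
  if n is n'.+1 then
    closure key gens n' (size acc)
      (foldl (extend key) acc [seq p.2 ++ g | p <- drop m acc, g <- gens])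
  else acc.

Lemma closure_key {K : eqType} (key : seq nat -> K) gens n m acc :
  (forall p, p \in acc -> p.1 = key p.2) ->
  forall p, p \in closure key gens n m acc -> p.1 = key p.2.
Proof.
have ext s : forall acc, (forall p, p \in acc -> p.1 = key p.2) ->
    forall p, p \in foldl (extend key) acc s -> p.1 = key p.2; last first.
  by elim: n m acc => // n IH m acc Hacc; apply: IH; apply: ext.
elim: s => //= u s IHs {}acc Hacc; apply: IHs.
rewrite /extend; case: ifP => // _ p; rewrite mem_rcons inE => /orP [/eqP -> //|].
exact: Hacc.
Qed.

Definition pairs4 : seq (seq nat) := [seq [:: i; j] | i <- iota 0 4, j <- iota 0 4].

Definition face_gens i : seq (seq nat) := [seq [:: j] | j <- iota 0 4 & j != i].

(** The parity is stored beside the matrix, so that equal keys give equal parities without a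
    determinant. *)
Definition fkey (u : seq nat) := (zword G9 u, odd (size u)).

(** Any three of the reflections generate the icosahedral reflection group H_3, whose longest
    element has length 15. *)
Definition face_words i := closure fkey (face_gens i) 15 0 [:: (fkey [::], [::])].

Lemma face_words_key i p : p \in face_words i -> p.1 = fkey p.2.
Proof. by apply: closure_key => q; rewrite inE => /eqP ->. Qed.

(* The reflections in the faces A, B, C, D act modulo 2 on a quadratic space of dimension 4
   and plus type over F_4; these are the permutations induced on its ten totally singular
   planes, which form two families, 0..4 and 5..9, exchanged by every reflection. *)
Definition planes : seq (seq nat) :=
  [:: [:: 5; 6; 7; 8; 9; 0; 1; 2; 3; 4]; [:: 5; 9; 8; 7; 6; 0; 4; 3; 2; 1];
      [:: 6; 9; 5; 7; 8; 2; 0; 3; 4; 1]; [:: 6; 8; 7; 5; 9; 3; 0; 2; 1; 4]]%N.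

Definition plane_act (x i : nat) : nat := nth x (nth [::] planes i) x.

Definition pkey (w : seq nat) : seq nat := [seq foldl plane_act x w | x <- iota 0 5].

Definition P60 := unzip1 (closure pkey pairs4 8 0 [:: (pkey [::], [::])]).

(* Reduction modulo sqrt 5, where phi becomes 3. *)
Definition zred (z : zphi) : nat := Z.to_nat (Z.modulo (Z.add z.1 (Z.mul (Zpos 3) z.2)) (Zpos 5)).

(** Modulo the radical (1,-1,1,-1) the last basis vector is e_0 - e_1 + e_2, whence the signs with
    which column 3 enters the other columns. *)
Definition bkey (w : seq nat) : seq (seq nat) :=
  let M := zword G9 w in
  [seq [seq zred (if j == 1%N then zsub (zentry M i j) (zentry M i 3)
                  else zadd (zentry M i j) (zentry M i 3)) | j <- iota 0 3] | i <- iota 0 3].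

Definition B60 := unzip1 (closure bkey pairs4 8 0 [:: (bkey [::], [::])]).

Definition comp (p q : seq nat) : seq nat := [seq nth 0%N q x | x <- p].
Definition id5 := iota 0 5.
Definition is_perm5_order (p : seq nat) n := (iter n (comp p) id5 == id5) && (p != id5).

(* One of the two classes of 5-cycles in A_5; face_check verifies that it consists of the
   images of the rotations of order 5 whose trace is 1 + phi rather than 2 - phi. *)
Definition class5 : seq (seq nat) :=
  [:: [:: 2; 0; 3; 4; 1]; [:: 3; 4; 1; 2; 0]; [:: 4; 2; 0; 1; 3]; [:: 1; 2; 4; 0; 3];
      [:: 3; 4; 0; 1; 2]; [:: 1; 3; 4; 2; 0]; [:: 2; 3; 4; 0; 1]; [:: 4; 0; 3; 1; 2];
      [:: 2; 3; 1; 4; 0]; [:: 3; 0; 1; 4; 2]; [:: 4; 2; 3; 0; 1]; [:: 1; 4; 0; 2; 3]]%N.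

Definition entry3 (a : seq (seq nat)) i j := nth 0%N (nth [::] a i) j.
Definition mul3 (a b : seq (seq nat)) : seq (seq nat) :=
  [seq [seq ((entry3 a i 0 * entry3 b 0 j + entry3 a i 1 * entry3 b 1 j
              + entry3 a i 2 * entry3 b 2 j) %% 5)%N | j <- iota 0 3] | i <- iota 0 3].
Definition id3 : seq (seq nat) := [:: [:: 1; 0; 0]; [:: 0; 1; 0]; [:: 0; 0; 1]]%N.
Definition is_mat3_order (a : seq (seq nat)) n := (iter n (mul3 a) id3 == id3) && (a != id3).
Definition trace3 (a : seq (seq nat)) := ((entry3 a 0 0 + entry3 a 1 1 + entry3 a 2 2) %% 5)%N.

(** Nontrivial rotations about a vertex are nontrivial in both finite quotients, so orders are kept
    there. The two traces 1 + phi and 2 - phi are 2 + 2 cos x for x = 2 pi/5 and x = 4 pi/5. *)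
Definition face_check (u : seq nat) :=
  let M := zword G9 u in let I := zword G9 [::] in
  all (fun j => j < 4)%N u && (~~ odd (size u) ==> (M != I) ==>
  [&& pkey u != id5, bkey u != id3,
      [|| zword G9 (u ++ u) == I, zword G9 (u ++ u ++ u) == I |
          zword G9 (u ++ u ++ u ++ u ++ u) == I]
    & (zword G9 (u ++ u ++ u ++ u ++ u) == I) ==>
      (ztrace M == if pkey u \in class5 then (Zpos 1, Zpos 1) else (Zpos 2, Zneg 1))]).

Lemma P60_closed : all (fun p => all (fun g => comp p (pkey g) \in P60) pairs4) P60.
Proof. by vm_compute. Qed.

Lemma P60_bound : all (all (fun x => x < 5)%N) P60.
Proof. by vm_compute. Qed.

Lemma B60_closed : all (fun p => all (fun g => mul3 p (bkey g) \in B60) pairs4) B60.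
Proof. by vm_compute. Qed.

Lemma class5_conj : all (fun p => all (fun q => (comp p q == id5) ==>
  all (fun y => (comp (comp p y) q \in class5) == (y \in class5)) P60) P60) P60.
Proof. by vm_compute. Qed.

Lemma no_255_class5 : all (fun x => is_perm5_order x 2 ==> all (fun y =>
  is_perm5_order y 5 ==> is_perm5_order (comp x y) 5 ==>
  ((y \in class5) != (comp x y \in class5))) P60) P60.
Proof. by vm_compute. Qed.

(** [mul3 y y] is the inverse of [y]. Trace 3 on the quotient is trace 4 on the whole space, the
    radical contributing 1. *)
Lemma trace_335_mod5 : all (fun x => is_mat3_order x 3 ==> all (fun y =>
  is_mat3_order y 3 ==> is_mat3_order (mul3 x y) 5 ==>
  (trace3 (mul3 x (mul3 y y)) == 3%N)) B60) B60.
Proof. by vm_compute. Qed.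

Lemma face_words_closed : all (fun i => let L := face_words i in let K := map fst L in
  all (fun p => all (fun g => fkey (p.2 ++ g) \in K) (face_gens i)) L) (iota 0 4).
Proof. by vm_compute. Qed.

Lemma face_words_check : all (fun i => all (fun p => face_check p.2) (face_words i)) (iota 0 4).
Proof. by vm_compute. Qed.

Lemma face_words_nil :
  all (fun i => has (fun p => p.1 == fkey [::]) (face_words i)) (iota 0 4).
Proof. by vm_compute. Qed.

Global Opaque P60 B60 face_words.

Lemma zword_cat G u u' v : zword G u = zword G u' -> zword G (u ++ v) = zword G (u' ++ v).
Proof.
move=> E; apply/eq_in_map => k kG; rewrite !foldl_cat; congr (foldl _ _ v).
by have /eq_in_map := E; apply.
Qed.

Definition on_face i (w : seq nat) := all (fun j => (j < 4)%N && (j != i)) w.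

Lemma face_word_in i (L : seq (seq (seq zphi) * bool * seq nat)) w :
  (forall p, p \in L -> p.1 = fkey p.2) -> has (fun p => p.1 == fkey [::]) L ->
  all (fun p => all (fun g => fkey (p.2 ++ g) \in map fst L) (face_gens i)) L ->
  on_face i w -> exists2 p, p \in L & fkey w = fkey p.2.
Proof.
move=> Hkey /hasP [p0 p0L /eqP p0n] /allP closed.
elim/last_ind: w => [|w j IH]; first by exists p0; rewrite -?p0n //; exact: Hkey.
rewrite /on_face all_rcons => /andP [/andP [j4 ji] /IH {IH} [p pL E]].
have gj : [:: j] \in face_gens i.
  by apply: (map_f (fun j => [:: j])); rewrite mem_filter ji mem_iota add0n.
have /allP /(_ [:: j] gj) /mapP [q qL Eq] := closed p pL.
exists q => //; rewrite -(Hkey q qL) -Eq /fkey -cats1 (zword_cat _ (congr1 fst E)).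
by rewrite !size_cat !oddD (congr1 snd E : odd _ = odd _).
Qed.

Lemma face_word i w : (i < 4)%N -> on_face i w ->
  exists2 u, face_check u & zword G9 w = zword G9 u /\ odd (size w) = odd (size u).
Proof.
move=> i4 wi.
have iI : i \in iota 0 4 by rewrite mem_iota add0n.
have [p pL E] := face_word_in (@face_words_key i) (allP face_words_nil _ iI)
  (allP face_words_closed _ iI) wi.
exists p.2; first exact: (allP (allP face_words_check _ iI) _ pL).
by split; [exact: (congr1 fst E) | exact: (congr1 snd E)].
Qed.

(** Odd words exchange the two families of planes, so words grow by two letters at a time. *)
Lemma even_word_ind (P : seq nat -> Prop) : P [::] ->
  (forall w g, all (fun j => j < 4)%N w -> g \in pairs4 -> P w -> P (w ++ g)) ->
  forall w, all (fun j => j < 4)%N w -> ~~ odd (size w) -> P w.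
Proof.
move=> P0 PS w; have [n] := ubnP (size w); elim: n w => // n IH w.
case/lastP: w => [//|w j]; case/lastP: w => [|w i].
  by move=> _ _; rewrite size_rcons.
rewrite !size_rcons !all_rcons /= !ltnS negbK => wn /and3P [j4 i4 w4] ow.
rewrite -!cats1 -catA; apply: PS => //; last by apply: IH => //; apply: ltnW.
by apply/allpairsP; exists (i, j); rewrite !mem_iota !add0n.
Qed.

Lemma pkey_foldl w x : (x < 5)%N -> foldl plane_act x w = nth 0%N (pkey w) x.
Proof. by move=> x5; rewrite (nth_map 0%N) ?size_iota // nth_iota // add0n. Qed.

(** * Even words acting on one family of planes *)

Section Planes.
Variable L : seq (seq nat).
Hypothesis L_nil : pkey [::] \in L.
Hypothesis L_bound : all (all (fun x => x < 5)%N) L.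
Hypothesis L_closed : all (fun p => all (fun g => comp p (pkey g) \in L) pairs4) L.

(** [pkey] records only the images of 0, ..., 4. Membership of [pkey u] in [L] keeps these images
    below 5, where [pkey v] can be applied. *)
Lemma pkey_cat u v : pkey u \in L -> pkey (u ++ v) = comp (pkey u) (pkey v).
Proof.
move=> /(allP L_bound) /allP ub; rewrite /comp -map_comp; apply/eq_in_map => x.
rewrite mem_iota add0n /= => x5; rewrite foldl_cat -pkey_foldl //.
by apply: ub; apply/mapP; exists x; rewrite // mem_iota.
Qed.

Lemma mem_pkey w : all (fun j => j < 4)%N w -> ~~ odd (size w) -> pkey w \in L.
Proof.
move: w; apply: (@even_word_ind (fun w => pkey w \in L)) => [|w g _ gP wP]; first exact: L_nil.
by rewrite pkey_cat //; have /allP /(_ _ wP) /allP := L_closed; apply.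
Qed.
End Planes.

Lemma P60_nil : pkey [::] \in P60. Proof. by vm_compute. Qed.

Definition pkey_P60 := mem_pkey P60_nil P60_bound P60_closed.

(** * Reduction modulo sqrt 5 *)

Section ModSqrt5.
Notation F5 := 'F_5.
Let f : F5 := 3%:R.

Lemma f5_golden : f * f = f + 1. Proof. exact/eqP. Qed.

Lemma int_of_Z_mod5 a : ((int_of_Z a)%:~R : F5) = (Z.to_nat (Z.modulo a (Zpos 5)))%:R.
Proof.
rewrite {1}(Z_div_mod_eq_full a (Zpos 5)) int_of_ZD int_of_ZM rmorphD rmorphM /=.
have -> : ((int_of_Z (Zpos 5))%:~R : F5) = 0 by exact/eqP.
rewrite mul0r add0r; have [] := Z.mod_pos_bound a (Zpos 5) (erefl _).
case: (Z.modulo _ _) => [|p|p] //= *; by rewrite ?pmulrn.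
Qed.

Lemma zval_mod5 z : zval f z = (zred z)%:R.
Proof.
rewrite /zred -int_of_Z_mod5 int_of_ZD int_of_ZM rmorphD rmorphM /zval /=.
by rewrite mulrC.
Qed.

Lemma zred_bound z : (zred z < 5)%N.
Proof.
rewrite /zred; have [] := Z.mod_pos_bound (Z.add z.1 (Z.mul (Zpos 3) z.2)) (Zpos 5) (erefl _).
by move: (Z.modulo _ _) => m; lia.
Qed.

End ModSqrt5.

(* Modulo sqrt 5 the form has radical spanned by (1,-1,1,-1), so the group acts
   on the 3-dimensional quotient, with matrices quo_mx. *)
Section Quotient.
Notation F5 := 'F_5.
Let f : F5 := 3%:R.
Let B : 'M[F5]_4 := zmx f 3 G9.

Definition rad : 'rV[F5]_4 := \row_j (if odd j then -1 else 1).
Definition inc_mx : 'M[F5]_(3, 4) := \matrix_(i, j) (val i == val j)%:R.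
Definition prj_mx : 'M[F5]_(4, 3) :=
  \matrix_(i, j) (if i == ord_max then (if val j == 1%N then -1 else 1) else (val i == val j)%:R).
Definition quo_mx w : 'M[F5]_3 := inc_mx *m cox_word B w *m prj_mx.

Lemma radB : rad *m B = 0.
Proof.
apply/matrixP => i j; rewrite !mxE !big_ord_recl big_ord0 !mxE.
by case: j => [[|[|[|[|j]]]] jP] //; apply/eqP.
Qed.

Lemma rad_prj : rad *m prj_mx = 0.
Proof.
apply/matrixP => i j; rewrite !mxE !big_ord_recl big_ord0 !mxE.
by case: j => [[|[|[|j]]] jP] //; apply/eqP.
Qed.

Lemma prj_inc : prj_mx *m inc_mx = 1%:M + (delta_mx ord_max 0 : 'cV[F5]_4) *m rad.
Proof.
apply/matrixP => i j; rewrite !mxE !big_ord_recl !big_ord0 !mxE.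
by case: i => [[|[|[|[|i]]]] iP] //; case: j => [[|[|[|[|j]]]] jP] //; apply/eqP.
Qed.

Lemma inc_prj : inc_mx *m prj_mx = 1%:M.
Proof.
apply/matrixP => i j; rewrite !mxE !big_ord_recl !big_ord0 !mxE.
by case: i => [[|[|[|i]]] iP] //; case: j => [[|[|[|j]]] jP] //; apply/eqP.
Qed.

Lemma rad_word w : rad *m cox_word B w = rad.
Proof.
elim: w => [|i w IH]; first by rewrite cox_word_nil mulmx1.
by rewrite cox_word_cons mulmxA mul_cox_refl radB mxE scale0r subr0.
Qed.

(** Up to multiples of the radical, [prj_mx *m inc_mx] is the identity; the group fixes the radical
    and the projection kills it. *)
Lemma quo_prj w : prj_mx *m quo_mx w = cox_word B w *m prj_mx.
Proof.
rewrite /quo_mx !mulmxA prj_inc !mulmxDl mul1mx -!mulmxA.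
by rewrite (mulmxA rad) rad_word rad_prj mulmx0 addr0.
Qed.

Lemma quo_cat w u : quo_mx (w ++ u) = quo_mx w *m quo_mx u.
Proof.
rewrite [quo_mx w]/quo_mx -!mulmxA quo_prj.
by rewrite /quo_mx cox_word_cat !mulmxA.
Qed.

Lemma quo_nil : quo_mx [::] = 1%:M.
Proof. by rewrite /quo_mx cox_word_nil mulmx1 inc_prj. Qed.

Lemma quo_trace w : \tr (quo_mx w) = \tr (cox_word B w) - 1.
Proof.
rewrite /quo_mx -mulmxA mxtrace_mulC -mulmxA prj_inc mulmxDr mulmx1 mxtraceD.
rewrite mulmxA mxtrace_mulC mulmxA rad_word; congr (_ + _).
rewrite /mxtrace big_ord1 !mxE !big_ord_recl big_ord0 !mxE.
by apply/eqP.
Qed.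

Definition mx3 (a : seq (seq nat)) : 'M[F5]_3 := \matrix_(i, j) (entry3 a i j)%:R.

Lemma entry3_mkseq (g : nat -> nat -> nat) (i j : 'I_3) :
  entry3 [seq [seq g i j | j <- iota 0 3] | i <- iota 0 3] i j = g i j.
Proof.
by rewrite /entry3 (nth_map 0%N) ?size_iota // (nth_map 0%N) ?size_iota // !nth_iota.
Qed.

Lemma mx3_bkey (w : seq 'I_4) : mx3 (bkey [seq val i | i <- w]) = quo_mx w.
Proof.
apply/matrixP => i j; rewrite /quo_mx -(zmx_word f5_golden) //.
set M := zword _ _; rewrite mxE entry3_mkseq -zval_mod5 -mulmxA.
rewrite [RHS]mxE (bigD1 (widen_ord (isT : 3 <= 4)%N i)) //= big1 => [|k /negbTE ki]; last first.
  rewrite mxE (_ : (val i == val k) = false) ?mul0r //.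
  by rewrite eq_sym; apply: contraFF ki => /eqP ik; apply/eqP/val_inj.
rewrite addr0 mxE eqxx mul1r mxE !big_ord_recl big_ord0 !mxE /=.
case: i => [[|[|[|i]]] iP] //; case: j => [[|[|[|j]]] jP] //=;
 rewrite ?(zvalD, zvalB) ?mulr1 ?mulr0 ?add0r ?addr0 ?mulrN ?mulr1 //.
Qed.
End Quotient.

Lemma val_F5 k : nat_of_ord (k%:R : 'F_5) = (k %% 5)%N.
Proof. exact: (@val_Fp_nat 5 isT). Qed.

Lemma natr_mod5 k : ((k %% 5)%:R : 'F_5) = k%:R.
Proof. by apply/val_inj; rewrite /= !val_F5 modn_mod. Qed.

Lemma mx3_mul (a b : seq (seq nat)) : mx3 (mul3 a b) = mx3 a *m mx3 b.
Proof.
apply/matrixP => i j; rewrite mxE entry3_mkseq natr_mod5 !natrD !natrM.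
by rewrite !mxE !big_ord_recl big_ord0 !mxE addr0 addrA.
Qed.

Definition normal3 (a : seq (seq nat)) :=
  a == [seq [seq (entry3 a i j %% 5)%N | j <- iota 0 3] | i <- iota 0 3].

Lemma normal3_mkseq (g : nat -> nat -> nat) : (forall i j, g i j < 5)%N ->
  normal3 [seq [seq g i j | j <- iota 0 3] | i <- iota 0 3].
Proof. by move=> g5; rewrite /normal3 /= /entry3 /= !modn_small. Qed.

Lemma mx3_inj a b : normal3 a -> normal3 b -> mx3 a = mx3 b -> a = b.
Proof.
move=> /eqP -> /eqP -> E.
have H (i j : 'I_3) : (entry3 a i j %% 5 = entry3 b i j %% 5)%N.
  move/matrixP: E => /(_ i j); rewrite !mxE !entry3_mkseq => /(congr1 (@nat_of_ord _)).
  by rewrite !val_F5 !modn_mod.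
apply/eq_in_map => i; rewrite mem_iota add0n /= => i3.
have K j (j3 : (j < 3)%N) := H (Ordinal i3) (Ordinal j3).
by rewrite (K 0 isT) (K 1 isT) (K 2 isT)%N.
Qed.

Lemma normal3_bkey w : normal3 (bkey w).
Proof. by apply: normal3_mkseq => i j; apply: zred_bound. Qed.

Definition vals (w : seq 'I_4) : seq nat := [seq val i | i <- w].

Lemma vals_lt w : all (fun j => j < 4)%N (vals w).
Proof. by apply/allP => j /mapP [i _ ->]; exact: ltn_ord. Qed.

Lemma bkey_inj w u : quo_mx w = quo_mx u -> bkey (vals w) = bkey (vals u).
Proof.
by rewrite -!mx3_bkey; apply: mx3_inj; exact: normal3_bkey.
Qed.

Lemma bkey_cat w u : bkey (vals (w ++ u)) = mul3 (bkey (vals w)) (bkey (vals u)).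
Proof.
apply: mx3_inj; first exact: normal3_bkey.
  by apply: normal3_mkseq => i j; rewrite ltn_mod.
by rewrite mx3_mul !mx3_bkey quo_cat.
Qed.

Lemma bkey_nil : bkey [::] = id3. Proof. by vm_compute. Qed.

Lemma valsP w : all (fun j => j < 4)%N w -> exists u, w = vals u.
Proof.
elim: w => [|j w IH] /=; first by exists [::].
by case/andP=> j4 /IH [u ->]; exists (Ordinal j4 :: u).
Qed.

Section B60.
Variable L : seq (seq (seq nat)).
Hypothesis L_nil : id3 \in L.
Hypothesis L_closed : all (fun p => all (fun g => mul3 p (bkey g) \in L) pairs4) L.
Hypothesis L_335 : all (fun x => is_mat3_order x 3 ==> all (fun y =>
  is_mat3_order y 3 ==> is_mat3_order (mul3 x y) 5 ==>
  (trace3 (mul3 x (mul3 y y)) == 3%N)) L) L.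

Lemma mem_bkey w : all (fun j => j < 4)%N w -> ~~ odd (size w) -> bkey w \in L.
Proof.
move: w; apply: (@even_word_ind (fun w => bkey w \in L)) => [|w g w4 gP wP].
  by rewrite bkey_nil; exact: L_nil.
have [u Eu] := valsP w4; have [v Ev] : exists v, g = vals v.
  by apply: valsP; apply: (allP (isT : all (all (fun j => j < 4)%N) pairs4)).
rewrite Eu Ev /vals -map_cat -/(vals _) bkey_cat -Eu -Ev.
by have /allP /(_ _ wP) /allP := L_closed; apply.
Qed.

Lemma quo_order w n : iter n (mulmx (quo_mx w)) 1%:M = 1%:M -> quo_mx w != 1%:M ->
  is_mat3_order (bkey (vals w)) n.
Proof.
have E k : mx3 (iter k (mul3 (bkey (vals w))) id3) = iter k (mulmx (quo_mx w)) 1%:M.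
  elim: k => [|k IH] /=; last by rewrite mx3_mul IH mx3_bkey.
  by rewrite -bkey_nil (mx3_bkey [::]) /quo_mx cox_word_nil mulmx1 inc_prj.
have id3N : normal3 id3 by vm_compute.
have E0 : mx3 id3 = 1%:M by rewrite (E 0%N).
move=> wn w1; apply/andP; split.
  apply/eqP; apply: mx3_inj => //; last by rewrite E wn.
  by case: n wn => // n _; apply: normal3_mkseq => i j; rewrite ltn_mod.
by apply: contraNneq w1 => H; rewrite -mx3_bkey H E0.
Qed.

Lemma mx3_trace a : \tr (mx3 a) = (trace3 a)%:R.
Proof.
rewrite /trace3 natr_mod5 !natrD /mxtrace !big_ord_recl big_ord0 !mxE /=.
by rewrite addr0 addrA.
Qed.

Lemma quo_trace_335 (x y : seq 'I_4) : ~~ odd (size x) -> ~~ odd (size y) ->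
  iter 3 (mulmx (quo_mx x)) 1%:M = 1%:M -> quo_mx x != 1%:M ->
  iter 3 (mulmx (quo_mx y)) 1%:M = 1%:M -> quo_mx y != 1%:M ->
  iter 5 (mulmx (quo_mx (x ++ y))) 1%:M = 1%:M -> quo_mx (x ++ y) != 1%:M ->
  \tr (quo_mx (x ++ y ++ y)) = 3%:R.
Proof.
move=> ox oy x3 x1 y3 y1 z5 z1.
have xL : bkey (vals x) \in L by rewrite mem_bkey ?vals_lt ?size_map.
have yL : bkey (vals y) \in L by rewrite mem_bkey ?vals_lt ?size_map.
have /allP /(_ _ xL) /implyP /(_ (quo_order x3 x1)) /allP := L_335.
move/(_ _ yL)/implyP/(_ (quo_order y3 y1)); rewrite -bkey_cat.
move/implyP/(_ (quo_order z5 z1)); rewrite -!bkey_cat => /eqP T.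
by rewrite -mx3_bkey mx3_trace T.
Qed.
End B60.

Lemma B60_nil : id3 \in B60. Proof. by vm_compute. Qed.

Definition quo_trace_B60 := quo_trace_335 B60_nil B60_closed trace_335_mod5.

Lemma zval_inj (R : realFieldType) (phi : R) : phi * phi = phi + 1 ->
  injective (zval phi).
Proof.
move=> phi2.
have golden_indep (a b : int) : a%:~R + b%:~R * phi = 0 :> R -> b = 0.
  move=> H; apply/eqP; apply: contraT => b0.
  (* Since (2 phi - 1)^2 = 5, a relation a + b phi = 0 gives this equation between integers, whose
     two sides have 5-adic valuations of different parity. *)
  have : (a + a + b) ^+ 2 = 5 * b ^+ 2 :> int.
    apply: (@intr_inj R); rewrite !(rmorphXn, rmorphM, rmorphD) /=.
    have -> : (a%:~R : R) = - (b%:~R * phi) by apply/eqP; rewrite -subr_eq0 opprK H.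
    ring: phi2.
  move/(congr1 absz); rewrite !(abszX, abszM) => /(congr1 (logn 5)).
  have b0' : (0 < `|b|)%N by rewrite absz_gt0.
  rewrite lognM ?expn_gt0 ?b0' // !lognX !mul2n => /(congr1 odd).
  by rewrite oddD !odd_double.
move=> [a b] [c d] /= E.
have H : zval phi (zsub (a, b) (c, d)) = 0 by rewrite zvalB E subrr.
have d0 := golden_indep _ _ H.
move: H; rewrite /zval d0 mul0r addr0 /= => /eqP; rewrite intr_eq0 => /eqP a0.
move: d0 a0; rewrite /= !int_of_ZB => /eqP; rewrite subr_eq0 => /eqP d0 /eqP.
rewrite subr_eq0 => /eqP a0.
by rewrite (can_inj int_of_ZK d0) (can_inj int_of_ZK a0).
Qed.

(** * Torsion in Gamma_9 *)

Section Gamma9.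
Context {R : realFieldType}.
Variable phi : R.
Hypothesis phi2 : phi * phi = phi + 1.
Hypothesis phi_gt0 : 0 < phi.
Let B : 'M[R]_4 := zmx phi 3 G9.
Notation wd := (cox_word B).

Lemma B9_diag i : B i i = 2.
Proof.
by rewrite mxE; case: i => [[|[|[|[|i]]]] iP] //; rewrite /zval /= mul0r addr0.
Qed.

Lemma B9_sym i j : B i j = B j i.
Proof.
rewrite !mxE; case: i => [[|[|[|[|i]]]] iP] //; by case: j => [[|[|[|[|j]]]] jP].
Qed.

Definition plane_braid (i j : 'I_4) m :=
  all (fun x => foldl plane_act x (vals (alternating i j m)) ==
                foldl plane_act x (vals (alternating j i m))) (iota 0 10).

Lemma B9_off i j : i != j ->
  [\/ B i j = 0 /\ plane_braid i j 2, B i j = -1 /\ plane_braid i j 3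
    | B i j = - phi /\ plane_braid i j 5].
Proof.
rewrite mxE.
case: i => [[|[|[|[|i]]]] iP] //; case: j => [[|[|[|[|j]]]] jP] // _;
 first [ by constructor 1; split; [rewrite /zval /= mul0r addr0 | vm_compute]
       | by constructor 2; split; [rewrite /zval /= mul0r addr0 | vm_compute]
       | by constructor 3; split; [rewrite /zval /= add0r mulN1r | vm_compute]].
Qed.

Lemma B9_off' i j : i != j -> [\/ B i j = 0, B i j = -1 | B i j = - phi].
Proof. by case/B9_off => -[-> _]; [constructor 1|constructor 2|constructor 3]. Qed.

Definition face_act (x : nat) (i : 'I_4) := plane_act x i.

Lemma foldl_face_act x w : foldl face_act x w = foldl plane_act x (vals w).
Proof. by elim: w x => //= i w IH x; rewrite IH. Qed.

Lemma plane_act_out x i : (10 <= x)%N -> plane_act x i = x.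
Proof.
move=> x10; rewrite /plane_act nth_default //; apply: leq_trans x10.
by case: i => [|[|[|[|i]]]] //=; rewrite nth_nil.
Qed.

Lemma foldl_plane_out x w : (10 <= x)%N -> foldl plane_act x w = x.
Proof. by move=> x10; elim: w => //= i w IH; rewrite plane_act_out. Qed.

Lemma face_act_invol x i : face_act (face_act x i) i = x.
Proof.
have [x10|x10] := leqP 10 x; first by rewrite /face_act !plane_act_out.
have H : all (fun j => all (fun x => plane_act (plane_act x j) j == x) (iota 0 10)) (iota 0 4).
  by vm_compute.
apply/eqP; apply: (allP (allP H i _)); first by rewrite mem_iota ltn_ord.
by rewrite mem_iota.
Qed.

Lemma face_act_braid x i j : i != j ->
  foldl face_act x (alternating i j (cox_order B i j)) =
  foldl face_act x (alternating j i (cox_order B i j)).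
Proof.
move=> ij; rewrite !foldl_face_act.
have [x10|x10] := leqP 10 x; first by rewrite !foldl_plane_out.
have xI : x \in iota 0 10 by rewrite mem_iota.
have [p1 p0] := phi_neq1 phi2.
suff H : plane_braid i j (cox_order B i j) by exact/eqP/(allP H).
rewrite /cox_order; have [] := B9_off ij => -[-> H].
- by rewrite eqxx.
- by rewrite oppr_eq0 oner_eq0 eqxx.
- by rewrite oppr_eq0 (negbTE p0) eqr_opp (negbTE p1).
Qed.

Lemma wd_equiv w u : wd w = wd u -> equiv B face_act w u.
Proof.
exact: (cox_word_inj phi2 phi_gt0 B9_diag B9_sym B9_off' face_act_invol face_act_braid).
Qed.

Lemma wd_foldl w u x : wd w = wd u ->
  foldl plane_act x (vals w) = foldl plane_act x (vals u).
Proof. by move=> /wd_equiv [_ /(_ x)]; rewrite !foldl_face_act. Qed.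

Lemma wd_pkey w u : wd w = wd u -> pkey (vals w) = pkey (vals u).
Proof. by move=> wu; apply/eq_in_map => x _; exact: wd_foldl. Qed.

Lemma wd_zentry w u (i j : 'I_4) : wd w = wd u ->
  zentry (zword G9 (vals w)) i j = zentry (zword G9 (vals u)) i j.
Proof.
rewrite -!(zmx_word phi2) // => /matrixP /(_ i j).
by rewrite !mxE => /(zval_inj phi2).
Qed.

(** An element of Z[phi] is determined by its real value, so equal real matrices have equal entries
    over Z[phi] and equal reductions. *)
Lemma wd_quo w u : wd w = wd u -> quo_mx w = quo_mx u.
Proof.
move=> wu; rewrite /quo_mx; congr (_ *m _ *m _).
rewrite -!(zmx_word f5_golden) //; apply/matrixP => i j.
by rewrite !mxE (wd_zentry _ _ wu).
Qed.

Lemma wd_rev_r w : wd (w ++ rev w) = 1%:M.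
Proof.
by rewrite (equiv_rev_r B9_diag face_act_invol w).1 cox_word_nil.
Qed.

Lemma foldl_plane_parity x w : (x < 10)%N ->
  [/\ (foldl plane_act x (vals w) < 10)%N &
      (foldl plane_act x (vals w) < 5)%N = (x < 5)%N (+) odd (size w)].
Proof.
have H : all (fun j => all (fun x => (plane_act x j < 10)%N &&
   ((plane_act x j < 5)%N == ~~ (x < 5)%N)) (iota 0 10)) (iota 0 4).
  by vm_compute.
elim: w x => [|i w IH] x x10 /=; first by rewrite x10 addbF.
have : (plane_act x i < 10)%N && ((plane_act x i < 5)%N == ~~ (x < 5)%N).
  apply: (allP (allP H i _)); first by rewrite mem_iota ltn_ord.
  by rewrite mem_iota.
move=> /andP [xi /eqP E]; have [-> ->] := IH _ xi; split=> //.
by rewrite E addNb addbN.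
Qed.

(** Every reflection exchanges the two families of planes, so the family of the image of plane 0
    shows the parity of a word. *)
Lemma wd_parity w u : wd w = wd u -> odd (size w) = odd (size u).
Proof.
move=> wu; have := wd_foldl 0 wu.
have [_ E] := foldl_plane_parity w (isT : (0 < 10)%N).
have [_ F] := foldl_plane_parity u (isT : (0 < 10)%N).
by move=> H; move: E; rewrite H F => /addbI.
Qed.

(** All four properties are invariant under conjugation by even words, which carries them from the
    vertex groups to all torsion. *)
Definition torsion_spec g :=
  [/\ pkey (vals g) != id5, quo_mx g != 1%:M,
      [\/ wd (g ++ g) = 1%:M, wd (g ++ g ++ g) = 1%:M | wd (g ++ g ++ g ++ g ++ g) = 1%:M]
    & wd (g ++ g ++ g ++ g ++ g) = 1%:M ->
      \tr (wd g) = zval phi (if pkey (vals g) \in class5 then (Zpos 1, Zpos 1) else (Zpos 2, Zneg 1))].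

Lemma zword_nil_wd w : (zword G9 (vals w) == zword G9 [::]) = (wd w == 1%:M).
Proof.
apply/eqP/eqP => [E|E].
  by rewrite -(zmx_word phi2) // E -(cox_word_nil B) -(zmx_word phi2).
have H (i j : 'I_4) : zentry (zword G9 (vals w)) i j = zentry (zword G9 [::]) i j.
  by apply: (@wd_zentry w [::]); rewrite cox_word_nil.
have sz v k : size (foldl (zact G9) (zunit 4 k) v) = 4%N.
  elim/last_ind: v => [|v l _]; first by rewrite size_map size_iota.
  by rewrite foldl_rcons size_zact.
apply: (@eq_from_nth _ [::]); first by rewrite !size_map.
move=> i; rewrite size_map size_iota => i4.
have szi v : size (nth [::] (zword G9 v) i) = 4%N.
  by rewrite (nth_map 0%N) ?size_iota // sz.
apply: (@eq_from_nth _ z0) => [|j]; rewrite szi ?szi // => j4.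
exact: (H (Ordinal i4) (Ordinal j4)).
Qed.

Lemma vals_cat w u : vals (w ++ u) = vals w ++ vals u.
Proof. exact: map_cat. Qed.

Lemma face_torsion i u : i \notin u -> ~~ odd (size u) -> wd u != 1%:M -> torsion_spec u.
Proof.
move=> iu ou u1.
have fu : on_face i (vals u).
  apply/allP => j /mapP [k ku ->]; rewrite ltn_ord /=.
  by apply: contraNneq iu => /val_inj <-.
have [v0 /andP [v4 chk] [Ez Eo]] := face_word (ltn_ord i) fu.
have [v Ev] := valsP v4; rewrite {}Ev {v0 v4} in chk Ez Eo.
have uv : wd u = wd v by rewrite -!(zmx_word phi2) // -/(vals _) Ez.
move/implyP: chk; rewrite -Eo size_map => /(_ ou) /implyP.
rewrite zword_nil_wd -uv -!vals_cat !zword_nil_wd => /(_ u1) /and4P [k1 k2 k3 k4].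
have E2 : wd (u ++ u) = wd (v ++ v) by rewrite !cox_word_cat uv.
have E3 : wd (u ++ u ++ u) = wd (v ++ v ++ v) by rewrite !cox_word_cat uv.
have E5 : wd (u ++ u ++ u ++ u ++ u) = wd (v ++ v ++ v ++ v ++ v) by rewrite !cox_word_cat uv.
rewrite -E2 -E3 -E5 in k3 k4; rewrite -(wd_pkey uv) in k1 k4.
split.
- exact: k1.
- apply: contraNneq k2 => H; rewrite -bkey_nil -[bkey [::]]/(bkey (vals [::])).
  by apply/eqP/bkey_inj; rewrite -(wd_quo uv) H quo_nil.
- by case/or3P: k3 => /eqP; [constructor 1|constructor 2|constructor 3].
- move=> u5; have k5 := eqP (implyP k4 (introT eqP u5)); apply: etrans (congr1 (zval phi) k5).
  by rewrite uv -(zmx_word phi2) // zmx_trace ?size_map ?size_iota.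
Qed.

Theorem torsion9 g m : ~~ odd (size g) -> (0 < m)%N -> wd g ^+ m = 1 ->
  wd g = 1%:M \/ torsion_spec g.
Proof.
move=> og m0 gm.
(* Every row of the Gram matrix sums to 1 - phi < 0, so the sum of the normals lies in the chamber
   and has norm 4 (1 - phi) < 0. *)
pose y0 : 'rV[R]_4 := const_mx 1.
have y0B i : (y0 *m B) 0 i = 1 - phi.
  rewrite mxE !big_ord_recl big_ord0 !mxE !mul1r addr0 -!zvalD.
  apply: (@etrans _ _ (zval phi (Zpos 1, Zneg 1))); last by rewrite /zval /= mulN1r.
  by congr zval; case: i => [[|[|[|[|i]]]] iP].
have phi_gt1 : 1 < phi.
  rewrite ltNge; apply/negP => H; have : phi * phi <= phi by rewrite ler_piMr // ltW.
  by rewrite phi2 gerDl ler10.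
have y0c : in_chamber B y0 by move=> i; rewrite y0B; lra.
have y0t : bform B y0 y0 < 0.
  rewrite bformE !big_ord_recl big_ord0 !y0B !mxE; lra.
have [w [u [i [iu gE]]]] := torsion_in_parabolic phi2 phi_gt0 B9_diag B9_sym B9_off'
  face_act_invol face_act_braid y0c y0t m0 gm.
(* An odd conjugator would exchange the families of planes. It is made even by a reflection [s]
   different from [i]: w u w^-1 = (w s)(s u s)(w s)^-1, and [s u s] still avoids [i]. *)
have {w iu gE u} [w [u [iu ow gE]]] : exists w u, [/\ i \notin u, ~~ odd (size w) &
    wd g = wd (w ++ u ++ rev w)].
  have [ow|ow] := boolP (odd (size w)); last by exists w, u.
  pose s : 'I_4 := if i == 0 then 1 else 0.
  exists (rcons w s), (s :: rcons u s); split.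
  - have si : i != s by rewrite /s; case: (eqVneq i 0) => [->|].
    by rewrite inE mem_rcons inE !negb_or iu si.
  - by rewrite size_rcons /= ow.
  - set S := cox_refl B s; have SS : S *m S = 1%:M by exact: cox_refl_invol B9_diag s.
    have E1 : wd (rcons w s) = wd w *m S.
      by rewrite -cats1 cox_word_cat cox_word_cons cox_word_nil mulmx1.
    have E2 : wd (s :: rcons u s) = S *m wd u *m S.
      by rewrite -cats1 cox_word_cons cox_word_cat cox_word_cons cox_word_nil mulmx1 mulmxA.
    rewrite gE !(cox_word_cat B) E1 E2 rev_rcons cox_word_cons -/S !mulmxA.
    by rewrite -(mulmxA (wd w) S S) SS mulmx1 -(mulmxA _ S S) SS mulmx1.
have ou : ~~ odd (size u).
  by move: og; rewrite (wd_parity gE) !size_cat size_rev !oddD (negbTE ow) addbF.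
have wr := wd_rev_r w; have rw : wd (rev w ++ w) = 1%:M.
  by have := wd_rev_r (rev w); rewrite revK.
have conj v : wd (w ++ v ++ rev w) = wd w *m wd v *m wd (rev w).
  by rewrite !cox_word_cat mulmxA.
have conj1 v : (wd (w ++ v ++ rev w) = 1%:M) <-> wd v = 1%:M.
  rewrite conj; split=> [H|->]; last by rewrite mulmx1 -cox_word_cat.
  have <- : wd (rev w) *m (wd w *m wd v *m wd (rev w)) *m wd w = wd v.
    by rewrite !mulmxA -cox_word_cat rw mul1mx -mulmxA -cox_word_cat rw mulmx1.
  by rewrite H mulmx1 -cox_word_cat rw.
have v1 : wd u != 1%:M -> torsion_spec u by exact: face_torsion iu ou.
have [u1|/v1 [k1 k2 k3 k4]] := eqVneq (wd u) 1%:M.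
  by left; rewrite gE conj1.
right.
have conjn n v : wd v = wd w *m wd u *m wd (rev w) ->
    wd (flatten (nseq n v)) = wd (w ++ flatten (nseq n u) ++ rev w).
  move=> vE; elim: n => [|n IH] /=; first by rewrite wr cox_word_nil.
  rewrite cox_word_cat IH vE !cox_word_cat !mulmxA.
  by rewrite -(mulmxA _ (wd (rev w)) (wd w)) -(cox_word_cat B (rev w) w) rw mulmx1.
have gE' : wd g = wd w *m wd u *m wd (rev w) by rewrite gE conj.
have e2 := conjn 2%N g gE'; have e3 := conjn 3%N g gE'; have e5 := conjn 5%N g gE'.
rewrite /= !cats0 in e2 e3 e5.
have kP v : ~~ odd (size v) -> pkey (vals v) \in P60.
  by move=> ov; apply: pkey_P60; rewrite ?vals_lt ?size_map.
have kcat x y : ~~ odd (size x) ->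
    pkey (vals (x ++ y)) = comp (pkey (vals x)) (pkey (vals y)).
  by move=> ox; rewrite vals_cat; exact: (pkey_cat P60_bound _ (kP x ox)).
have kE : pkey (vals g) = comp (comp (pkey (vals w)) (pkey (vals u))) (pkey (vals (rev w))).
  rewrite -(kcat w u ow) -(kcat (w ++ u) (rev w)); last first.
    by rewrite size_cat oddD (negbTE ow) (negbTE ou).
  by apply: wd_pkey; rewrite -catA.
have kww : comp (pkey (vals w)) (pkey (vals (rev w))) = id5.
  rewrite -(kcat w (rev w) ow) -[id5]/(pkey (vals [::])); apply: wd_pkey.
  by rewrite wr cox_word_nil.
have uE : wd u = wd (rev w ++ g ++ w).
  rewrite !cox_word_cat gE' !mulmxA -(cox_word_cat B (rev w) w) rw mul1mx -mulmxA.
  by rewrite -cox_word_cat rw mulmx1.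
split.
- apply: contra k1 => /eqP g1; apply/eqP; rewrite (wd_pkey uE).
  have orw : ~~ odd (size (rev w)) by rewrite size_rev.
  rewrite (kcat (rev w) _ orw) (kcat g w og) g1 -[id5]/(pkey (vals [::])).
  rewrite -(kcat [::] w isT) -(kcat (rev w) w orw).
  by apply: wd_pkey; rewrite rw cox_word_nil.
- apply: contra k2 => /eqP g1; apply/eqP; rewrite (wd_quo uE) !quo_cat g1 mul1mx -quo_cat.
  by rewrite -quo_nil; apply: wd_quo; rewrite rw cox_word_nil.
- rewrite e2 e3 e5; case: k3 => k3; [constructor 1|constructor 2|constructor 3]; exact/conj1.
- rewrite e5 => /conj1 /k4; rewrite gE' mxtrace_mulC mulmxA -cox_word_cat rw mul1mx => ->.
  congr (zval phi (if _ then _ else _)).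
  have orw : ~~ odd (size (rev w)) by rewrite size_rev.
  have /allP /(_ _ (kP w ow)) /allP /(_ _ (kP _ orw)) /implyP := class5_conj.
  by rewrite kww eqxx => /(_ isT) /allP /(_ _ (kP u ou)) /eqP <-; rewrite kE.
Qed.
End Gamma9.

(** * Hyperbolic simplices *)

(** The same block matrix is factored into block triangular matrices in two ways. *)
Lemma det_1Bmul (A : comNzRingType) m (c : 'cV[A]_m) (r : 'rV[A]_m) :
  \det (1%:M - c *m r) = 1 - (r *m c) 0 0.
Proof.
have E1 : block_mx (1%:M : 'M[A]_1) r c 1%:M =
    block_mx 1%:M 0 c 1%:M *m block_mx 1%:M r 0 (1%:M - c *m r).
  rewrite mulmx_block ?mul1mx ?mul0mx ?mulmx1 ?mulmx0 ?addr0.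
  by congr block_mx; rewrite addrC subrK.
have E2 : block_mx (1%:M : 'M[A]_1) r c 1%:M =
    block_mx (1%:M - r *m c) r 0 1%:M *m block_mx 1%:M 0 c 1%:M.
  by rewrite mulmx_block ?mul1mx ?mul0mx ?mulmx1 ?mulmx0 ?add0r subrK.
have := congr1 determinant E1; rewrite {1}E2 !det_mulmx !det_ublock !det_lblock !det1.
by rewrite !mul1r !mulr1 => <-; rewrite det_mx11 !mxE eqxx.
Qed.

Section Lorentz.
Context {R : realType} {n : nat}.
Implicit Types (x y u v p : 'rV[R]_n.+1).

Lemma lorentzC x y : lorentz x y = lorentz y x.
Proof.
rewrite /lorentz mulrC; congr (_ + _); apply: eq_bigr => i _; exact: mulrC.
Qed.

Lemma lorentzDl x y v : lorentz (x + y) v = lorentz x v + lorentz y v.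
Proof.
rewrite /lorentz mxE mulrDl opprD -!addrA; congr (_ + _); rewrite addrCA; congr (_ + _).
by rewrite -big_split; apply: eq_bigr => i _; rewrite mxE mulrDl.
Qed.

Lemma lorentzZl a x v : lorentz (a *: x) v = a * lorentz x v.
Proof.
rewrite /lorentz mxE mulrDr mulrN mulrA; congr (_ + _); rewrite mulr_sumr.
by apply: eq_bigr => i _; rewrite mxE mulrA.
Qed.

Lemma lorentzDr x y v : lorentz v (x + y) = lorentz v x + lorentz v y.
Proof. by rewrite !(lorentzC v) lorentzDl. Qed.

Lemma lorentzZr a x v : lorentz v (a *: x) = a * lorentz v x.
Proof. by rewrite !(lorentzC v) lorentzZl. Qed.

Lemma lorentzNl x v : lorentz (- x) v = - lorentz x v.
Proof. by rewrite -scaleN1r lorentzZl mulN1r. Qed.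

Lemma lorentzNr x v : lorentz v (- x) = - lorentz v x.
Proof. by rewrite !(lorentzC v) lorentzNl. Qed.

Lemma lorentz_suml (I : finType) (F : I -> 'rV[R]_n.+1) v :
  lorentz (\sum_i F i) v = \sum_i lorentz (F i) v.
Proof.
apply: (big_morph (fun x => lorentz x v)); first by move=> x y; exact: lorentzDl.
by rewrite -(scale0r 0) lorentzZl mul0r.
Qed.

(* With p on the hyperboloid, p_0^2 <x,x> = x_0^2 + sum_i (p_0 x_i - x_0 p_i)^2. *)
Lemma lorentz_orth_timelike p x : lorentz p p = -1 -> lorentz x p = 0 -> x != 0 ->
  0 < lorentz x x.
Proof.
rewrite /lorentz; set x0 := x 0 ord0; set p0 := p 0 ord0.
set sp := \sum_(i < n) p _ _ * _; set sxp := \sum_(i < n) x _ _ * p _ _.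
set sx := \sum_(i < n) x _ _ * x _ _ => Hp Hxp xn0.
have E : p0 ^+ 2 * (- (x0 * x0) + sx) = x0 ^+ 2 +
    \sum_(i < n) (p0 * x 0 (lift ord0 i) - x0 * p 0 (lift ord0 i)) ^+ 2.
  have -> : \sum_(i < n) (p0 * x 0 (lift ord0 i) - x0 * p 0 (lift ord0 i)) ^+ 2 =
      p0 ^+ 2 * sx - 2 * p0 * x0 * sxp + x0 ^+ 2 * sp.
    rewrite !mulr_sumr -sumrN -!big_split; apply: eq_bigr => i _ /=; ring.
  have -> : sp = p0 * p0 - 1 by move: Hp; lra.
  have -> : sxp = x0 * p0 by move: Hxp; lra.
  ring.
have p0_gt0 : 0 < p0 ^+ 2.
  rewrite lt_def sqr_ge0 andbT; apply/eqP => H.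
  have : 0 <= sp by apply: sumr_ge0 => i _; rewrite -expr2 sqr_ge0.
  by move: Hp; rewrite -expr2 H; lra.
rewrite -(pmulr_rgt0 _ p0_gt0) E lt_def; apply/andP; split; last first.
  by rewrite addr_ge0 ?sqr_ge0 // sumr_ge0 // => i _; exact: sqr_ge0.
apply: contra xn0; rewrite paddr_eq0 ?sqr_ge0 //; last first.
  by rewrite sumr_ge0 // => i _; exact: sqr_ge0.
rewrite sqrf_eq0 => /andP [/eqP x00]; rewrite psumr_eq0 => [|i _]; last exact: sqr_ge0.
move=> /allP H; apply/eqP/rowP => i; rewrite mxE.
have [j ->|->] := unliftP ord0 i; last exact: x00.
have := H j (mem_index_enum _); rewrite /= x00 mul0r subr0 sqrf_eq0 mulf_eq0.
by case/orP => /eqP // p00; move: p0_gt0; rewrite p00 expr0n ltxx.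
Qed.

Lemma mul_reflection_mx v u : v *m reflection_mx u = v - (2 * lorentz v u) *: u.
Proof.
have lin : linear (fun x : 'rV[R]_n.+1 => x - (2 * lorentz x u) *: u).
  move=> a x y; rewrite lorentzDl lorentzZl; apply/rowP => k; rewrite !mxE; ring.
pose f := HB.pack_for {linear 'rV[R]_n.+1 -> 'rV[R]_n.+1}
  (fun x : 'rV[R]_n.+1 => x - (2 * lorentz x u) *: u)
  (GRing.isLinear.Build _ _ _ _ _ lin).
exact: (mul_rV_lin1 f v).
Qed.

Definition lorentz_mx : 'M[R]_n.+1 :=
  diag_mx (\row_i (if i == ord0 then -1 else 1)).

Lemma mul_lorentz_mx v i :
  (v *m lorentz_mx) 0 i = (if i == ord0 then - v 0 i else v 0 i).
Proof.
rewrite /lorentz_mx mul_mx_diag !mxE; case: ifP => _; by rewrite ?mulrN1 ?mulr1.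
Qed.

Lemma lorentz_mxE x y : lorentz x y = (x *m lorentz_mx *m y^T) 0 0.
Proof.
rewrite mxE big_ord_recl /lorentz; congr (_ + _).
  by rewrite mul_lorentz_mx [y^T _ _]mxE eqxx mulNr.
by apply: eq_bigr => i _; rewrite mul_lorentz_mx [y^T _ _]mxE.
Qed.

Lemma lorentz_mx_unit : lorentz_mx \in unitmx.
Proof.
suff E : lorentz_mx *m lorentz_mx = 1%:M by case: (mulmx1_unit E).
apply: eq_mulmx_row => v; rewrite mulmxA mulmx1; apply/rowP => i.
by rewrite !mul_lorentz_mx; case: (i == ord0); rewrite ?opprK.
Qed.

Lemma reflection_mxE u : reflection_mx u = 1%:M - (2 *: (lorentz_mx *m u^T)) *m u.
Proof.
apply: eq_mulmx_row => v; rewrite mul_reflection_mx mulmxBr mulmx1; congr (_ - _).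
rewrite mulmxA -scalemxAr mulmxA -scalemxAl lorentz_mxE -scalerA; congr (_ *: _).
set m := _ *m u^T; rewrite {2}(mx11_scalar m) mul_scalar_mx //.
Qed.

Lemma reflection_invol u : lorentz u u = 1 -> reflection_mx u *m reflection_mx u = 1%:M.
Proof.
move=> u1; apply: eq_mulmx_row => v; rewrite mulmxA mulmx1 !mul_reflection_mx.
rewrite lorentzDl lorentzNl lorentzZl u1; apply/rowP => k; rewrite !mxE; ring.
Qed.

Lemma det_reflection u : lorentz u u = 1 -> \det (reflection_mx u) = -1.
Proof.
move=> u1; rewrite reflection_mxE det_1Bmul -scalemxAr mxE mulmxA -lorentz_mxE u1; ring.
Qed.

Lemma lorentz_reflection u x y : lorentz u u = 1 ->
  lorentz (x *m reflection_mx u) (y *m reflection_mx u) = lorentz x y.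
Proof.
move=> u1; rewrite !mul_reflection_mx.
rewrite !(lorentzDl, lorentzDr, lorentzNl, lorentzNr, lorentzZl, lorentzZr).
rewrite u1 (lorentzC u y); ring.
Qed.

End Lorentz.

Lemma acos_outside (R : realType) (x : R) : ~ (-1 <= x <= 1) -> acos x = 0.
Proof.
move=> xo; rewrite unlock /acos; case: xgetP => [y ->|] //= [_ cx].
by case: xo; rewrite -cx cos_geN1 cos_le1.
Qed.

Section Words.
Context {R : realType} {n k : nat}.
Variable u : 'I_k.+1 -> 'rV[R]_n.+1.
Hypothesis u_unit : forall i, lorentz (u i) (u i) = 1.
Implicit Types w : seq 'I_k.+1.

Definition rword w : 'M[R]_n.+1 := \prod_(i <- w) reflection_mx (u i).
Definition gram2 : 'M[R]_k.+1 := \matrix_(i, j) (2 * lorentz (u i) (u j)).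
Definition rows_mx : 'M[R]_(k.+1, n.+1) := \matrix_i u i.

Lemma rword_nil : rword [::] = 1%:M. Proof. by rewrite /rword big_nil. Qed.

Lemma rword_cons i w : rword (i :: w) = reflection_mx (u i) *m rword w.
Proof. by rewrite /rword big_cons. Qed.

Lemma rword_cat w1 w2 : rword (w1 ++ w2) = rword w1 *m rword w2.
Proof. by rewrite /rword big_cat. Qed.

Lemma rword_rev w : rword w *m rword (rev w) = 1%:M.
Proof.
elim: w => [|i w IH]; first by rewrite rword_nil mulmx1.
rewrite rev_cons -cats1 rword_cat !rword_cons rword_nil mulmx1 !mulmxA.
by rewrite -(mulmxA (reflection_mx _)) IH mulmx1 reflection_invol.
Qed.

Lemma rword_unit w : rword w \is a GRing.unit.
Proof. exact: (mulmx1_unit (rword_rev w)).1. Qed.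

Lemma rword_inv w : (rword w)^-1 = rword (rev w).
Proof.
apply: (mulrI (rword_unit w)); rewrite divrr ?rword_unit //.
exact: esym (rword_rev w).
Qed.

Lemma det_rword w : \det (rword w) = (-1) ^+ size w.
Proof.
elim: w => [|i w IH]; first by rewrite rword_nil det1.
by rewrite rword_cons det_mulmx IH det_reflection // exprS.
Qed.

Lemma lorentz_rword w x y : lorentz (x *m rword w) (y *m rword w) = lorentz x y.
Proof.
elim: w x y => [|i w IH] x y; first by rewrite rword_nil !mulmx1.
by rewrite rword_cons !mulmxA IH lorentz_reflection.
Qed.

Lemma row_rows_mx i : row i rows_mx = u i. Proof. exact: rowK. Qed.

(** Reflections in the [u i] act on the [u i] themselves by the Coxeter matrices. The number of
    roots is independent of the dimension, so this covers the four normals of the tetrahedron and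
    also three roots in R^4. *)
Lemma rows_mx_word w : rows_mx *m rword w = cox_word gram2 w *m rows_mx.
Proof.
elim: w => [|i w IH]; first by rewrite rword_nil cox_word_nil mulmx1 mul1mx.
rewrite rword_cons cox_word_cons mulmxA -[RHS]mulmxA -IH mulmxA; congr (_ *m _).
apply/row_matrixP => j; rewrite !row_mul !row_rows_mx mul_reflection_mx.
rewrite [row j (cox_refl _ _)]rowE -/(vec j) mul_cox_refl mulmxBl -scalemxAl.
rewrite -[vec j *m rows_mx]rowE -[vec i *m rows_mx]rowE !row_rows_mx.
have -> : (vec j *m gram2) 0 i = gram2 j i by rewrite -rowE mxE.
by rewrite mxE.
Qed.

Lemma generated_rword :
  generated_group [set reflection_mx (u i) | i in [set: 'I_k.+1]]%classic =
  [set M | exists w, M = rword w]%classic.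
Proof.
apply/seteqP; split=> [M|M [w ->]].
  apply; split=> [|_ [i _ <-]].
    split=> [M' [w ->]||_ _ [w ->] [w' ->]|_ [w ->]].
    - exact: rword_unit.
    - by exists [::]; rewrite rword_nil.
    - by exists (w ++ w'); rewrite rword_cat.
    - by exists (rev w); rewrite rword_inv.
  by exists [:: i]; rewrite rword_cons rword_nil mulmx1.
move=> G [[_ G1 GM _] SG]; elim: w => [|i w IH]; first by rewrite rword_nil.
by rewrite rword_cons; apply: GM => //; apply: SG; exists i.
Qed.
End Words.

Section Simplex.
Context {R : realType} {n : nat}.
Variable T : hsimplex R n.+1.

Definition vertex_dual : 'M[R]_n.+2 := lorentz_mx *m (\matrix_j T j)^T.

Lemma vertex_dual_unit : vertex_dual \in unitmx.
Proof.
by rewrite unitmx_mul lorentz_mx_unit unitmx_tr -row_free_unit; exact: vertex_free.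
Qed.

Lemma lorentz_vertex v j : lorentz v (T j) = (v *m vertex_dual) 0 j.
Proof.
rewrite lorentz_mxE /vertex_dual mulmxA [RHS]mxE [LHS]mxE; apply: eq_bigr => l _.
by rewrite !mxE.
Qed.

(** Minus the dual basis vector of vertex [i] has the right signs; being orthogonal to another
    vertex, which is timelike, it is spacelike and can be normalized. *)
Lemma exists_outward_normal i : exists v, is_outward_normal T i v.
Proof.
pose v := - (delta_mx 0 i : 'rV[R]_n.+2) *m invmx vertex_dual.
have vT j : lorentz v (T j) = - (j == i)%:R.
  by rewrite lorentz_vertex mulmxKV ?vertex_dual_unit // !mxE eqxx.
have [j ji] : exists j, j != i.
  by exists (if i == 0 then 1 else 0); case: (eqVneq i 0) => [->|]; rewrite // eq_sym.
have [Tj _] := vertex_hyperbolic T j.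
have vv : 0 < lorentz v v.
  apply: (lorentz_orth_timelike Tj); first by rewrite vT (negbTE ji) oppr0.
  apply/eqP => v0; have := vT i; rewrite v0 eqxx -(scale0r 0) lorentzZl mul0r.
  by move/eqP; rewrite eq_sym oppr_eq0 oner_eq0.
have s0 : 0 < Num.sqrt (lorentz v v) by rewrite sqrtr_gt0.
exists ((Num.sqrt (lorentz v v))^-1 *: v); split=> [|l li|].
- rewrite lorentzZl lorentzZr mulrA -expr2 exprVn sqr_sqrtr ?mulVf ?gt_eqF //.
  exact: ltW.
- by rewrite lorentzZl vT (negbTE li) oppr0 mulr0.
- by rewrite lorentzZl vT eqxx mulrN1 oppr_lt0 invr_gt0.
Qed.

Lemma facet_normalP i : is_outward_normal T i (facet_normal T i).
Proof. exact: (xgetPex 0 (exists_outward_normal i)). Qed.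

Lemma facet_normal_unit i : lorentz (facet_normal T i) (facet_normal T i) = 1.
Proof. by have [] := facet_normalP i. Qed.

Lemma outward_normal_unique i v : is_outward_normal T i v -> facet_normal T i = v.
Proof.
have [u1 uT uTi] := facet_normalP i; set u := facet_normal T i in u1 uT uTi *.
move=> [v1 vT vTi]; pose a := lorentz u (T i) / lorentz v (T i).
have a0 : 0 < a by rewrite /a -mulrNN -invrN divr_gt0 // oppr_gt0.
have E : u = a *: v.
  rewrite -[u](mulmxK vertex_dual_unit) -[a *: v](mulmxK vertex_dual_unit).
  congr (_ *m _); apply/rowP => j; rewrite -!lorentz_vertex lorentzZl; have [->|ji] := eqVneq j i; last by rewrite uT // vT // mulr0.
  by rewrite /a divfK // lt_eqF.
have : a ^+ 2 = 1 by rewrite -u1 E lorentzZl lorentzZr v1; ring.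
move/eqP; rewrite sqrf_eq1 => /orP [/eqP a1|/eqP a1]; first by rewrite E a1 scale1r.
by move: a0; rewrite a1 oppr_gt0 ltr10.
Qed.

Lemma facet_normal_basis : rows_mx (facet_normal T) \in unitmx.
Proof.
have E : rows_mx (facet_normal T) *m vertex_dual =
    diag_mx (\row_i lorentz (facet_normal T i) (T i)).
  apply/row_matrixP => i; rewrite row_mul row_rows_mx; apply/rowP => j.
  rewrite -lorentz_vertex !mxE; have [_ uT _] := facet_normalP i.
  by have [->|ij] := eqVneq j i; rewrite ?eqxx ?mulr1n // mulr0n uT.
have : rows_mx (facet_normal T) *m vertex_dual \in unitmx.
  rewrite E unitmxE det_diag unitfE; apply/prodf_neq0 => i _; rewrite mxE.
  by have [_ _ lt] := facet_normalP i; rewrite lt_eqF.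
by rewrite unitmx_mul => /andP [].
Qed.

Lemma dihedral_angle_lorentz i j m : (0 < m)%N -> dihedral_angle T i j = pi / m%:R ->
  lorentz (facet_normal T i) (facet_normal T j) = - cos (pi / m%:R).
Proof.
move=> m0; rewrite /dihedral_angle; set x := - lorentz _ _ => H.
have pm : 0 < pi / m%:R :> R by rewrite divr_gt0 ?pi_gt0 ?ltr0n.
(* Outside [-1, 1] the arc cosine takes its default value 0, which [pi / m] is not. *)
have xr : -1 <= x <= 1.
  apply: contrapT => /acos_outside E; by move: pm; rewrite -H E ltxx.
by rewrite -H acosK ?in_itv //= opprK.
Qed.

Lemma reflection_groupE :
  reflection_group T = [set M | exists w, M = rword (facet_normal T) w]%classic.
Proof. exact: (generated_rword facet_normal_unit). Qed.

Lemma rotation_groupP M : rotation_group T M <->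
  exists2 w, ~~ odd (size w) & M = rword (facet_normal T) w.
Proof.
rewrite /rotation_group reflection_groupE; split=> [[[w ->]]|[w ow ->]].
  rewrite /= det_rword; last exact: facet_normal_unit.
  move=> H; exists w => //; apply/negP => ow; move: H.
  by rewrite -signr_odd ow expr1; lra.
split; first by exists w.
by rewrite /= det_rword; [rewrite -signr_odd (negbTE ow)|exact: facet_normal_unit].
Qed.
End Simplex.

(** * Lifts to SL_2(C) *)

Section Mat2.
Variable A : comNzRingType.

Record mat2 := Mat2 { m00 : A; m01 : A; m10 : A; m11 : A }.

Implicit Types g h k : mat2.

Definition mul2 g h := Mat2 (m00 g * m00 h + m01 g * m10 h) (m00 g * m01 h + m01 g * m11 h)
                            (m10 g * m00 h + m11 g * m10 h) (m10 g * m01 h + m11 g * m11 h).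
Definition scalar2 a := Mat2 a 0 0 a.
Definition opp2 g := Mat2 (- m00 g) (- m01 g) (- m10 g) (- m11 g).
Definition adj2 g := Mat2 (m11 g) (- m01 g) (- m10 g) (m00 g).
Definition tr2 g := m00 g + m11 g.
Definition det2 g := m00 g * m11 g - m01 g * m10 g.

Lemma mat2P g h : m00 g = m00 h -> m01 g = m01 h -> m10 g = m10 h -> m11 g = m11 h -> g = h.
Proof. by case: g h => a b c d [a' b' c' d'] /= -> -> -> ->. Qed.

Lemma mul2A g h k : mul2 g (mul2 h k) = mul2 (mul2 g h) k.
Proof. by apply: mat2P => /=; ring. Qed.

Lemma mul2_1l g : mul2 (scalar2 1) g = g.
Proof. by apply: mat2P => /=; ring. Qed.

Lemma mul2_1r g : mul2 g (scalar2 1) = g.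
Proof. by apply: mat2P => /=; ring. Qed.

Lemma det2M g h : det2 (mul2 g h) = det2 g * det2 h.
Proof. by rewrite /det2 /=; ring. Qed.

Lemma det2_opp g : det2 (opp2 g) = det2 g. Proof. by rewrite /det2 /=; ring. Qed.
Lemma det2_adj g : det2 (adj2 g) = det2 g. Proof. by rewrite /det2 /=; ring. Qed.
Lemma adj2M g h : adj2 (mul2 g h) = mul2 (adj2 h) (adj2 g).
Proof. by apply: mat2P => /=; ring. Qed.
Lemma adj2K g : adj2 (adj2 g) = g. Proof. by apply: mat2P => /=; ring. Qed.

Lemma adj2_mull g : det2 g = 1 -> mul2 (adj2 g) g = scalar2 1.
Proof. by move=> g1; apply: mat2P; rewrite /= -?g1 /det2; ring. Qed.

Lemma adj2_mulr g : det2 g = 1 -> mul2 g (adj2 g) = scalar2 1.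
Proof. by move=> g1; apply: mat2P; rewrite /= -?g1 /det2; ring. Qed.

(* Fricke's identity *)
Lemma tr2_commutator g h : det2 g = 1 -> det2 h = 1 ->
  tr2 (mul2 (mul2 (adj2 h) (adj2 g)) (mul2 h g)) =
  tr2 g ^+ 2 + tr2 h ^+ 2 + tr2 (mul2 h g) ^+ 2 - tr2 g * tr2 h * tr2 (mul2 h g) - 2.
Proof.
move=> g1 h1; transitivity (tr2 g ^+ 2 * det2 h + tr2 h ^+ 2 * det2 g
    + tr2 (mul2 h g) ^+ 2 - tr2 g * tr2 h * tr2 (mul2 h g) - 2 * det2 g * det2 h).
  by rewrite /det2 /tr2 /=; ring.
by rewrite g1 h1 !mulr1.
Qed.

Lemma tr2_mul_adj g h : tr2 (mul2 (adj2 h) g) = tr2 g * tr2 h - tr2 (mul2 h g).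
Proof. by rewrite /tr2 /=; ring. Qed.

(** By Cayley-Hamilton g^2 = g - 1, hence g^3 = -1. *)
Lemma cube2 g : det2 g = 1 -> tr2 g = 1 -> mul2 (mul2 g g) g = scalar2 (-1).
Proof.
case: g => a b c d; rewrite /det2 /tr2 /= => E F.
have dE : d = 1 - a by rewrite -F; ring.
have bc : b * c = a * d - 1 by rewrite -E; ring.
rewrite dE in bc.
by rewrite dE; apply: mat2P => /=; ring: bc.
Qed.

End Mat2.

Section Mat2Field.
Variable A : fieldType.
Implicit Types g : mat2 A.

Definition pm1 g := g = scalar2 1 \/ g = scalar2 (-1).

Lemma scalar_pm1 g x y : det2 g = 1 -> x != 0 ->
  x * m00 g = y -> x * m01 g = 0 -> x * m10 g = 0 -> x * m11 g = y -> pm1 g.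
Proof.
case: g => a b c d /= det x0 ea /eqP; rewrite mulf_eq0 (negbTE x0) => /eqP b0.
move/eqP; rewrite mulf_eq0 (negbTE x0) => /eqP c0 ed.
have da : d = a by apply: (mulfI x0); rewrite ed ea.
move: det; rewrite /det2 /= b0 mul0r subr0 da -expr2 => /eqP.
by rewrite sqrf_eq1 c0 => /orP [] /eqP ->; [left|right].
Qed.

(** By Cayley-Hamilton a power of [g] is a polynomial in the trace times [g], plus a scalar. If the
    power is scalar and [g] is not, that polynomial vanishes: t for order 2, t^2 - 1 for order 3. *)
Lemma tr2_order2 g : det2 g = 1 -> ~ pm1 g -> pm1 (mul2 g g) -> tr2 g = 0.
Proof.
move=> g1 gn H; apply/eqP; apply: contra_notT gn => t0.
have [y Ey] : exists y, mul2 g g = scalar2 y by case: H => ->; eexists.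
apply: (@scalar_pm1 g (tr2 g) (y + 1)) => //.
- by have /= := congr1 (@m00 A) Ey; rewrite -g1 => <-; rewrite /tr2 /det2; ring.
- by have /= := congr1 (@m01 A) Ey; move=> <-; rewrite /tr2; ring.
- by have /= := congr1 (@m10 A) Ey; move=> <-; rewrite /tr2; ring.
- by have /= := congr1 (@m11 A) Ey; rewrite -g1 => <-; rewrite /tr2 /det2; ring.
Qed.

Lemma tr2_order3 g : det2 g = 1 -> ~ pm1 g -> pm1 (mul2 (mul2 g g) g) -> tr2 g ^+ 2 = 1.
Proof.
move=> g1 gn H; apply/eqP; rewrite -subr_eq0; apply: contra_notT gn => t0.
have [y Ey] : exists y, mul2 (mul2 g g) g = scalar2 y by case: H => ->; eexists.
case: g g1 t0 Ey {H} => a b c d g1 t0 Ey.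
have ad : a * d = 1 + b * c by rewrite -g1 /det2 /=; ring.
apply: (@scalar_pm1 _ _ (y + (a + d))) t0 _ _ _ _ => //.
- by have /= <- := congr1 (@m00 A) Ey; rewrite /tr2 /=; ring: ad.
- by have /= <- := congr1 (@m01 A) Ey; rewrite /tr2 /=; ring: ad.
- by have /= <- := congr1 (@m10 A) Ey; rewrite /tr2 /=; ring: ad.
- by have /= <- := congr1 (@m11 A) Ey; rewrite /tr2 /=; ring: ad.
Qed.

(** Here g^5 = (t^4 - 3 t^2 + 1) g - (t^3 - 2 t), and the coefficient of [g] factors as (t^2 - t -
    1)(t^2 + t - 1). *)
Lemma tr2_order5 g : det2 g = 1 -> ~ pm1 g ->
  pm1 (mul2 (mul2 (mul2 (mul2 g g) g) g) g) ->
  tr2 g ^+ 2 = tr2 g + 1 \/ tr2 g ^+ 2 = - tr2 g + 1.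
Proof.
move=> g1 gn H.
suff /eqP : (tr2 g ^+ 2 - (tr2 g + 1)) * (tr2 g ^+ 2 - (- tr2 g + 1)) = 0.
  by rewrite mulf_eq0 !subr_eq0 => /orP [] /eqP; [left|right].
apply/eqP; apply: contra_notT gn => t0.
have [y Ey] : exists y, mul2 (mul2 (mul2 (mul2 g g) g) g) g = scalar2 y.
  by case: H => ->; eexists.
case: g g1 t0 Ey {H} => a b c d g1 t0 Ey.
have ad : a * d = 1 + b * c by rewrite -g1 /det2 /=; ring.
apply: (@scalar_pm1 _ _ (y + (a + d) ^+ 3 - 2 * (a + d))) t0 _ _ _ _ => //.
- by have /= <- := congr1 (@m00 A) Ey; rewrite /tr2 /=; ring: ad.
- by have /= <- := congr1 (@m01 A) Ey; rewrite /tr2 /=; ring: ad.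
- by have /= <- := congr1 (@m10 A) Ey; rewrite /tr2 /=; ring: ad.
- by have /= <- := congr1 (@m11 A) Ey; rewrite /tr2 /=; ring: ad.
Qed.
End Mat2Field.

Section Lift.
Local Arguments conjc : simpl never.
Context {R : realType}.
Notation C := R[i].
Implicit Types (v u : 'rV[R]_4) (g h : mat2 C) (M N : 'M[R]_4).

Definition star2 g := Mat2 (conjc (m00 g)) (conjc (m10 g)) (conjc (m01 g)) (conjc (m11 g)).

(** The identification of Minkowski space with Hermitian 2 by 2 matrices, under which the Lorentz
    form is minus the determinant. *)
Definition herm v : mat2 C :=
  let a := (v 0 0)%:C%C in let b := (v 0 1)%:C%C in
  let c := (v 0 2)%:C%C in let d := (v 0 3)%:C%C in
  Mat2 (a + d) (b + 'i%C * c) (b - 'i%C * c) (a - d).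

Lemma conjcD (x y : C) : conjc (x + y) = conjc x + conjc y. Proof. exact: rmorphD. Qed.
Lemma conjcM (x y : C) : conjc (x * y) = conjc x * conjc y. Proof. exact: rmorphM. Qed.
Lemma conjcN (x : C) : conjc (- x) = - conjc x. Proof. exact: rmorphN. Qed.

Lemma star2M g h : star2 (mul2 g h) = mul2 (star2 h) (star2 g).
Proof. by apply: mat2P; rewrite /= !(conjcD, conjcM); ring. Qed.

Lemma star2_herm v : star2 (herm v) = herm v.
Proof.
have ci : conjc 'i%C = - 'i%C :> C by apply/eqP; rewrite eq_complex /= oppr0 !eqxx.
have cr (x : R) : conjc x%:C%C = x%:C%C by apply/eqP; rewrite eq_complex /= oppr0 !eqxx.
by apply: mat2P; rewrite /= !(conjcD, conjcM, conjcN, ci, cr); ring.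
Qed.

Lemma star2_adj g : star2 (adj2 g) = adj2 (star2 g).
Proof. by apply: mat2P; rewrite /= ?conjcN. Qed.

Lemma lorentz4 u v : lorentz u v =
  - (u 0 0 * v 0 0) + u 0 1 * v 0 1 + u 0 2 * v 0 2 + u 0 3 * v 0 3.
Proof.
rewrite /lorentz !big_ord_recl big_ord0 addr0 !addrA.
have -> : lift ord0 (ord0 : 'I_3) = 1 :> 'I_4 by exact/val_inj.
have -> : lift ord0 (lift ord0 (ord0 : 'I_2)) = 2 :> 'I_4 by exact/val_inj.
have -> : lift ord0 (lift ord0 (lift ord0 (ord0 : 'I_1))) = 3 :> 'I_4 by exact/val_inj.
by [].
Qed.

Lemma sqri : 'i%C * 'i%C = -1 :> C. Proof. by rewrite -expr2 sqr_i. Qed.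

Lemma det2_herm v : det2 (herm v) = (- lorentz v v)%:C%C.
Proof.
rewrite lorentz4 /det2 /= !(rmorphN, rmorphD, rmorphM) /=; ring: sqri.
Qed.

(** Write U, V for the matrices of [u], [v]. Polarizing the determinant gives U adj(V) + V adj(U) =
    -2 <u,v>; multiplied by U on the right, with adj(U) U = det U = -1, this is the formula for the
    reflection. *)
Lemma herm_reflection u v : lorentz u u = 1 ->
  herm (v *m reflection_mx u) = mul2 (mul2 (herm u) (adj2 (herm v))) (herm u).
Proof.
move=> u1; rewrite mul_reflection_mx.
have E : mul2 (mul2 (herm u) (adj2 (herm v))) (herm u) =
    Mat2 ((lorentz u u)%:C%C * m00 (herm v) - 2 * (lorentz v u)%:C%C * m00 (herm u))
         ((lorentz u u)%:C%C * m01 (herm v) - 2 * (lorentz v u)%:C%C * m01 (herm u))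
         ((lorentz u u)%:C%C * m10 (herm v) - 2 * (lorentz v u)%:C%C * m10 (herm u))
         ((lorentz u u)%:C%C * m11 (herm v) - 2 * (lorentz v u)%:C%C * m11 (herm u)).
  by apply: mat2P; rewrite /= !lorentz4 !(rmorphN, rmorphD, rmorphM) /=; ring: sqri.
rewrite E u1 !mul1r; apply: mat2P;
  rewrite /= !mxE !(rmorphN, rmorphD, rmorphM, rmorph_nat) /=; ring.
Qed.

(** [M] acts on rows from the right and [g] on Hermitian matrices from the left, so lifting reverses
    products. *)
Definition is_lift M g := det2 g = 1 /\
  forall v, herm (v *m M) = mul2 (mul2 g (herm v)) (star2 g).

Lemma lift_reflections u w : lorentz u u = 1 -> lorentz w w = 1 ->
  is_lift (reflection_mx u *m reflection_mx w) (mul2 (herm w) (adj2 (herm u))).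
Proof.
move=> u1 w1; split=> [|v].
  by rewrite det2M det2_adj !det2_herm u1 w1 rmorphN /= mulrNN mulr1.
rewrite mulmxA !herm_reflection // !adj2M adj2K star2M star2_adj !star2_herm.
by rewrite !mul2A.
Qed.

Lemma lift_mul M N g h : is_lift M g -> is_lift N h -> is_lift (M *m N) (mul2 h g).
Proof.
move=> [g1 gM] [h1 hN]; split; first by rewrite det2M g1 h1 mulr1.
by move=> v; rewrite mulmxA hN gM star2M !mul2A.
Qed.

Lemma star2_1 : star2 (scalar2 1) = scalar2 1 :> mat2 C.
Proof. by apply: mat2P; rewrite /= ?(rmorph1 conjc) ?(rmorph0 conjc). Qed.

Lemma lift_1 : is_lift 1%:M (scalar2 1).
Proof.
split=> [|v]; first by rewrite /det2 /=; ring.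
by rewrite mulmx1 star2_1 mul2_1l mul2_1r.
Qed.

Lemma det2_star g : det2 g = 1 -> det2 (star2 g) = 1.
Proof.
by rewrite /det2 /= -(mulrC (conjc (m01 g))) -!conjcM -conjcN -conjcD => ->; exact: rmorph1.
Qed.

Lemma lift_inv M N g : is_lift M g -> N *m M = 1%:M -> is_lift N (adj2 g).
Proof.
move=> [g1 gM] NM; split; first by rewrite det2_adj.
move=> v; have := gM (v *m N); rewrite -mulmxA NM mulmx1 => ->.
rewrite star2_adj !mul2A adj2_mull // mul2_1l -mul2A adj2_mulr ?mul2_1r //.
exact: det2_star.
Qed.

Lemma lift_opp M g : is_lift M g -> is_lift M (opp2 g).
Proof.
move=> [g1 gM]; split; first by rewrite det2_opp.
by move=> v; rewrite gM; apply: mat2P; rewrite /= ?conjcN; ring.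
Qed.

Lemma lift_rword k (u : 'I_k.+1 -> 'rV[R]_4) w : (forall i, lorentz (u i) (u i) = 1) ->
  ~~ odd (size w) -> exists g, is_lift (rword u w) g.
Proof.
move=> u1; have [m] := ubnP (size w); elim: m w => // m IH [|i [|j w]] //.
  by exists (scalar2 1); rewrite rword_nil; exact: lift_1.
rewrite /= negbK ltnS => wm ow; have [g gw] := IH w (ltnW wm) ow.
exists (mul2 g (mul2 (herm (u j)) (adj2 (herm (u i))))).
by rewrite !rword_cons mulmxA; apply: lift_mul => //; exact: lift_reflections.
Qed.

Lemma herm_inj : injective herm.
Proof.
move=> u v E.
have e00 := congr1 (@m00 _) E; have e01 := congr1 (@m01 _) E.
have e10 := congr1 (@m10 _) E; have e11 := congr1 (@m11 _) E.
have /eqP := e00; rewrite eq_complex /= => /andP [/eqP a1 _].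
have /eqP := e01; rewrite eq_complex /= => /andP [/eqP b1 /eqP b2].
have /eqP := e11; rewrite eq_complex /= => /andP [/eqP d1 _].
have [E0 E1 E2 E3] : [/\ u 0 0 = v 0 0, u 0 1 = v 0 1, u 0 2 = v 0 2 & u 0 3 = v 0 3].
  by split; lra.
apply/rowP => i; case: i => [[|[|[|[|i]]]] iP] //.
- by rewrite (_ : Ordinal iP = 0) //; exact: val_inj.
- by rewrite (_ : Ordinal iP = 1) //; exact: val_inj.
- by rewrite (_ : Ordinal iP = 2) //; exact: val_inj.
- by rewrite (_ : Ordinal iP = 3) //; exact: val_inj.
Qed.

Definition rv (a b c d : R) : 'rV[R]_4 := \row_i [:: a; b; c; d]`_i.

Lemma herm_rv a b c d : herm (rv a b c d) =
  Mat2 (a%:C + d%:C)%C (b%:C + 'i * c%:C)%C (b%:C - 'i * c%:C)%C (a%:C - d%:C)%C.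
Proof. by rewrite /herm !mxE. Qed.

(** If [M] is the identity, the image of (1,0,0,0) shows that [g] is unitary, so [g] commutes with
    all Hermitian matrices; two Pauli matrices already force it to be scalar. *)
Lemma lift_pm1 M g : is_lift M g -> (M = 1%:M <-> pm1 g).
Proof.
move=> [g1 gM]; split=> [M1|gpm]; last first.
  apply: eq_mulmx_row => v; rewrite mulmx1; apply: herm_inj; rewrite gM.
  have c1 : conjc 1 = 1 :> C by exact: rmorph1.
  have c0 : conjc 0 = 0 :> C by exact: rmorph0.
  by case: gpm => ->; apply: mat2P; rewrite /= ?conjcN ?c1 ?c0; ring.
have H v : mul2 g (herm v) = mul2 (herm v) g.
  have s1 : mul2 g (star2 g) = scalar2 1.
    have := gM (rv 1 0 0 0); rewrite M1 mulmx1 herm_rv.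
    have -> : Mat2 (1%:C + 0%:C)%C (0%:C + 'i * 0%:C)%C (0%:C - 'i * 0%:C)%C (1%:C - 0%:C)%C
      = scalar2 (1 : C) by apply: mat2P => /=; ring.
    by rewrite mul2_1r.
  have s2 : mul2 (star2 g) g = scalar2 1.
    have E : star2 g = adj2 g.
      by rewrite -[star2 g]mul2_1l -(adj2_mull g1) -mul2A s1 mul2_1r.
    by rewrite E adj2_mull.
  by have := gM v; rewrite M1 mulmx1 => {2}->; rewrite -mul2A s2 mul2_1r.
have Z : herm (rv 0 0 0 1) = Mat2 1 0 0 (-1) by rewrite herm_rv; apply: mat2P => /=; ring.
have X : herm (rv 0 1 0 0) = Mat2 0 1 1 0 by rewrite herm_rv; apply: mat2P => /=; ring.
have H1 := H (rv 0 0 0 1); have H2 := H (rv 0 1 0 0); rewrite {}Z {}X in H1 H2.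
have e01 := congr1 (@m01 _) H1; have e10 := congr1 (@m10 _) H1.
have f01 := congr1 (@m01 _) H2; rewrite /= in e01 e10 f01.
have two : (2 : C) != 0 by rewrite pnatr_eq0.
have b0 : m01 g = 0.
  apply: (mulfI two); rewrite mulr0 -(subrr (1 * m01 g + 0 * m11 g)) -{2}e01; ring.
have c0 : m10 g = 0.
  apply: (mulfI two); rewrite mulr0 -(subrr (m10 g * 1 + m11 g * 0)) {2}e10; ring.
have ad : m11 g = m00 g.
  by transitivity (0 * m01 g + 1 * m11 g); [ring|rewrite -f01; ring].
by apply: (scalar_pm1 (x := 1) (y := m00 g)) => //; rewrite ?oner_eq0 ?mul1r.
Qed.

Lemma coord_herm v : [/\ (v 0 0)%:C%C = (m00 (herm v) + m11 (herm v)) / 2,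
  (v 0 1)%:C%C = (m01 (herm v) + m10 (herm v)) / 2,
  (v 0 2)%:C%C = (m10 (herm v) - m01 (herm v)) * 'i%C / 2 &
  (v 0 3)%:C%C = (m00 (herm v) - m11 (herm v)) / 2].
Proof.
have two : (2 : C) != 0 by rewrite pnatr_eq0.
by split; apply: (mulIf two); rewrite divfK //=; ring: sqri.
Qed.

(** Complexified, [M] is the tensor product of [g] and its conjugate. *)
Lemma lift_trace M g : is_lift M g -> (\tr M)%:C%C = tr2 g * conjc (tr2 g).
Proof.
move=> [_ gM]; have two : (2 : C) != 0 by rewrite pnatr_eq0.
have ent i : (M i i)%:C%C = (((vec i : 'rV[R]_4) *m M) 0 i)%:C%C :> C by rewrite -rowE mxE.
have [E0 _ _ _] := coord_herm ((vec 0 : 'rV[R]_4) *m M).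
have [_ E1 _ _] := coord_herm ((vec 1 : 'rV[R]_4) *m M).
have [_ _ E2 _] := coord_herm ((vec 2 : 'rV[R]_4) *m M).
have [_ _ _ E3] := coord_herm ((vec 3 : 'rV[R]_4) *m M).
rewrite -!ent !gM in E0 E1 E2 E3.
have -> : (\tr M)%:C%C = (M 0 0)%:C%C + (M 1 1)%:C%C + (M 2 2)%:C%C + (M 3 3)%:C%C :> C.
  rewrite -!rmorphD /mxtrace !big_ord_recl big_ord0 addr0 !addrA /=.
  have -> : lift ord0 (ord0 : 'I_3) = 1 :> 'I_4 by exact/val_inj.
  have -> : lift ord0 (lift ord0 (ord0 : 'I_2)) = 2 :> 'I_4 by exact/val_inj.
  have -> : lift ord0 (lift ord0 (lift ord0 (ord0 : 'I_1))) = 3 :> 'I_4 by exact/val_inj.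
  by [].
rewrite E0 E1 E2 E3 /herm /vec /= !mxE /= /tr2 conjcD.
apply: (mulIf two); rewrite !mulrDl !divfK //; ring: sqri.
Qed.
End Lift.

(** * Traces of lifts and the commutator *)

Section Dichotomy.
Context {R : realType}.
Notation C := R[i].
Variable phi : R.
Hypothesis phi2 : phi * phi = phi + 1.
Implicit Types (g h : mat2 C) (M N : 'M[R]_4).

Lemma golden_root (t : C) : t ^+ 2 = t + 1 ->
  exists2 s : R, t = s%:C%C & s = phi \/ s = 1 - phi.
Proof.
have phi2C : phi%:C%C * phi%:C%C = phi%:C%C + 1 :> C by rewrite -rmorphM phi2 rmorphD rmorph1.
move=> t2; have /eqP : (t - phi%:C%C) * (t - (1 - phi)%:C%C) = 0.
  rewrite rmorphB rmorph1; ring: t2 phi2C.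
rewrite mulf_eq0 !subr_eq0 => /orP [] /eqP ->; [exists phi|exists (1 - phi)] => //; by [left|right].
Qed.

(** Both [g] and its negative lift [M]; the sign is chosen to make the trace a root of t^2 = t +
    1. *)
Lemma lift_order5 M g : is_lift M g -> M != 1%:M -> M *m M *m M *m M *m M = 1%:M ->
  exists2 h, is_lift M h & tr2 h ^+ 2 = tr2 h + 1.
Proof.
move=> Mg M1 M5; have g1 := Mg.1.
have gn : ~ pm1 g by move/(lift_pm1 Mg).2 => E; rewrite E eqxx in M1.
have Mg2 := lift_mul Mg Mg; have Mg3 := lift_mul Mg2 Mg.
have Mg4 := lift_mul Mg3 Mg; have Mg5 := lift_mul Mg4 Mg.
have := (lift_pm1 Mg5).1 M5; rewrite !mul2A => /(tr2_order5 g1 gn) [E|E].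
  by exists g.
exists (opp2 g); first exact: lift_opp.
by rewrite /tr2 /= -opprD sqrrN -/(tr2 g) E.
Qed.

Lemma lift_order3 M g : is_lift M g -> M != 1%:M -> M *m M *m M = 1%:M ->
  exists2 h, is_lift M h & tr2 h = 1.
Proof.
move=> Mg M1 M3; have g1 := Mg.1.
have gn : ~ pm1 g by move/(lift_pm1 Mg).2 => E; rewrite E eqxx in M1.
have := (lift_pm1 (lift_mul (lift_mul Mg Mg) Mg)).1 M3; rewrite mul2A.
move=> /(tr2_order3 g1 gn) /eqP; rewrite sqrf_eq1 => /orP [/eqP E|/eqP E].
  by exists g.
exists (opp2 g); first exact: lift_opp.
by rewrite /tr2 /= -opprD -/(tr2 g) E opprK.
Qed.

Lemma lift_order2 M g : is_lift M g -> M != 1%:M -> M *m M = 1%:M -> tr2 g = 0.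
Proof.
move=> Mg M1 M2; apply: tr2_order2 (Mg.1) _ ((lift_pm1 (lift_mul Mg Mg)).1 M2).
by move/(lift_pm1 Mg).2 => E; rewrite E eqxx in M1.
Qed.

Lemma lift_tr1_cube (K : 'M[R]_4) (k : mat2 C) : is_lift K k -> tr2 k = 1 -> K *m K *m K = 1%:M.
Proof.
move=> Kk k1; apply/(lift_pm1 (lift_mul (lift_mul Kk Kk) Kk)).
by right; rewrite mul2A; apply: cube2 => //; exact: Kk.1.
Qed.

Section Pair.
Variables (M M' N N' : 'M[R]_4) (g h : mat2 C).
Hypotheses (M'M : M' *m M = 1%:M) (N'N : N' *m N = 1%:M).
Hypotheses (Mg : is_lift M g) (Nh : is_lift N h).
Hypotheses (M1 : M != 1%:M) (N1 : N != 1%:M) (MN1 : M *m N != 1%:M).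
Hypothesis MN5 : (M *m N) *m (M *m N) *m (M *m N) *m (M *m N) *m (M *m N) = 1%:M.

Let K := M *m N *m M' *m N'.

Lemma lift_commutator (a b : mat2 C) : is_lift M a -> is_lift N b ->
  is_lift K (mul2 (mul2 (adj2 b) (adj2 a)) (mul2 b a)).
Proof.
move=> Ma Nb; rewrite -mul2A; apply: lift_mul; last exact: lift_inv Nb N'N.
by apply: lift_mul; [exact: lift_mul | exact: lift_inv Ma M'M].
Qed.

Lemma dichotomy_255 : M *m M = 1%:M -> N *m N *m N *m N *m N = 1%:M ->
  K *m K *m K = 1%:M \/ \tr N = \tr (M *m N).
Proof.
move=> M2 N5; have a0 := lift_order2 Mg M1 M2.
have [b Nb tb] := lift_order5 Nh N1 N5.
(* The trace of a lift of [M] is 0 for either sign, so its sign is free to normalize the trace of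
   the product. *)
have [a [Ma {}a0 tc]] : exists a, [/\ is_lift M a, tr2 a = 0 &
    tr2 (mul2 b a) ^+ 2 = tr2 (mul2 b a) + 1].
  have MNl := lift_mul Mg Nb; have [c cl tc] := lift_order5 MNl MN1 MN5.
  have gn : ~ pm1 (mul2 b g) by move/(lift_pm1 MNl).2 => E; move: MN1; rewrite E eqxx.
  have Mg2 := lift_mul MNl MNl; have Mg3 := lift_mul Mg2 MNl.
  have Mg4 := lift_mul Mg3 MNl; have Mg5 := lift_mul Mg4 MNl.
  have := (lift_pm1 Mg5).1 MN5; rewrite !mul2A -!(mul2A _ b g).
  case/(tr2_order5 MNl.1 gn) => E; first by exists g.
  exists (opp2 g); split; first exact: lift_opp.
    by rewrite /tr2 /= -opprD -/(tr2 g) a0 oppr0.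
  have -> : mul2 b (opp2 g) = opp2 (mul2 b g) by apply: mat2P => /=; ring.
  by rewrite /tr2 /= -opprD sqrrN -/(tr2 (mul2 b g)) E.
have [s sE _] := golden_root tb; have [s' sE' _] := golden_root tc.
have [ss|ss] := eqVneq (tr2 b) (tr2 (mul2 b a)).
  right; apply: (@complexI R).
  by rewrite (lift_trace Nb) (lift_trace (lift_mul Ma Nb)) ss.
left; apply: lift_tr1_cube (lift_commutator Ma Nb) _.
(* Distinct roots of t^2 = t + 1 have sum 1, and with [tr2 a] = 0 Fricke's identity makes this sum
   the trace of the commutator. *)
have sum1 : tr2 b + tr2 (mul2 b a) = 1.
  have /eqP : (tr2 b - tr2 (mul2 b a)) * (tr2 b + tr2 (mul2 b a) - 1) = 0 by ring: tb tc.
  by rewrite mulf_eq0 subr_eq0 (negbTE ss) /= subr_eq0 => /eqP.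
rewrite tr2_commutator; [|exact: Ma.1|exact: Nb.1].
rewrite a0 tb tc mul0r mul0r subr0 expr0n add0r.
have -> : tr2 b + 1 + (tr2 (mul2 b a) + 1) - 2 = tr2 b + tr2 (mul2 b a) by ring.
exact: sum1.
Qed.

Lemma dichotomy_335 : M *m M *m M = 1%:M -> N *m N *m N = 1%:M ->
  K *m K *m K = 1%:M \/ exists2 s, s = phi \/ s = 1 - phi & \tr (M *m N') = 3 * s + 2.
Proof.
move=> M3 N3; have [a Ma ta] := lift_order3 Mg M1 M3.
have [b Nb tb] := lift_order3 Nh N1 N3.
have MNl := lift_mul Ma Nb.
have gn : ~ pm1 (mul2 b a) by move/(lift_pm1 MNl).2 => E; move: MN1; rewrite E eqxx.
have Mg2 := lift_mul MNl MNl; have Mg3 := lift_mul Mg2 MNl.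
have Mg4 := lift_mul Mg3 MNl; have Mg5 := lift_mul Mg4 MNl.
have := (lift_pm1 Mg5).1 MN5; rewrite !mul2A -!(mul2A _ b a).
case/(tr2_order5 MNl.1 gn) => E.
  (* With traces 1, 1 and t, where t^2 = t + 1, the commutator has trace 1 + 1 + t^2 - t - 2 = 1. *)
  left; apply: lift_tr1_cube (lift_commutator Ma Nb) _.
  rewrite tr2_commutator; [|exact: Ma.1|exact: Nb.1].
  by rewrite ta tb E; ring.
(* Now s = -t is the golden root, and the lift of [M *m N'] has trace 1 - t = 1 + s, with square 3 s
   + 2. *)
right; have [|s sE sP] := @golden_root (- tr2 (mul2 b a)); first by rewrite sqrrN.
exists s => //; apply: (@complexI R).
have NM' : is_lift (M *m N') (mul2 (adj2 b) a) by apply: lift_mul => //; exact: lift_inv Nb N'N.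
rewrite (lift_trace NM') tr2_mul_adj ta tb mul1r sE conjcD.
have -> : conjc (s%:C%C : C) = s%:C%C by apply/eqP; rewrite eq_complex /= oppr0 !eqxx.
have -> : conjc 1 = 1 :> C by exact: rmorph1.
have s2 : s%:C%C * s%:C%C = s%:C%C + 1 :> C.
  by rewrite -sE mulrNN -expr2 E.
rewrite rmorphD rmorphM !rmorph_nat; ring: s2.
Qed.
End Pair.
End Dichotomy.

(** * Rotations and their orders *)

Section Trigonometry.
Context {R : realType}.
Implicit Types (x t : R) (m l : nat).

Lemma pi_div_bounds m : (1 < m)%N -> 0 < (pi / m%:R : R) < pi.
Proof.
move=> m1; have m0 : 0 < (m%:R : R) by rewrite ltr0n (ltn_trans _ m1).
by rewrite divr_gt0 ?pi_gt0 //= ltr_pdivrMr // ltr_pMr ?pi_gt0 // ltr1n.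
Qed.

Definition golden : R := 2 * cos (pi / 5%:R).

Lemma golden_gt0 : 0 < golden.
Proof.
rewrite /golden mulr_gt0 // cos_gt0_pihalf //.
have := pi_gt0 R; lra.
Qed.

Lemma golden_sqr : golden * golden = golden + 1.
Proof.
have := golden_gt0; rewrite /golden; set t := pi / 5%:R; set c := cos t => c0.
(* For t = pi/5, 3 t = pi - 2 t. The resulting cubic in c = cos t has the spurious root -1, excluded
   by c > 0. *)
have E : cos (t *+ 2 + t) = - cos (t *+ 2).
  have -> : t *+ 2 + t = - (t *+ 2) + pi by rewrite /t; field.
  by rewrite cosDpi cosN.
have s2 : sin t * sin t = 1 - c * c by rewrite -!expr2 sin2cos2.
move: E; rewrite cosD cos_mulr2n sin_mulr2n -/c => E.
have : (c + 1) * (4 * c * c - 2 * c - 1) = 0.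
  have -> : (c + 1) * (4 * c * c - 2 * c - 1) =
    ((c ^+ 2 *+ 2 - 1) * c - 2 * c * (1 - c * c)) + (c ^+ 2 *+ 2 - 1) by ring.
  rewrite -s2; move: E => /eqP; rewrite -subr_eq0 opprK => /eqP <-; ring.
by move/eqP; rewrite mulf_eq0 => /orP [] /eqP H; [|]; lra.
Qed.

Lemma cos_pi3 : cos (pi / 3%:R) = 1 / 2 :> R.
Proof.
set t := pi / 3%:R; set c := cos t.
have c0 : 0 < c by apply: cos_gt0_pihalf; have := pi_gt0 R; rewrite /t; lra.
have E : cos (t *+ 2) = - cos t.
  have -> : t *+ 2 = - t + pi by rewrite /t; field.
  by rewrite cosDpi cosN.
move: E; rewrite cos_mulr2n -/c => E.
have /eqP : (c + 1) * (2 * c - 1) = 0.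
  have -> : (c + 1) * (2 * c - 1) = (c ^+ 2 *+ 2 - 1) + c by ring.
  by rewrite E addNr.
by rewrite mulf_eq0 => /orP [] /eqP H; lra.
Qed.

Lemma golden_cos : cos (pi / 5%:R) = golden / 2.
Proof. by rewrite /golden [2 * _]mulrC mulfK ?pnatr_eq0. Qed.
End Trigonometry.

Section Rotation.
Context {R : realType} {n : nat}.
Variables (u w : 'rV[R]_n.+1) (m : nat).
Hypotheses (m1 : (1 < m)%N) (uu : lorentz u u = 1) (ww : lorentz w w = 1).
Let t : R := pi / m%:R.
Hypothesis uw : lorentz u w = - cos t.
Let A : 'M[R]_n.+1 := reflection_mx u * reflection_mx w.
Let c := cos t.

Lemma sin_rot_gt0 : 0 < sin t.
Proof. exact: sin_gt0_pi (pi_div_bounds m1). Qed.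

Lemma rotate_u : u *m A = - u - (2 * c) *: w.
Proof.
rewrite mulmxA !mul_reflection_mx !(lorentzDl, lorentzNl, lorentzZl) uu uw -/c.
by apply/rowP => k; rewrite !mxE; ring.
Qed.

Lemma rotate_w : w *m A = (2 * c) *: u + (4 * c ^+ 2 - 1) *: w.
Proof.
rewrite mulmxA !mul_reflection_mx !(lorentzDl, lorentzNl, lorentzZl) (lorentzC w u) ww uw -/c.
by apply/rowP => k; rewrite !mxE; ring.
Qed.

Lemma sin_step x : sin (x + t + t) = 2 * c * sin (x + t) - sin x.
Proof.
have s2 : sin t * sin t = 1 - c * c by rewrite -!expr2 sin2cos2.
rewrite !sinD cosD -/c; ring: s2.
Qed.

(** On the plane of [u] and [w], [A] is the rotation through 2 t. The coefficients are the Chebyshev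
    quotients sin (k t) / sin t, with the denominator cleared. *)
Lemma rotate_iter_w l : sin t *: (w *m A ^+ l) =
  sin (t *+ l.*2) *: u + sin (t *+ l.*2.+1) *: w.
Proof.
elim: l => [|l IH]; first by rewrite expr0 mulmx1 mulr0n sin0 scale0r add0r.
rewrite exprSr mulmxA scalemxAl IH mulmxDl -!scalemxAl rotate_u rotate_w.
set x := t *+ l.*2.
have -> : t *+ l.+1.*2 = x + t + t by rewrite doubleS !mulrSr.
have -> : t *+ l.+1.*2.+1 = x + t + t + t by rewrite doubleS !mulrSr.
have -> : t *+ l.*2.+1 = x + t by rewrite mulrSr.
rewrite !sin_step.
by apply/rowP => k; rewrite !mxE; ring.
Qed.

Lemma rotate_iter_u l : sin t *: (u *m A ^+ l) =
  - sin (t *+ l.*2 - t) *: u - sin (t *+ l.*2) *: w.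
Proof.
elim: l => [|l IH].
  by rewrite expr0 mulmx1 mulr0n sin0 scale0r subr0 sub0r sinN opprK.
rewrite exprSr mulmxA scalemxAl IH mulmxBl -!scalemxAl rotate_u rotate_w.
have e1 : t *+ l.+1.*2 = (t *+ l.*2 - t) + t + t + t by rewrite doubleS !mulrSr; ring.
have e0 : t *+ l.*2 = (t *+ l.*2 - t) + t by ring.
set x := t *+ l.*2 - t in e0 e1 *.
rewrite e1 addrK !sin_step e0.
by apply/rowP => k; rewrite !mxE; ring.
Qed.

(** The Gram determinant of [u] and [w] is sin^2 t, so [A ^+ l = 1] lets the coefficients be
    compared: sin (2 l t) = 0 and cos (2 l t) = 1. Hence sin (l t) = 0, although 0 < l t < pi. *)
Lemma rotation_pow_neq1 l : (0 < l < m)%N -> A ^+ l != 1.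
Proof.
move=> /andP [l0 lm]; apply/eqP => H.
have st := sin_rot_gt0; have := rotate_iter_w l; rewrite H mulmx1 => E.
have s2 : sin t * sin t = 1 - c * c by rewrite -!expr2 sin2cos2.
have E1 := congr1 (fun v => lorentz v u) E; have E2 := congr1 (fun v => lorentz v w) E.
rewrite /= !(lorentzDl, lorentzZl) uu ww (lorentzC w) uw -/c in E1 E2.
have z : sin (t *+ l.*2) = 0.
  apply: (mulIf (lt0r_neq0 (mulr_gt0 st st))); rewrite mul0r s2.
  have -> : sin (t *+ l.*2) * (1 - c * c) =
    (sin (t *+ l.*2) * 1 + sin (t *+ l.*2.+1) * - c) +
    c * (sin (t *+ l.*2) * - c + sin (t *+ l.*2.+1) * 1) by ring.
  by rewrite -E1 -E2; ring.
have c1 : cos (t *+ l.*2) = 1.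
  apply: (mulIf (lt0r_neq0 st)); rewrite mul1r; move: E2.
  rewrite mulrSr sinD z !mul0r !mulr1 !add0r => <-.
  by ring.
move: c1; rewrite -muln2 mulrnA cos_mulr2n cos2sin2 => c1.
have : 0 < sin (t *+ l).
  apply: sin_gt0_pi; have /andP [t0 _] := pi_div_bounds m1 (R := R).
  rewrite mulrn_wgt0 //= -mulr_natr /t mulrAC ltr_pdivrMr ?ltr0n ?(ltn_trans _ m1) //.
  by rewrite ltr_pM2l ?pi_gt0 // ltr_nat l0 lm.
move=> s0; have := exprn_gt0 2 s0; move: c1; move: (sin _ ^+ 2) => y; clear E H; lra.
Qed.

Lemma rotation_pow : A ^+ m = 1.
Proof.
have st := sin_rot_gt0; have st0 := lt0r_neq0 st.
have s2 : sin t * sin t = 1 - c * c by rewrite -!expr2 sin2cos2.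
have tm : t *+ m.*2 = pi *+ 2.
  rewrite -muln2 mulrnA; congr (_ *+ 2); rewrite -mulr_natr /t divfK //.
  by rewrite pnatr_eq0 -lt0n (ltn_trans _ m1).
have wm : w *m A ^+ m = w.
  apply: (scalerI st0); rewrite rotate_iter_w mulrSr tm sin2pi scale0r add0r.
  by rewrite addrC sinD2pi.
have um : u *m A ^+ m = u.
  apply: (scalerI st0); rewrite rotate_iter_u tm sin2pi scale0r subr0.
  by rewrite addrC sinD2pi sinN opprK.
(* Every [v] is moved by a combination of [u] and [w]. Since [A ^+ m] is an isometry fixing both,
   this combination is orthogonal to them and hence zero. *)
have span l v : exists a b, v *m A ^+ l = v + a *: u + b *: w.
  elim: l => [|l [a [b IH]]].
    by exists 0, 0; rewrite expr0 mulmx1 !scale0r !addr0.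
  rewrite exprSr mulmxA IH mulmxA !mul_reflection_mx.
  move: (lorentz _ w) => y; move: (lorentz _ u) => x.
  exists (a - 2 * x), (b - 2 * y); apply/rowP => k; rewrite !mxE; ring.
have pres v v' : lorentz (v *m A ^+ m) (v' *m A ^+ m) = lorentz v v'.
  elim: m v v' => [|l IH] v v'; first by rewrite !mulmx1.
  by rewrite exprSr !mulmxA !lorentz_reflection // IH.
apply: eq_mulmx_row => v; have [a [b E]] := span m v.
have Eu := pres v u; have Ew := pres v w.
rewrite um wm E !(lorentzDl, lorentzZl) uu ww (lorentzC w) uw -/c in Eu Ew.
have a0 : a = 0.
  apply: (mulIf (mulf_neq0 st0 st0)); rewrite mul0r s2.
  have -> : a * (1 - c * c) = (a * 1 + b * - c) + c * (a * - c + b * 1) by ring.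
  have -> : a * 1 + b * - c = 0 by lra.
  have -> : a * - c + b * 1 = 0 by lra.
  by rewrite mulr0 addr0.
have b0 : b = 0 by move: Ew; rewrite a0; lra.
by rewrite E a0 b0 !scale0r !addr0 mulmx1.
Qed.
End Rotation.

Section Coordinates.
Context {R : realType} {n : nat}.
Variable T : hsimplex R n.+1.
Notation u := (facet_normal T).

Lemma rword_cox w : rword u w = invmx (rows_mx u) *m cox_word (gram2 u) w *m rows_mx u.
Proof. by rewrite -mulmxA -rows_mx_word mulKmx // facet_normal_basis. Qed.

Lemma cox_rword w : cox_word (gram2 u) w = rows_mx u *m rword u w *m invmx (rows_mx u).
Proof. by rewrite rows_mx_word mulmxK // facet_normal_basis. Qed.

Lemma rword_eq w w' : rword u w = rword u w' <-> cox_word (gram2 u) w = cox_word (gram2 u) w'.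
Proof. by split=> E; [rewrite !cox_rword E | rewrite !rword_cox E]. Qed.

Lemma rword_eq1 w : rword u w = 1%:M <-> cox_word (gram2 u) w = 1%:M.
Proof. by rewrite -{1}(rword_nil u) -(cox_word_nil (gram2 u)) rword_eq. Qed.

Lemma tr_rword w : \tr (rword u w) = \tr (cox_word (gram2 u) w).
Proof. by rewrite rword_cox mxtrace_mulC mulmxA mulmxV ?facet_normal_basis // mul1mx. Qed.

Lemma rword_exp w k : rword u w ^+ k = rword u (flatten (nseq k w)).
Proof.
elim: k => [|k IH] /=; first by rewrite rword_nil.
by rewrite exprS IH rword_cat.
Qed.

Lemma gram2_facet i j m : (0 < m)%N -> dihedral_angle T i j = pi / m%:R ->
  gram2 u i j = - (2 * cos (pi / m%:R)) /\ gram2 u j i = - (2 * cos (pi / m%:R)).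
Proof.
by move=> m0 /(dihedral_angle_lorentz m0) E; rewrite !mxE (lorentzC (u j)) E mulrN.
Qed.

Lemma gram2_diag i : gram2 u i i = 2.
Proof. by rewrite mxE facet_normal_unit mulr1. Qed.
End Coordinates.

Section Values.
Context {R : realType}.
Let phi : R := golden.

Lemma cos_values : [/\ - (2 * cos (pi / 2%:R)) = zval phi z0,
  - (2 * cos (pi / 3%:R)) = zval phi (Zneg 1, Z0) & - (2 * cos (pi / 5%:R)) = zval phi (Z0, Zneg 1)].
Proof.
split.
- by rewrite cos_pihalf mulr0 oppr0 zval0.
- by rewrite cos_pi3 /zval /= mul0r addr0 mul1r divff ?pnatr_eq0.
- by rewrite /zval /= add0r mulN1r.
Qed.

Lemma zval2 : zval phi (Zpos 2, Z0) = 2.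
Proof. by rewrite /zval /= mul0r addr0. Qed.

Lemma ord4_cases (i : 'I_4) : [\/ i = 0, i = 1, i = 2 | i = 3].
Proof.
case: i => [[|[|[|[|i]]]] iP] //; [constructor 1|constructor 2|constructor 3|constructor 4];
 exact: val_inj.
Qed.

Lemma gram2_T9 (T9 : hsimplex R 3) : is_tetrahedron T9 2 3 5 2 3 5 ->
  gram2 (facet_normal T9) = zmx phi 3 G9.
Proof.
have [v2 v3 v5] := cos_values; have v22 := zval2.
move=> [[/gram2_facet CD /gram2_facet AD /gram2_facet BD]].
move=> [/gram2_facet AB /gram2_facet BC /gram2_facet AC].
have [//|CD1 CD2] := CD; have [//|AD1 AD2] := AD; have [//|BD1 BD2] := BD.
have [//|AB1 AB2] := AB; have [//|BC1 BC2] := BC; have [//|AC1 AC2] := AC.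
apply/matrixP => i j; rewrite [RHS]mxE.
case: (ord4_cases i) => ->; case: (ord4_cases j) => ->;
 rewrite ?gram2_diag ?CD1 ?CD2 ?AD1 ?AD2 ?BD1 ?BD2 ?AB1 ?AB2 ?BC1 ?BC2 ?AC1 ?AC2 ?v2 ?v3 ?v5 ?v22 //.
Qed.
End Values.

Section Class5.
Variable L : seq (seq nat).
Hypothesis L_nil : pkey [::] \in L.
Hypothesis L_bound : all (all (fun x => x < 5)%N) L.
Hypothesis L_closed : all (fun p => all (fun g => comp p (pkey g) \in L) pairs4) L.
Hypothesis L_255 : all (fun x => is_perm5_order x 2 ==> all (fun y =>
  is_perm5_order y 5 ==> is_perm5_order (comp x y) 5 ==>
  ((y \in class5) != (comp x y \in class5))) L) L.

Lemma mem_pkey_vals w : ~~ odd (size w) -> pkey (vals w) \in L.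
Proof. by move=> ow; apply: mem_pkey => //; rewrite ?vals_lt ?size_map. Qed.

Lemma pkey_order w n : ~~ odd (size w) -> pkey (vals (flatten (nseq n w))) = id5 ->
  pkey (vals w) != id5 -> is_perm5_order (pkey (vals w)) n.
Proof.
move=> ow wn w1; apply/andP; split=> //; apply/eqP; apply: etrans wn.
elim: n => //= n ->; rewrite vals_cat; apply: esym.
exact: (pkey_cat L_bound _ (mem_pkey_vals ow)).
Qed.

Lemma class5_255 x y : ~~ odd (size x) -> ~~ odd (size y) ->
  pkey (vals (flatten (nseq 2 x))) = id5 -> pkey (vals x) != id5 ->
  pkey (vals (flatten (nseq 5 y))) = id5 -> pkey (vals y) != id5 ->
  pkey (vals (flatten (nseq 5 (x ++ y)))) = id5 -> pkey (vals (x ++ y)) != id5 ->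
  (pkey (vals y) \in class5) != (pkey (vals (x ++ y)) \in class5).
Proof.
move=> ox oy x2 x1 y5 y1 z5 z1.
have oz : ~~ odd (size (x ++ y)) by rewrite size_cat oddD (negbTE ox).
have Ez : pkey (vals (x ++ y)) = comp (pkey (vals x)) (pkey (vals y)).
  by rewrite vals_cat; exact: (pkey_cat L_bound _ (mem_pkey_vals ox)).
have px := pkey_order ox x2 x1; have py := pkey_order oy y5 y1.
have pz := pkey_order oz z5 z1; rewrite Ez in pz *.
have /allP /(_ _ (mem_pkey_vals ox)) /implyP /(_ px) := L_255.
by move=> /allP /(_ _ (mem_pkey_vals oy)) /implyP /(_ py) /implyP /(_ pz).
Qed.
End Class5.

Definition class5_P60 := class5_255 P60_nil P60_bound P60_closed no_255_class5.

(** * Excluding the triples (2,5,5) and (3,3,5) *)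

Section Group9.
Context {R : realType}.
Variable T9 : hsimplex R 3.
Hypothesis hT9 : is_tetrahedron T9 2 3 5 2 3 5.
Notation phi := (@golden R).
Notation n9 := (facet_normal T9).
Notation wd := (cox_word (zmx phi 3 G9)).

Let phi2 := @golden_sqr R.
Let phi_gt0 := @golden_gt0 R.

Lemma rword9_eq1 w : rword n9 w = 1%:M <-> wd w = 1%:M.
Proof. by rewrite rword_eq1 (gram2_T9 hT9). Qed.

Lemma tr_rword9 w : \tr (rword n9 w) = \tr (wd w).
Proof. by rewrite tr_rword (gram2_T9 hT9). Qed.

Lemma order9 w m : ~~ odd (size w) -> (1 < m)%N ->
  (forall l, rword n9 w ^+ l = 1 <-> (m %| l)%N) ->
  m \in [:: 2; 3; 5]%N /\ torsion_spec phi w.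
Proof.
move=> ow m1 ordm.
have wm : wd w ^+ m = 1.
  have : rword n9 w ^+ m = 1 by apply/ordm.
  rewrite rword_exp => /rword9_eq1; rewrite -[1%:M]/(1 : 'M[R]_4) => <-.
  elim: m {m1 ordm} => [|k IH] /=; first by rewrite cox_word_nil.
  by rewrite exprS IH cox_word_cat.
have [w1|spec] := torsion9 phi2 phi_gt0 ow (ltnW m1) wm.
  have /ordm : rword n9 w ^+ 1 = 1 by rewrite expr1; apply/rword9_eq1.
  by rewrite dvdn1 => /eqP m_1; rewrite m_1 in m1.
split=> //; have [_ _ k _] := spec.
have H l : prime l -> wd (flatten (nseq l w)) = 1%:M -> m = l.
  move=> /primeP [_ pl] /rword9_eq1; rewrite -rword_exp => /ordm /pl /orP [] /eqP //.
  by move=> m_1; rewrite m_1 in m1.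
by case: k => k; [rewrite (@H 2) | rewrite (@H 3) | rewrite (@H 5)];
  rewrite //= ?cats0 // inE ?eqxx ?orbT.
Qed.

Lemma tr_class5 w : torsion_spec phi w -> wd (w ++ w ++ w ++ w ++ w) = 1%:M ->
  \tr (wd w) = zval phi (if pkey (vals w) \in class5 then (Zpos 1, Zpos 1) else (Zpos 2, Zneg 1)).
Proof. by move=> [_ _ _ H] /H. Qed.

Lemma rword9_rev w : rword n9 (rev w) *m rword n9 w = 1%:M.
Proof. by have := rword_rev (@facet_normal_unit _ _ T9) (rev w); rewrite revK. Qed.

Section Pair9.
Variables x y : seq 'I_4.
Hypotheses (ox : ~~ odd (size x)) (oy : ~~ odd (size y)).
Let xy := x ++ y.
Let comm := x ++ y ++ rev x ++ rev y.

Let oxy : ~~ odd (size xy).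
Proof. by rewrite size_cat oddD (negbTE ox). Qed.

Lemma pair9_lifts : exists g h, is_lift (rword n9 x) g /\ is_lift (rword n9 y) h.
Proof.
have [g Hg] := lift_rword (@facet_normal_unit _ _ T9) ox.
have [h Hh] := lift_rword (@facet_normal_unit _ _ T9) oy.
by exists g, h.
Qed.

Hypothesis comm3 : rword n9 (comm ++ comm ++ comm) != 1%:M.

Lemma order9_wd w l k : (forall k, rword n9 w ^+ k = 1 <-> (l %| k)%N) -> (l %| k)%N ->
  wd (flatten (nseq k w)) = 1%:M.
Proof. by move=> H /H; rewrite rword_exp => /rword9_eq1. Qed.

Lemma order9_neq1 w l : (1 < l)%N -> (forall k, rword n9 w ^+ k = 1 <-> (l %| k)%N) ->
  rword n9 w != 1%:M.
Proof.
move=> l1 H; apply/eqP => w1; have : rword n9 w ^+ 1 = 1 by rewrite expr1.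
by move/H; rewrite dvdn1 => /eqP E; rewrite E in l1.
Qed.

Lemma wd_pkey1 w : wd w = 1%:M -> pkey (vals w) = id5.
Proof.
by rewrite -(cox_word_nil (zmx phi 3 G9)); exact: (@wd_pkey _ _ phi2 phi_gt0 w [::]).
Qed.

Lemma wd_quo1 w : wd w = 1%:M -> quo_mx w = 1%:M.
Proof.
by rewrite -(cox_word_nil (zmx phi 3 G9)) => /(wd_quo phi2) ->; exact: quo_nil.
Qed.

Lemma comm3E (M := rword n9) : M x *m M y *m M (rev x) *m M (rev y) *m
  (M x *m M y *m M (rev x) *m M (rev y)) *m (M x *m M y *m M (rev x) *m M (rev y)) =
  rword n9 (comm ++ comm ++ comm).
Proof. by rewrite /M /comm !rword_cat !mulmxA. Qed.

Lemma no_255 :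
  (forall l, rword n9 x ^+ l = 1 <-> (2 %| l)%N) ->
  (forall l, rword n9 y ^+ l = 1 <-> (5 %| l)%N) ->
  (forall l, rword n9 xy ^+ l = 1 <-> (5 %| l)%N) -> False.
Proof.
move=> x2 y5 z5; have [g [h [Hg Hh]]] := pair9_lifts.
have [_ sx] := order9 ox (isT : 1 < 2)%N x2.
have [_ sy] := order9 oy (isT : 1 < 5)%N y5.
have [_ sz] := order9 oxy (isT : 1 < 5)%N z5.
have X2 := order9_wd x2 (isT : 2 %| 2)%N; have Y5 := order9_wd y5 (isT : 5 %| 5)%N.
have Z5 := order9_wd z5 (isT : 5 %| 5)%N.
have cl : (pkey (vals y) \in class5) != (pkey (vals xy) \in class5).
  have [x1 _ _ _] := sx; have [y1 _ _ _] := sy; have [z1 _ _ _] := sz.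
  exact: (class5_P60 ox oy (wd_pkey1 X2) x1 (wd_pkey1 Y5) y1 (wd_pkey1 Z5) z1).
rewrite /= !cats0 in X2 Y5 Z5.
have [] := dichotomy_255 phi2 (rword9_rev x) (rword9_rev y) Hg Hh
  (order9_neq1 (isT : 1 < 2)%N x2) (order9_neq1 (isT : 1 < 5)%N y5).
- by rewrite -rword_cat; exact: (order9_neq1 (isT : 1 < 5)%N z5).
- by rewrite -!rword_cat -!catA; apply/rword9_eq1; move: Z5; rewrite /xy -!catA.
- by rewrite -rword_cat; apply/rword9_eq1.
- by rewrite -!rword_cat -!catA; apply/rword9_eq1.
- by rewrite comm3E => H; move: comm3; rewrite H eqxx.
rewrite -rword_cat -/xy !tr_rword9 (tr_class5 sy Y5) (tr_class5 sz Z5).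
move/(zval_inj phi2); move: cl; case: (pkey (vals y) \in class5);
  by case: (pkey (vals xy) \in class5).
Qed.

Lemma no_335 :
  (forall l, rword n9 x ^+ l = 1 <-> (3 %| l)%N) ->
  (forall l, rword n9 y ^+ l = 1 <-> (3 %| l)%N) ->
  (forall l, rword n9 xy ^+ l = 1 <-> (5 %| l)%N) -> False.
Proof.
move=> x3 y3 z5; have [g [h [Hg Hh]]] := pair9_lifts.
have [_ sx] := order9 ox (isT : 1 < 3)%N x3.
have [_ sy] := order9 oy (isT : 1 < 3)%N y3.
have [_ sz] := order9 oxy (isT : 1 < 5)%N z5.
have X3 := order9_wd x3 (isT : 3 %| 3)%N; have Y3 := order9_wd y3 (isT : 3 %| 3)%N.
have Z5 := order9_wd z5 (isT : 5 %| 5)%N.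
have T3 : \tr (quo_mx (x ++ y ++ y)) = 3%:R.
  have [_ x1 _ _] := sx; have [_ y1 _ _] := sy; have [_ z1 _ _] := sz.
  have it k w : iter k (mulmx (quo_mx w)) 1%:M = quo_mx (flatten (nseq k w)).
    by elim: k => [|k IH] /=; rewrite ?quo_nil // quo_cat IH.
  by apply: quo_trace_B60 => //; rewrite it; apply: wd_quo1.
rewrite /= !cats0 in X3 Y3 Z5.
have [] := dichotomy_335 phi2 (rword9_rev x) (rword9_rev y) Hg Hh
  (order9_neq1 (isT : 1 < 3)%N x3) (order9_neq1 (isT : 1 < 3)%N y3).
- by rewrite -rword_cat; exact: (order9_neq1 (isT : 1 < 5)%N z5).
- by rewrite -!rword_cat -!catA; apply/rword9_eq1; move: Z5; rewrite /xy -!catA.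
- by rewrite -!rword_cat -!catA; apply/rword9_eq1.
- by rewrite -!rword_cat -!catA; apply/rword9_eq1.
- by rewrite comm3E => H; move: comm3; rewrite H eqxx.
(* The inverse of [y], of order 3, is rewritten as [y ++ y] to meet the finite check. *)
have yy : rword n9 (rev y) = rword n9 (y ++ y).
  have := rword9_rev y; move: Y3 => /rword9_eq1; rewrite !rword_cat => Y3 E.
  by rewrite -[LHS]mulmx1 -Y3 !mulmxA E mul1mx.
move=> [s sP]; rewrite yy -rword_cat tr_rword9 => trE.
have trZ : \tr (wd (x ++ y ++ y)) = zval phi (ztrace (zword G9 (vals (x ++ y ++ y)))).
  by rewrite -(zmx_word phi2) // zmx_trace ?size_map ?size_iota.
(* These are 3 s + 2 for s = phi and s = 1 - phi. With phi reduced to 3, both become 1 in F_5, so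
   the trace on the quotient would be 0 and not 3. *)
have zt : ztrace (zword G9 (vals (x ++ y ++ y))) \in
    [:: (Zpos 2, Zpos 3); (Zpos 5, Zneg 3)].
  have e1 : zval phi (Zpos 2, Zpos 3) = 2%:~R + 3%:~R * phi by [].
  have e2 : zval phi (Zpos 5, Zneg 3) = 5%:~R + (-3)%:~R * phi by [].
  rewrite !inE; apply/orP; case: sP => sE; [left|right]; apply/eqP;
    apply: (zval_inj phi2); rewrite -trZ trE sE ?e1 ?e2; ring.
have : \tr (cox_word (zmx (3%:R : 'F_5) 3 G9) (x ++ y ++ y)) = 1.
  rewrite -(zmx_word f5_golden) // zmx_trace ?size_map ?size_iota //.
  by move: zt; rewrite !inE => /orP [] /eqP ->; apply/eqP.
by move=> E; move: T3; rewrite quo_trace E subrr => /eqP.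
Qed.
End Pair9.
End Group9.

(** * Turnover subgroups of Gamma_9 *)

Section Triangle.
Context {R : realType}.
Notation phi := (@golden R).

Lemma exact_order n (A : 'M[R]_n.+1) m : (0 < m)%N -> A ^+ m = 1 ->
  (forall l, (0 < l < m)%N -> A ^+ l != 1) -> forall l, A ^+ l = 1 <-> (m %| l)%N.
Proof.
move=> m0 Am An l; split=> [Al|/dvdnP [k ->]]; last by rewrite mulnC exprM Am expr1n.
rewrite /dvdn; apply: contraT => lm; have := An (l %% m)%N.
rewrite lt0n lm ltn_mod m0 => /(_ isT) /eqP []; move: Al.
by rewrite {1}(divn_eq l m) exprD mulnC exprM Am expr1n mul1r.
Qed.

Variable Delta : hsimplex R 2.
Notation uD := (facet_normal Delta).

Lemma rword_order (i j : 'I_3) m : (1 < m)%N -> lorentz (uD i) (uD j) = - cos (pi / m%:R) ->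
  forall l, rword uD [:: i; j] ^+ l = 1 <-> (m %| l)%N.
Proof.
move=> m1 uij; have E : rword uD [:: i; j] = reflection_mx (uD i) * reflection_mx (uD j).
  by rewrite !rword_cons rword_nil mulmx1.
rewrite E; apply: exact_order; first exact: ltnW.
  exact: rotation_pow m1 (facet_normal_unit _ _) (facet_normal_unit _ _) uij.
by move=> l lm; apply: rotation_pow_neq1 m1 (facet_normal_unit _ _) (facet_normal_unit _ _) uij _ lm.
Qed.

Definition tri_gram (c a b : zphi) : seq (seq zphi) :=
  [:: [:: (Zpos 2, Z0); c; b]; [:: c; (Zpos 2, Z0); a]; [:: b; a; (Zpos 2, Z0)]].

Lemma ord3_cases (i : 'I_3) : [\/ i = 0, i = 1 | i = 2].
Proof.
by case: i => [[|[|[|i]]] iP] //; [constructor 1|constructor 2|constructor 3]; exact: val_inj.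
Qed.

Lemma gram2_triangle p q r a b c : (1 < p)%N -> (1 < q)%N -> (1 < r)%N ->
  is_triangle Delta p q r -> - (2 * cos (pi / p%:R)) = zval phi a ->
  - (2 * cos (pi / q%:R)) = zval phi b -> - (2 * cos (pi / r%:R)) = zval phi c ->
  gram2 uD = zmx phi 2 (tri_gram c a b).
Proof.
move=> p1 q1 r1 [/gram2_facet P /gram2_facet Q /gram2_facet S] pa qb rc.
have [P1 P2] := P (ltnW p1); have [Q1 Q2] := Q (ltnW q1); have [S1 S2] := S (ltnW r1).
apply/matrixP => i j; rewrite [RHS]mxE.
by case: (ord3_cases i) => ->; case: (ord3_cases j) => ->;
  rewrite ?gram2_diag ?P1 ?P2 ?Q1 ?Q2 ?S1 ?S2 ?pa ?qb ?rc ?zval2.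
Qed.

(** The commutator of the rotations s_1 s_2 and s_2 s_0. *)
Definition tri_comm : seq 'I_3 := [:: 1; 2; 2; 0; 2; 1; 0; 2].

(** In the basis of its normals the triangle group also has matrices over Z[phi], so a single
    computed entry shows that a word is not the identity. *)
Lemma comm_cube_neq1 G w : size G = 3%N -> gram2 uD = zmx phi 2 G ->
  zentry (zword G [seq val i | i <- w]) 0 0 != z1 -> rword uD w <> 1%:M.
Proof.
move=> sG E /eqP; apply: contra_not => /rword_eq1; rewrite E -(zmx_word golden_sqr) //.
move/matrixP/(_ 0 0); rewrite !mxE eqxx -(zval1 phi) => /(zval_inj golden_sqr) //.
Qed.
End Triangle.

Lemma sorted_triples p q r (R : realType) :
  p \in [:: 2; 3; 5]%N -> q \in [:: 2; 3; 5]%N -> r \in [:: 2; 3; 5]%N ->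
  (p <= q)%N -> (q <= r)%N -> p%:R^-1 + q%:R^-1 + r%:R^-1 < 1 :> R ->
  (p, q, r) \in [:: (2, 5, 5); (3, 3, 5); (3, 5, 5); (5, 5, 5)]%N.
Proof.
rewrite !inE => /or3P [] /eqP -> /or3P [] /eqP -> /or3P [] /eqP -> //= _ _ H; lra.
Qed.

Section Forward.
Context {R : realType}.
Variables (T9 : hsimplex R 3) (Delta : hsimplex R 2) (p q r : nat).
Hypothesis hT9 : is_tetrahedron T9 2 3 5 2 3 5.
Hypotheses (hp : (2 <= p)%N) (hpq : (p <= q)%N) (hqr : (q <= r)%N).
Hypothesis hpqr : p%:R^-1 + q%:R^-1 + r%:R^-1 < 1 :> R.
Hypothesis hDelta : is_triangle Delta p q r.
Hypothesis hcopy : contains_copy_of (rotation_group T9) (rotation_group Delta).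
Notation uD := (facet_normal Delta).
Notation n9 := (facet_normal T9).

(** [x] and [y] correspond to s_1 s_2 and s_2 s_0, whose product s_1 s_0 has order [r]. The last
    clause lets the commutator in Gamma_9 be tested in the triangle group. *)
Lemma turnover_generators : exists x y : seq 'I_4,
  [/\ ~~ odd (size x), ~~ odd (size y) &
    [/\ forall l, rword n9 x ^+ l = 1 <-> (p %| l)%N,
        forall l, rword n9 y ^+ l = 1 <-> (q %| l)%N,
        forall l, rword n9 (x ++ y) ^+ l = 1 <-> (r %| l)%N &
        let c := x ++ y ++ rev x ++ rev y in
        rword n9 (c ++ c ++ c) = 1%:M -> rword uD (tri_comm ++ tri_comm ++ tri_comm) = 1%:M]].
Proof.
have q_gt1 : (1 < q)%N := leq_trans hp hpq.
have r_gt1 : (1 < r)%N := leq_trans q_gt1 hqr.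
have [P Q S] := hDelta.
have ordA := rword_order hp (dihedral_angle_lorentz (ltnW hp) P).
have ordB : forall l, rword uD [:: 2; 0] ^+ l = 1 <-> (q %| l)%N.
  by apply: (rword_order q_gt1); rewrite lorentzC; exact: (dihedral_angle_lorentz (ltnW q_gt1) Q).
have ordC : forall l, rword uD [:: 1; 0] ^+ l = 1 <-> (r %| l)%N.
  by apply: (rword_order r_gt1); rewrite lorentzC; exact: (dihedral_angle_lorentz (ltnW r_gt1) S).
have [H [[HU H1 HM HV] HG [f [fH finj fsurj] fM]]] := hcopy.
have rotD w : ~~ odd (size w) -> rotation_group Delta (rword uD w).
  by move=> ow; apply/rotation_groupP; exists w.
have [X HX fX] := fsurj _ (rotD [:: 1; 2] isT).
have [Y HY fY] := fsurj _ (rotD [:: 2; 0] isT).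
have /rotation_groupP [x ox Xx] := HG _ HX; have /rotation_groupP [y oy Yy] := HG _ HY.
(* [f] is only known to be multiplicative on [H]; units and inverses are recovered by cancelling the
   invertible matrix [f 1]. *)
have f1 : f 1 = 1.
  have /rotation_groupP [w _ fw] := fH _ H1.
  apply: (mulrI (rword_unit (@facet_normal_unit _ _ Delta) w)).
  by rewrite mulr1 -fw -fM // mulr1.
have inj1 Z : H Z -> f Z = 1 -> Z = 1.
  by move=> HZ fZ; apply: finj; rewrite ?inE // f1.
have fpow Z l : H Z -> H (Z ^+ l) /\ f (Z ^+ l) = f Z ^+ l.
  move=> HZ; elim: l => [|l [IH1 IH2]]; first by rewrite !expr0.
  by rewrite !exprS fM // IH2; split=> //; exact: HM.
have ord Z l : H Z -> Z ^+ l = 1 <-> f Z ^+ l = 1.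
  move=> HZ; have [HZl fZl] := fpow Z l HZ; rewrite -fZl; split=> [->//|]; exact: inj1.
have fV Z : H Z -> f Z^-1 = (f Z)^-1.
  move=> HZ; have /rotation_groupP [w _ fw] := fH _ HZ.
  have fu : f Z \is a GRing.unit by rewrite fw rword_unit //; exact: facet_normal_unit.
  apply: (mulrI fu); rewrite divrr // -fM //; last exact: HV.
  by rewrite divrr //; exact: HU.
exists x, y; split=> //; split.
- by move=> l; rewrite -Xx ord // fX.
- by move=> l; rewrite -Yy ord // fY.
- move=> l; rewrite rword_cat -Xx -Yy.
  rewrite (ord (X * Y)); last exact: HM.
  rewrite fM // fX fY -[_ * _]/(_ *m _) -rword_cat.
  have -> : rword uD ([:: 1; 2] ++ [:: 2; 0]) = rword uD [:: 1; 0].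
    by rewrite /= !rword_cons !mulmxA -(mulmxA (reflection_mx (uD 1))) reflection_invol
      ?mulmx1 ?facet_normal_unit.
  exact: ordC.
- move=> c; pose K := X * Y * X^-1 * Y^-1.
  have HXY := HM _ _ HX HY.
  have HXYX := HM _ _ HXY (HV _ HX).
  have HK : H K := HM _ _ HXYX (HV _ HY).
  have u9 := @facet_normal_unit _ _ T9; have u2 := @facet_normal_unit _ _ Delta.
  have cK : rword n9 c = K.
    rewrite /c /K Xx Yy !(rword_inv u9) !rword_cat.
    by rewrite -!mulrA.
  have fK : f K = rword uD tri_comm.
    rewrite /K !fM ?fV //; [|exact: HV|exact: HV].
    rewrite fX fY !(rword_inv u2).
    rewrite -[tri_comm]/([:: 1; 2] ++ [:: 2; 0] ++ rev [:: 1; 2] ++ rev [:: 2; 0]).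
    by rewrite !(rword_cat uD) -!mulrA.
  rewrite (rword_cat n9 c) (rword_cat n9 c c) cK !rword_cat => K3; have := (ord K 3%N HK).1.
  rewrite fK !exprS expr0 !mulr1; apply; exact: K3.
Qed.

Theorem turnover_types : (p, q, r) = (3, 5, 5)%N \/ (p, q, r) = (5, 5, 5)%N.
Proof.
have q_gt1 : (1 < q)%N := leq_trans hp hpq.
have r_gt1 : (1 < r)%N := leq_trans q_gt1 hqr.
have [x [y [ox oy [xp yq zr ck]]]] := turnover_generators.
have oz : ~~ odd (size (x ++ y)) by rewrite size_cat oddD (negbTE ox).
have [p235 _] := order9 hT9 ox hp xp; have [q235 _] := order9 hT9 oy q_gt1 yq.
have [r235 _] := order9 hT9 oz r_gt1 zr.
have [v2 v3 v5] := @cos_values R.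
have neq1 a b c : - (2 * cos (pi / p%:R)) = zval (@golden R) a ->
    - (2 * cos (pi / q%:R)) = zval (@golden R) b ->
    - (2 * cos (pi / r%:R)) = zval (@golden R) c ->
    zentry (zword (tri_gram c a b) [seq val i | i <- tri_comm ++ tri_comm ++ tri_comm]) 0 0
      != z1 ->
    let k := x ++ y ++ rev x ++ rev y in rword n9 (k ++ k ++ k) != 1%:M.
  move=> pa qb rc e /=; apply/eqP => /ck; apply: comm_cube_neq1 e => //.
  exact: (gram2_triangle hp q_gt1 r_gt1).
have := sorted_triples p235 q235 r235 hpq hqr hpqr.
rewrite !inE => /or4P [] /eqP E; [| |by left|by right]; exfalso;
  move: E xp yq zr neq1 => [-> -> ->] xp yq zr neq1.
  by refine (no_255 hT9 ox oy (neq1 _ _ _ v2 v5 v5 _) xp yq zr); vm_compute.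
by refine (no_335 hT9 ox oy (neq1 _ _ _ v3 v3 v5 _) xp yq zr); vm_compute.
Qed.
End Forward.

(** * Existence *)

Section ExistsTriangle.
Context {R : realType}.

Definition rv3 (x y z : R) : 'rV[R]_3 := \row_i [:: x; y; z]`_i.

Lemma lorentz3 x y z x' y' z' :
  lorentz (rv3 x y z) (rv3 x' y' z') = - (x * x') + y * y' + z * z'.
Proof. by rewrite /lorentz !big_ord_recl big_ord0 !mxE /= addr0 addrA. Qed.

Lemma sin_pi_div m : (1 < m)%N -> 0 < sin (pi / m%:R : R).
Proof. by move=> m1; exact: sin_gt0_pi (pi_div_bounds m1). Qed.

Section Build.
Variables p q r : nat.
Hypotheses (p1 : (1 < p)%N) (q1 : (1 < q)%N) (r1 : (1 < r)%N).
Let a : R := cos (pi / p%:R).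
Let b : R := cos (pi / q%:R).
Let c : R := cos (pi / r%:R).
Let s : R := sin (pi / r%:R).
Hypothesis D0 : 0 < a ^+ 2 + b ^+ 2 + c ^+ 2 + 2 * a * b * c - 1.
Hypotheses (abc : 0 < a + b * c) (bac : 0 < b + a * c).

Let t : R := Num.sqrt (a ^+ 2 + b ^+ 2 + c ^+ 2 + 2 * a * b * c - 1) / s.
Let e : R := (a + b * c) / s.
Let sp : R := sin (pi / p%:R).
Let sq : R := sin (pi / q%:R).

Let s0 : 0 < s. Proof. exact: sin_pi_div. Qed.
Let sp0 : 0 < sp. Proof. exact: sin_pi_div. Qed.
Let sq0 : 0 < sq. Proof. exact: sin_pi_div. Qed.
Let t0 : 0 < t. Proof. by rewrite divr_gt0 // sqrtr_gt0. Qed.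

Let s2 : s ^+ 2 = 1 - c ^+ 2. Proof. exact: sin2cos2. Qed.
Let t2 : t ^+ 2 = (a ^+ 2 + b ^+ 2 + c ^+ 2 + 2 * a * b * c - 1) / s ^+ 2.
Proof. by rewrite exprMn sqr_sqrtr ?exprVn // ltW. Qed.

(** Vertex 2 is placed at (1,0,0), so the first two normals have no time coordinate. In the third,
    [e] solves the product with the second and [t] makes the norm 1; [t] is real because the
    quantity in [D0] is minus the determinant of the Gram matrix. *)
Definition tri_normal (i : 'I_3) : 'rV[R]_3 :=
  nth 0 [:: rv3 0 1 0; rv3 0 (- c) s; rv3 t (- b) (- e)] i.

Definition tri_vertex (i : 'I_3) : 'rV[R]_3 :=
  nth 0 [:: rv3 ((b + a * c) / s / sp) (- (s * t / sp)) (- (c * t / sp));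
            rv3 (e / sq) 0 (- (t / sq)); rv3 1 0 0] i.

Lemma tri_normal_gram : [/\ lorentz (tri_normal 1) (tri_normal 2) = - a,
  lorentz (tri_normal 0) (tri_normal 2) = - b, lorentz (tri_normal 0) (tri_normal 1) = - c &
  forall i, lorentz (tri_normal i) (tri_normal i) = 1].
Proof.
have sn0 := lt0r_neq0 s0; split; rewrite ?lorentz3.
- by rewrite /e; field.
- by ring.
- by ring.
move=> i; case: (ord3_cases i) => ->; rewrite lorentz3; first by ring.
  by rewrite mulr0 oppr0 add0r mulrNN -!expr2 s2; ring.
have -> : - (t * t) + - b * - b + - e * - e = - t ^+ 2 + b ^+ 2 + e ^+ 2 by ring.
rewrite t2 /e; apply: (mulIf (expf_neq0 2 sn0)); rewrite mul1r.
transitivity (- (a ^+ 2 + b ^+ 2 + c ^+ 2 + 2 * a * b * c - 1) + b ^+ 2 * s ^+ 2 + (a + b * c) ^+ 2).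
  by field.
rewrite s2; ring.
Qed.

Lemma tri_vertex_hyperbolic i : hyperbolic_space (tri_vertex i).
Proof.
have sn0 := lt0r_neq0 s0; have spn := lt0r_neq0 sp0; have sqn := lt0r_neq0 sq0.
have s2n : s ^+ 2 != 0 by rewrite expf_neq0.
have sp2n : sp ^+ 2 != 0 by rewrite expf_neq0.
have sq2n : sq ^+ 2 != 0 by rewrite expf_neq0.
case: (ord3_cases i) => ->; split; rewrite ?lorentz3 ?mxE /=.
- have sp2 : sp ^+ 2 = 1 - a ^+ 2 by exact: sin2cos2.
  have -> : - ((b + a * c) / s / sp * ((b + a * c) / s / sp)) +
      - (s * t / sp) * - (s * t / sp) + - (c * t / sp) * - (c * t / sp) =
      (- (b + a * c) ^+ 2 / s ^+ 2 + (s ^+ 2 + c ^+ 2) * t ^+ 2) / sp ^+ 2.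
    by field; rewrite spn sn0.
  apply: (mulIf sp2n); rewrite divfK // t2 s2 subrK mul1r -mulrDl -s2.
  by apply: (mulIf s2n); rewrite divfK // mulN1r sp2 s2; ring.
- by rewrite !divr_gt0.
- have sq2 : sq ^+ 2 = 1 - b ^+ 2 by exact: sin2cos2.
  have -> : - (e / sq * (e / sq)) + 0 * 0 + - (t / sq) * - (t / sq) =
    (- e ^+ 2 + t ^+ 2) / sq ^+ 2 by field.
  apply: (mulIf sq2n); rewrite divfK // t2 /e exprMn exprVn -mulNr -mulrDl.
  by apply: (mulIf s2n); rewrite divfK // mulN1r sq2 s2; ring.
- by rewrite !divr_gt0.
- by ring.
- exact: ltr01.
Qed.

Lemma tri_outward i : [/\ lorentz (tri_normal i) (tri_normal i) = 1,
  (forall j, j != i -> lorentz (tri_normal i) (tri_vertex j) = 0) &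
  lorentz (tri_normal i) (tri_vertex i) < 0].
Proof.
have sn0 := lt0r_neq0 s0; have spn := lt0r_neq0 sp0; have sqn := lt0r_neq0 sq0.
have [_ _ _ nn] := tri_normal_gram.
split; first exact: nn.
  move=> j; case: (ord3_cases i) => ->; case: (ord3_cases j) => -> // _; rewrite lorentz3.
  - by ring.
  - by ring.
  - by ring.
  - by ring.
  - have e1 : (b + a * c) / s = b * s + e * c.
      apply: (mulIf sn0); transitivity (b * s ^+ 2 + (a + b * c) * c); last by rewrite /e; field.
      by rewrite divfK // s2; ring.
    rewrite e1; ring.
  - by ring.
case: (ord3_cases i) => ->; rewrite lorentz3.
- have -> : - (0 * ((b + a * c) / s / sp)) + 1 * - (s * t / sp) + 0 * - (c * t / sp) =
    - (s * t / sp) by ring.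
  by rewrite oppr_lt0; apply: divr_gt0; [exact: mulr_gt0 s0 t0 | done].
- have -> : - (0 * (e / sq)) + - c * 0 + s * - (t / sq) = - (s * t / sq) by ring.
  by rewrite oppr_lt0; apply: divr_gt0; [exact: mulr_gt0 s0 t0 | done].
- by rewrite mulr1 !mulr0 !addr0 oppr_lt0.
Qed.

Lemma tri_vertex_free : row_free (\matrix_i tri_vertex i).
Proof.
set M := \matrix_i tri_vertex i.
have E : rows_mx tri_normal *m (lorentz_mx *m M^T) =
    diag_mx (\row_i lorentz (tri_normal i) (tri_vertex i)).
  apply/matrixP => i j; rewrite mulmxA [LHS]mxE [RHS]mxE.
  have -> : (\row_i lorentz (tri_normal i) (tri_vertex i)) 0 i *+ (i == j) =
            lorentz (tri_normal i) (tri_vertex j).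
    have [_ Z _] := tri_outward i; rewrite mxE; have [->|ij] := eqVneq i j; first by rewrite mulr1n.
    by rewrite mulr0n Z // eq_sym.
  rewrite lorentz_mxE mxE; apply: eq_bigr => k _; congr (_ * _); last by rewrite !mxE.
  by rewrite -(row_rows_mx tri_normal i) -row_mul [RHS]mxE.
rewrite row_free_unit -unitmx_tr.
have : rows_mx tri_normal *m (lorentz_mx *m M^T) \in unitmx.
  rewrite E unitmxE det_diag unitfE; apply/prodf_neq0 => i _; rewrite mxE.
  by have [_ _ lt] := tri_outward i; rewrite lt_eqF.
by rewrite !unitmx_mul => /and3P [].
Qed.

Lemma exists_triangle : exists Delta : hsimplex R 2, is_triangle Delta p q r.
Proof.
pose Delta := HSimplex tri_vertex_hyperbolic tri_vertex_free.
have nE i : facet_normal Delta i = tri_normal i.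
  by apply: outward_normal_unique; exact: tri_outward.
have [e12 e02 e01 _] := tri_normal_gram.
have ac m : (1 < m)%N -> acos (- - cos (pi / m%:R)) = pi / m%:R :> R.
  move=> m1; rewrite opprK cosK // in_itv /=.
  by have /andP [/ltW -> /ltW ->] := pi_div_bounds m1 (R := R).
by exists Delta; split; rewrite /dihedral_angle !nE (e12, e02, e01) ac.
Qed.
End Build.
End ExistsTriangle.

Lemma mul_gram2 (R : realType) n k (w : 'I_k.+1 -> 'rV[R]_n.+1) (d : 'rV[R]_k.+1) i :
  (d *m gram2 w) 0 i = 2 * lorentz (d *m rows_mx w) (w i).
Proof.
rewrite (mulmx_sum_row d (rows_mx w)) lorentz_suml mulr_sumr mxE; apply: eq_bigr => l _.
by rewrite row_rows_mx lorentzZl mxE; ring.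
Qed.

Lemma mul_rows_lorentz (R : realType) n k (w : 'I_k.+1 -> 'rV[R]_n.+1) x i :
  (x *m lorentz_mx *m (rows_mx w)^T) 0 i = lorentz x (w i).
Proof.
by rewrite lorentz_mxE !mxE; apply: eq_bigr => l _; congr (_ * _); rewrite !mxE.
Qed.

Lemma gram2_facet_inj (R : realType) n (T : hsimplex R n.+1) (d : 'rV[R]_n.+2) :
  d *m gram2 (facet_normal T) = 0 -> d = 0.
Proof.
move=> d0; have U := facet_normal_basis T.
have Lu : lorentz_mx *m (rows_mx (facet_normal T))^T \in unitmx.
  by rewrite unitmx_mul lorentz_mx_unit unitmx_tr.
suff H : d *m rows_mx (facet_normal T) *m (lorentz_mx *m (rows_mx (facet_normal T))^T) = 0.
  by rewrite -[d](mulmxK U) -[d *m _](mulmxK Lu) H !mul0mx.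
rewrite mulmxA; apply/rowP => i; rewrite mul_rows_lorentz.
have := congr1 (fun M : 'rV[R]_n.+2 => M 0 i) d0; rewrite mul_gram2 !mxE => /eqP.
by rewrite mulf_eq0 pnatr_eq0 /= => /eqP.
Qed.

(** * Copies of triangle groups generated by three roots *)

Section Embedding.
Context {R : realType} {n : nat}.
Variable Delta : hsimplex R 2.
Notation u := (facet_normal Delta).
Variable v : 'I_3 -> 'rV[R]_n.+1.
Hypothesis uv : forall i j, lorentz (v i) (v j) = lorentz (u i) (u j).

Let v_unit i : lorentz (v i) (v i) = 1.
Proof. by rewrite uv facet_normal_unit. Qed.

Let gram_uv : gram2 v = gram2 u.
Proof. by apply/matrixP => i j; rewrite !mxE uv. Qed.

Lemma rword_span w : exists C : 'M[R]_(n.+1, 3), rword v w = 1%:M + C *m rows_mx v.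
Proof.
elim: w => [|i w [C IH]]; first by exists 0; rewrite rword_nil mul0mx addr0.
have [D ED] : exists D : 'M[R]_(n.+1, 3), reflection_mx (v i) = 1%:M + D *m rows_mx v.
  exists (- (2 *: (lorentz_mx *m (v i)^T)) *m vec i).
  by rewrite reflection_mxE -mulmxA -[vec i *m _]rowE row_rows_mx mulNmx.
exists (D + C + D *m rows_mx v *m C); rewrite rword_cons IH ED.
by rewrite mulmxDl mul1mx mulmxDr mulmx1 !mulmxDl !mulmxA -!addrA; congr (_ + _); rewrite addrCA.
Qed.

(* A product of reflections in the v_i moves every vector by an element of their span,
   on which the Gram matrix is nondegenerate. *)
Lemma rword_rows_inj w : rows_mx v *m rword v w = rows_mx v -> rword v w = 1%:M.
Proof.
move=> fixv; have [C E] := rword_span w.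
apply: eq_mulmx_row => x; rewrite E mulmxDr mulmx1 mulmxA.
suff -> : x *m C = 0 by rewrite mul0mx addr0.
apply: (@gram2_facet_inj _ _ Delta); rewrite -gram_uv; apply/rowP => i; rewrite mul_gram2 mxE.
have vi : v i *m rword v w = v i.
  by rewrite -(row_rows_mx v i) -row_mul fixv.
have -> : x *m C *m rows_mx v = x *m rword v w - x.
  by rewrite E mulmxDr mulmx1 mulmxA addrAC subrr add0r.
by rewrite lorentzDl lorentzNl -{1}vi (lorentz_rword v_unit) subrr mulr0.
Qed.

(** [J] is the isometric embedding taking each [u i] to [v i]. [J'] is its adjoint for the two
    Lorentz forms, so that [J *m J'] is the identity. *)
Let J : 'M[R]_(3, n.+1) := invmx (rows_mx u) *m rows_mx v.
Let J' : 'M[R]_(n.+1, 3) := lorentz_mx *m J^T *m lorentz_mx.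

Lemma embed_rword w : J *m rword v w = rword u w *m J.
Proof.
rewrite /J rword_cox -[LHS]mulmxA (rows_mx_word v) gram_uv !mulmxA.
by rewrite mulmxK // facet_normal_basis.
Qed.

Lemma embed_lorentz x y : lorentz (x *m J) (y *m J) = lorentz x y.
Proof.
have U := facet_normal_basis Delta.
have H d d' : lorentz (d *m rows_mx v) (d' *m rows_mx v) =
              lorentz (d *m rows_mx u) (d' *m rows_mx u).
  rewrite (mulmx_sum_row d' (rows_mx v)) (mulmx_sum_row d' (rows_mx u)).
  rewrite !(lorentzC (d *m _)) !lorentz_suml; apply: eq_bigr => i _.
  rewrite !row_rows_mx !lorentzZl; congr (_ * _); rewrite ![lorentz _ (d *m _)]lorentzC.
  have two : (2 : R) != 0 by rewrite pnatr_eq0.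
  by apply: (mulfI two); rewrite -!mul_gram2 gram_uv.
by rewrite /J !mulmxA H !mulmxKV.
Qed.

Lemma embed_inv : J *m J' = 1%:M.
Proof.
apply: (can_inj (mulmxK (@lorentz_mx_unit R 2))).
have LL : lorentz_mx *m lorentz_mx = 1%:M :> 'M[R]_3.
  apply: eq_mulmx_row => x; rewrite mulmxA mulmx1; apply/rowP => i.
  by rewrite !mul_lorentz_mx; case: (i == ord0); rewrite ?opprK.
rewrite mul1mx /J' !mulmxA -(mulmxA _ lorentz_mx lorentz_mx) LL mulmx1.
have ent (A : 'M[R]_3) i j : A i j = (vec i *m A *m (vec j)^T) 0 0.
  by rewrite -rowE trmx_delta -colE !mxE.
apply/matrixP => i j; rewrite [LHS]ent [RHS]ent -lorentz_mxE -embed_lorentz lorentz_mxE.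
by rewrite !trmx_mul !mulmxA.
Qed.

Variable G : set 'M[R]_n.+1.
Hypothesis G_words : forall w, ~~ odd (size w) -> G (rword v w).

(** The isomorphism is the compression [J *m M *m J'], which sends a word in the [v]-reflections to
    the same word in the [u]-reflections; it is injective because the Gram matrix of the roots is
    nondegenerate. *)
Theorem contains_triangle_copy : contains_copy_of G (rotation_group Delta).
Proof.
exists [set M | exists2 w, ~~ odd (size w) & M = rword v w]%classic; split.
- split=> [M [w _ ->]||_ _ [w ow ->] [w' ow' ->]|_ [w ow ->]].
  + exact: rword_unit.
  + by exists [::]; rewrite ?rword_nil.
  + by exists (w ++ w'); rewrite ?rword_cat // size_cat oddD (negbTE ow).
  + by exists (rev w); rewrite ?size_rev // rword_inv.
- by move=> _ [w ow ->]; exact: G_words.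
have fE w : J *m rword v w *m J' = rword u w.
  by rewrite embed_rword -mulmxA embed_inv mulmx1.
have uu := @facet_normal_unit _ _ Delta.
exists (fun M => J *m M *m J').
  split.
  - by move=> _ [w ow ->]; apply/rotation_groupP; exists w.
  - move=> _ _ /set_mem [w ow ->] /set_mem [w' ow' ->]; rewrite !fE => E.
    suff H : rword v (w ++ rev w') = 1%:M.
      move: H; rewrite rword_cat -(rword_inv v_unit) => H.
      by apply: (mulIr (_ : (rword v w')^-1 \is a GRing.unit));
         rewrite ?unitrV ?rword_unit // divrr ?rword_unit.
    apply: rword_rows_inj; rewrite (rows_mx_word v) gram_uv cox_rword rword_cat E.
    by rewrite (rword_rev uu) mulmx1 mulmxV ?facet_normal_basis // mul1mx.
  - move=> M /rotation_groupP [w ow ->].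
    by exists (rword v w); [exists w | exact: fE].
move=> _ _ [w ow ->] [w' ow' ->].
by rewrite -[_ * _]/(_ *m _) -rword_cat !fE rword_cat.
Qed.
End Embedding.

Lemma reflection_conj (R : realType) n (x y : 'rV[R]_n.+1) : lorentz y y = 1 ->
  reflection_mx (x *m reflection_mx y) =
  reflection_mx y *m reflection_mx x *m reflection_mx y.
Proof.
move=> y1; apply: eq_mulmx_row => v.
rewrite !mulmxA [LHS]mul_reflection_mx [in RHS](mul_reflection_mx (v *m _)).
rewrite mulmxBl -scalemxAl -[v *m _ *m _]mulmxA reflection_invol // mulmx1.
congr (_ - (2 * _) *: _).
by rewrite -[LHS](lorentz_reflection _ _ y1) -mulmxA reflection_invol // mulmx1.
Qed.

(** * The subgroups T(3,5,5) and T(5,5,5) *)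

Section Existence.
Context {R : realType}.
Variable T9 : hsimplex R 3.
Hypothesis hT9 : is_tetrahedron T9 2 3 5 2 3 5.
Notation n9 := (facet_normal T9).
Notation phi := (@golden R).

Let n9_unit := @facet_normal_unit _ _ T9.

Lemma turnover_of_reflections p q r (v : 'I_3 -> 'rV[R]_4) (sigma : 'I_3 -> seq 'I_4) :
  (1 < p)%N -> (1 < q)%N -> (1 < r)%N ->
  (exists Delta : hsimplex R 2, is_triangle Delta p q r) ->
  (forall i, lorentz (v i) (v i) = 1) ->
  lorentz (v 1) (v 2) = - cos (pi / p%:R) -> lorentz (v 0) (v 2) = - cos (pi / q%:R) ->
  lorentz (v 0) (v 1) = - cos (pi / r%:R) ->
  (forall i, reflection_mx (v i) = rword n9 (sigma i)) -> (forall i, odd (size (sigma i))) ->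
  has_turnover_subgroup (rotation_group T9) p q r.
Proof.
move=> p1 q1 r1 [Delta hD] v1 v12 v02 v01 vs os; exists Delta => //.
have [/(dihedral_angle_lorentz (ltnW p1)) P /(dihedral_angle_lorentz (ltnW q1)) Q
  /(dihedral_angle_lorentz (ltnW r1)) S] := hD.
apply: (@contains_triangle_copy _ _ _ v) => [i j|w ow].
  case: (ord3_cases i) => ->; case: (ord3_cases j) => ->;
    rewrite ?v1 ?facet_normal_unit ?v01 ?v02 ?v12 ?P ?Q ?S //;
    by rewrite lorentzC ?v01 ?v02 ?v12 [RHS]lorentzC ?P ?Q ?S.
apply/rotation_groupP; exists (flatten [seq sigma i | i <- w]).
  suff -> : odd (size (flatten [seq sigma i | i <- w])) = odd (size w) by [].
  by elim: w {ow} => //= i w IH; rewrite size_cat oddD os IH.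
elim: w {ow} => [|i w IH]; first by rewrite !rword_nil.
by rewrite /= rword_cons rword_cat IH vs.
Qed.

Lemma lorentz9 : [/\ lorentz (n9 0) (n9 1) = 0, lorentz (n9 2) (n9 3) = 0,
  lorentz (n9 0) (n9 3) = - (1 / 2) & lorentz (n9 1) (n9 2) = - (1 / 2)] /\
  lorentz (n9 0) (n9 2) = - (phi / 2) /\ lorentz (n9 1) (n9 3) = - (phi / 2).
Proof.
pose L i j m m0 := @dihedral_angle_lorentz R 2 T9 i j m m0.
have [[/(L _ _ 2%N isT) CD /(L _ _ 3%N isT) AD /(L _ _ 5%N isT) BD]] := hT9.
move=> [/(L _ _ 2%N isT) AB /(L _ _ 3%N isT) BC /(L _ _ 5%N isT) AC].
by rewrite CD AD BD AB BC AC cos_pihalf cos_pi3 golden_cos oppr0.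
Qed.

Lemma golden_gt1 : 1 < phi.
Proof.
rewrite ltNge; apply/negP => H; have := @golden_sqr R; have := @golden_gt0 R.
move=> g0 gg; have : phi * phi <= phi by rewrite ler_piMr // ltW.
by rewrite gg gerDl ler10.
Qed.

Lemma turnover_355 : has_turnover_subgroup (rotation_group T9) 3 5 5.
Proof.
have [[AB CD AD BC] [AC BD]] := lorentz9; have g1 := golden_gt1; have gg := @golden_sqr R.
pose v (i : 'I_3) := nth 0 [:: n9 2; n9 3 *m reflection_mx (n9 1); n9 0] i.
pose sigma (i : 'I_3) : seq 'I_4 := nth [::] [:: [:: 2]; [:: 1; 3; 1]; [:: 0]] i.
(* In this form the products with the normals of A and C are read off as -1/2 and -phi/2. *)
have v1E : v 1 = n9 3 + phi *: n9 1.
  rewrite /v /= mul_reflection_mx lorentzC BD -scaleNr; congr (_ + _ *: _); by field.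
apply: (@turnover_of_reflections 3 5 5 v sigma) => //.
- apply: exists_triangle => //; rewrite ?cos_pi3 ?golden_cos; nra.
- move=> i; case: (ord3_cases i) => ->; rewrite /v /= ?lorentz_reflection //; exact: n9_unit.
- by rewrite v1E /v /= lorentzDl lorentzZl lorentzC AD lorentzC AB cos_pi3; ring.
- by rewrite /v /= lorentzC AC golden_cos.
- by rewrite v1E /v /= lorentzDr lorentzZr CD (lorentzC (n9 2)) BC golden_cos; field.
- move=> i; case: (ord3_cases i) => ->; rewrite /v /sigma /= ?reflection_conj //;
    by rewrite !rword_cons rword_nil !mulmx1 ?mulmxA.
- by move=> i; case: (ord3_cases i) => ->.
Qed.

Lemma turnover_555 : has_turnover_subgroup (rotation_group T9) 5 5 5.
Proof.
have [[AB CD AD BC] [AC BD]] := lorentz9; have g1 := golden_gt1; have gg := @golden_sqr R.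
pose x := n9 3 *m reflection_mx (n9 0) *m reflection_mx (n9 2) *m reflection_mx (n9 1).
pose v (i : 'I_3) := nth 0 [:: n9 2; x; n9 0] i.
pose sigma (i : 'I_3) : seq 'I_4 := nth [::] [:: [:: 2]; [:: 1; 2; 0; 3; 0; 2; 1]; [:: 0]] i.
(* From these coefficients the product with the normal of A is -1/2 + 1 - phi^2/2 = -phi/2, and that
   with the normal of C is -phi/2 + phi - phi = -phi/2. *)
have xE : x = n9 3 + n9 0 + phi *: n9 2 + (2 * phi) *: n9 1.
  have E0 : n9 3 *m reflection_mx (n9 0) = n9 3 + n9 0.
    by rewrite mul_reflection_mx lorentzC AD -scaleNr (_ : - _ = 1) ?scale1r //; field.
  have E2 : (n9 3 + n9 0) *m reflection_mx (n9 2) = n9 3 + n9 0 + phi *: n9 2.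
    rewrite mul_reflection_mx lorentzDl (lorentzC (n9 3)) CD AC -scaleNr.
    by congr (_ + _ *: _); field.
  rewrite /x E0 E2 mul_reflection_mx !lorentzDl lorentzZl (lorentzC (n9 3)) BD AB.
  by rewrite (lorentzC (n9 2)) BC -scaleNr; congr (_ + _ *: _); field.
apply: (@turnover_of_reflections 5 5 5 v sigma) => //.
- apply: exists_triangle => //; rewrite ?golden_cos; nra.
- move=> i; case: (ord3_cases i) => ->; rewrite /v /= /x ?lorentz_reflection //; exact: n9_unit.
- rewrite /v /= xE !lorentzDl !lorentzZl (lorentzC (n9 3)) AD n9_unit (lorentzC (n9 2)) AC.
  rewrite (lorentzC (n9 1)) AB golden_cos mulr0 addr0.
  have -> : phi * - (phi / 2) = - (phi * phi) / 2 by field.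
  by rewrite gg; field.
- by rewrite /v /= lorentzC AC golden_cos.
- rewrite /v /= xE !lorentzDr !lorentzZr CD (lorentzC (n9 2) (n9 0)) AC n9_unit.
  rewrite (lorentzC (n9 2)) BC golden_cos; by field.
- move=> i; case: (ord3_cases i) => ->; rewrite /v /sigma /= /x ?reflection_conj //;
    by rewrite !rword_cons rword_nil !mulmx1 ?mulmxA.
- by move=> i; case: (ord3_cases i) => ->.
Qed.
End Existence.

Theorem proposition9p3 (R : realType) (T9 : hsimplex R 3)
    (hT9 : is_tetrahedron T9 2 3 5 2 3 5)
    (p q r : nat) (hp : (2 <= p)%N) (hpq : (p <= q)%N) (hqr : (q <= r)%N)
    (hpqr : p%:R^-1 + q%:R^-1 + r%:R^-1 < 1 :> R) :
  has_turnover_subgroup (rotation_group T9) p q r <->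
  (p, q, r) = (3, 5, 5)%N \/ (p, q, r) = (5, 5, 5)%N.
Proof.
split=> [[Delta hDelta hcopy]|].
  exact: (turnover_types hT9 hp hpq hqr hpqr hDelta hcopy).
by case=> -[-> -> ->]; [exact: turnover_355 | exact: turnover_555].
Qed.
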